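(* Let $\rho_0\in\mathcal P^\circ(G)$, $N\in\mathbb N_+$, $\tau=T/N$, $t_n=n\tau$, and let Assumptions (P) and (L) of the context hold for $\mathcal H,\mathcal F,\mathcal U_T,\mathcal L$. Consider the scheme $$\text{(S)}\quad\begin{cases}\rho^0=\rho_0,\qquad\phi^N=D_\rho\mathcal U_T(\rho^N),\\ \dfrac{\phi^{n+1}-\phi^n}{\tau}=D_\rho\mathcal H(\rho^{n+1},-\nabla_G\phi^n)+D_\rho\mathcal F(\rho^{n+1})-\Delta_G\phi^n,\\[2mm] \dfrac{\rho^{n+1}-\rho^n}{\tau}=-\operatorname{div}_GD_q\mathcal H(\rho^{n+1},-\nabla_G\phi^n)+\Delta_G\rho^{n+1},\end{cases}\qquad 0\le n\le N-1,$$ a solution being called interior if $\rho^n\in\mathcal P^\circ(G)$ for all $0\le n\le N$, and the minimization problem $$\text{(M)}\quad\min\bigl\{\mathcal A_\tau(\rho,m):\ \rho\in\mathcal P(G)^{N+1},\ m\in(\mathbb S^{d\times d})^N,\ \rho^0=\rho_0,\ \Gamma^n(\rho,m)=0\ (0\le n<N)\bigr\},$$ with $\mathcal A_\tau$ and $\Gamma^n$ defined in the context. Then: (i) Problem (M) has a unique minimizer $(\rho_*,m_* )$, and $\rho_*^n\in\mathcal P^\circ(G)$ for every $n$. (ii) There are unique Lagrange multipliers $\phi^0,\dots,\phi^{N-1}\in\mathbb R_0^d$ such that $(\rho_*,m_*,\phi)$ satisfies the KKT conditions (see context). Set $\phi^N=D_\rho\mathcal U_T(\rho_*^N)$. There are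 unique constants $a_0,\dots,a_{N-1}\in\mathbb R$ such that, with $a_N=0$ and $\widehat\phi^n=\phi^n+a_n\mathbf 1$ for $0\le n\le N$, the pair $(\widehat\phi,\rho_* )$ solves (S). (iii) Conversely, every interior solution $(\phi,\rho)$ of (S) generates the unique minimizer of (M): with $$w^{n+1}=D_q\mathcal H(\rho^{n+1},-\nabla_G\phi^n),\qquad m^{n+1}=w^{n+1}-\nabla_G\rho^{n+1},\qquad 0\le n<N,$$ the pair $(\rho,m)$ is the minimizer of (M). In particular, (S) has an interior solution. If, in addition, Assumption (A) of the context holds for $\boldsymbol H(\rho,p)=D_\rho\mathcal H(\rho,-p)+D_\rho\mathcal F(\rho)$, $\boldsymbol B(\rho,p)=-D_q\mathcal H(\rho,-p)$, $g=D_\rho\mathcal U_T$, and $\rho_0\in\mathcal P_\epsilon$ for some $\epsilon\in(0,1/d)$, then this solution satisfies $$\min_{0\le n\le N}\min_i\rho_i^n\ge\delta_T,\qquad \max_{0\le n\le N}\bigl(\|\phi^n\|_{\ell^\infty}+\|\nabla_G\phi^n\|_{\ell^\infty(E)}\bigr)\le C_T,$$ and, for $0<\tau\le\tau_0$, $$\max_{0\le n\le N}\bigl(\|\rho(t_n)-\rho^n\|+\|\phi(t_n)-\phi^n\|\bigr)+\Bigl(\tau\sum_{n=0}^{N-1}\|\nabla_G\phi(t_n)-\nabla_G\phi^n\|_E^2\Bigr)^{1/2}\le\widetilde C_T\,\tau,$$ with constants $\delta_T,C_T,\tau_0,\widetilde C_T>0$ that may depend on $G$, the problem data, $\epsilon$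 and $T$ but are independent of $N$ and $\tau$, where $(\phi(\cdot),\rho(\cdot))$ is the exact solution described in the context.
   Context: Graph notation. $G=(V,E,\omega)$ is a finite connected undirected graph without self-loops, $V=\{1,\dots,d\}$, $d\ge2$; $E\subset V\times V$ contains both orientations of each edge; $\omega=(\omega_{ij})$ is symmetric with $\omega_{ij}>0$ for $(i,j)\in E$ and $\omega_{ij}=0$ otherwise; $j\sim i$ means $(i,j)\in E$; $\mathbf 1=(1,\dots,1)^T$. On $\mathbb R^d$: $(x,y)=\sum_i x_iy_i$, $\|x\|=(x,x)^{1/2}$, $\|x\|_{\ell^\infty}=\max_i|x_i|$. $\mathbb S^{d\times d}$ is the space of skew-symmetric matrices $p$ with $p_{ij}=0$ for $(i,j)\notin E$, with $(p,q)_E=\frac12\sum_{(i,j)\in E}p_{ij}q_{ij}$, $\|p\|_E=(p,p)_E^{1/2}$, $\|p\|_{\ell^\infty(E)}=\max_{(i,j)\in E}|p_{ij}|$. Define $(\nabla_Gu)_{ij}=\sqrt{\omega_{ij}}(u_i-u_j)$, $(\operatorname{div}_Gq)_i=-\sum_{j\sim i}\sqrt{\omega_{ij}}\,q_{ij}$, $\Delta_G=\operatorname{div}_G\nabla_G$, i.e. $(\Delta_Gu)_i=\sum_{j\sim i}\omega_{ij}(u_j-u_i)$. $\mathcal P(G)=\{\xi\in[0,1]^d:\sum_i\xi_i=1\}$, $\mathcal P^\circ(G)=\{\xi\in\mathcal P(G):\xi_i>0\ \forall i\}$, $\mathcal P_\epsilon=\{\xi\in\mathcal P(G):\xi_i\ge\epsilon\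 \forall i\}$, $\mathbb R_0^d=\{\eta\in\mathbb R^d:\sum_i\eta_i=0\}$. $T>0$ is fixed. Derivatives. $D_q,D_w$ of scalar functions are represented by elements of $\mathbb S^{d\times d}$ via $(\cdot,\cdot)_E$. Density derivatives of scalar functions on the simplex are linear functionals on $\mathbb R_0^d$; whenever $D_\rho\mathcal H,D_\rho\mathcal L,D_\rho\mathcal F,D_\rho\mathcal U_T$ are written as vectors in $\mathbb R^d$, smooth extensions to a neighborhood of the simplex are fixed once and for all (different extensions change the vector only by a multiple of $\mathbf 1$). Data: $\mathcal H:\mathcal P^\circ(G)\times\mathbb S^{d\times d}\to\mathbb R$, $\mathcal F,\mathcal U_T:\mathcal P(G)\to\mathbb R$, $\mathcal L:\mathcal P(G)\times\mathbb S^{d\times d}\to\mathbb R\cup\{+\infty\}$, related by $\mathcal H(\rho,q)=\sup_{w\in\mathbb S^{d\times d}}\{(w,q)_E-\mathcal L(\rho,w)\}$ for $\rho\in\mathcal P^\circ(G)$. Assumption (P). $\mathcal H\in C^2(\mathcal P^\circ(G)\times\mathbb S^{d\times d})$, $\mathcal F,\mathcal U_T\in C^2(\mathcal P(G))$; $-\mathcal F$ is strictly convex and $\mathcal U_T$ is convex on $\mathcal P(G)$. For $(\rho,q)\in\mathcal P^\circ(G)\times\mathbb S^{d\times d}$, $\eta\in\mathbb R_0^d$, $r\in\mathbb S^{d\times d}$: $(D^2_{\rho\rho}\mathcal H(\rho,q)\eta,\eta)\le0$; $(D^2_{qq}\mathcal H(\rho,q)r,r)_E>0$ if $r\ne0$;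 $(D^2\mathcal F(\rho)\eta,\eta)<0$ if $\eta\neq0$. Assumption (L). $\mathcal L$ is proper, lower semicontinuous, jointly convex in $(\rho,w)$, and strictly convex in $w$ whenever it is finite. For every $A\in\mathbb R$ there is $R_A>0$ such that $\rho\in\mathcal P(G)$ and $\mathcal L(\rho,w)\le A$ imply $\|w\|_E\le R_A$. $\mathcal L(\rho,0)<\infty$ for every $\rho\in\mathcal P^\circ(G)$. If $\mathcal L(\rho,w)<\infty$ and $\rho_i=0$, then $w_{ij}=0$ for every $j\sim i$. $\mathcal L\in C^1(\mathcal P^\circ(G)\times\mathbb S^{d\times d})$, and for every compact $K\subset\mathcal P^\circ(G)$, $\lim_{R\to\infty}\inf_{\rho\in K,\ \|w\|_E\ge R}\mathcal L(\rho,w)/\|w\|_E=+\infty$. Variational objects. For $\rho=(\rho^n)_{n=0}^N$, $m=(m^{n+1})_{n=0}^{N-1}$: $\Gamma^n(\rho,m)=\frac{\rho^{n+1}-\rho^n}{\tau}+\operatorname{div}_Gm^{n+1}$, $w^{n+1}=m^{n+1}+\nabla_G\rho^{n+1}$, $$\mathcal A_\tau(\rho,m)=\tau\sum_{n=0}^{N-1}\bigl[\mathcal L(\rho^{n+1},w^{n+1})-\mathcal F(\rho^{n+1})\bigr]+\mathcal U_T(\rho^N).$$ For $\phi=(\phi^0,\dots,\phi^{N-1})$ put $\mathfrak L_\tau(\rho,m,\phi)=\mathcal A_\tau(\rho,m)-\tau\sum_{n=0}^{N-1}(\phi^n,\Gamma^n(\rho,m))$. KKT conditions for $(\rho,m,\phi)$: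 $\Gamma^n(\rho,m)=0$ for all $0\le n<N$, and $D_{(\rho,m)}\mathfrak L_\tau(\rho,m,\phi)[\eta,\zeta]=0$ for every $(\eta,\zeta)\in(\mathbb R_0^d)^N\times(\mathbb S^{d\times d})^N$, where $\eta=(\eta^1,\dots,\eta^N)$ is the variation of $(\rho^1,\dots,\rho^N)$ ($\rho^0$ being fixed) and $\zeta$ the variation of $m$. Assumption (A) for coefficients $\boldsymbol H:\mathcal P^\circ(G)\times\mathbb S^{d\times d}\to\mathbb R^d$, $\boldsymbol B:\mathcal P^\circ(G)\times\mathbb S^{d\times d}\to\mathbb S^{d\times d}$, $g:\mathcal P(G)\to\mathbb R^d$: all three are $C^1$ on their domains; there are constants $C_0,C_H,C_g\ge0$ with $(\boldsymbol B(\rho,p),p)_E\ge(\boldsymbol H(\rho,p),\rho)-C_0$, $\boldsymbol H_i(\rho,p)\ge-C_H$, $\|g(\rho)\|_{\ell^\infty}\le C_g$; and there is a locally bounded $\mathfrak a:(0,\infty)\times\mathbb S^{d\times d}\to[0,\infty)$ with $|\boldsymbol B_{ij}(\rho,p)|\le(\rho_i+\rho_j)\mathfrak a(\rho_j/\rho_i,p)$ for $(i,j)\in E$ and $\mathfrak a(u,p)\to0$ as $u\to0^+$ or $u\to\infty$, locally uniformly in $p$. Exact solution. For $\boldsymbol H,\boldsymbol B,g$ as in the claim, the continuous system is $\dot\phi=\boldsymbol H(\rho,\nabla_G\phi)-\Delta_G\phi$, $\dot\rho=\operatorname{div}_G\boldsymbol B(\rho,\nabla_G\phi)+\Delta_G\rho$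 on $[0,T]$, $\rho(0)=\rho_0$, $\phi(T)=g(\rho(T))$. Under (A), (P) and $\rho_0\in\mathcal P_\epsilon$ it is known to have a unique solution $(\phi,\rho)\in C^2([0,T];\mathbb R^d\times\mathcal P^\circ(G))$, with $\min_t\min_i\rho_i(t)\ge\delta_*$ and $\|\phi\|_{C^2}+\|\rho\|_{C^2}\le C_*$ for some $\delta_*,C_*>0$ depending on $G,T,\epsilon$ and the problem data. *)

(* Defs.v *)
From HB Require Import structures.
From mathcomp Require Export all_boot all_order all_algebra.
From mathcomp Require Export all_classical all_reals all_analysis.
Set Implicit Arguments.
Unset Strict Implicit.
Unset Printing Implicit Defensive.
Import Order.TTheory GRing.Theory Num.Theory.
Export numFieldNormedType.Exports.
Local Open Scope classical_set_scope.
Local Open Scope ring_scope.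

(* All spaces below are finite dimensional, so that continuity of every
   directional derivative is continuity of the differential. *)
Section Smoothness.
Context {R : realType} {E W : normedModType R}.
Implicit Types (f : E -> W) (U A : set E).

Definition C1_open U f := forall x, U x ->
  differentiable f x /\ forall v, {for x, continuous ('D_v f)}.

Definition C2_open U f := C1_open U f /\ forall v, C1_open U ('D_v f).

Definition C1_near A f := exists U, [/\ open U, A `<=` U & C1_open U f].

Definition C2_near A f := exists U, [/\ open U, A `<=` U & C2_open U f].

(* Here, unlike in [C1_near], the values of [f] off [A] are irrelevant. *)
Definition C1_on A f := exists2 g, C1_near A g & forall x, A x -> f x = g x.

End Smoothness.

Record wgraph (R : realType) (d : nat) := WGraph {
  edge : rel 'I_d;
  weight : 'M[R]_d;
  edge_sym : symmetric edge;
  edge_irr : irreflexive edge;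
  edge_conn : forall i j, connect edge i j;
  weight_sym : forall i j, weight i j = weight j i;
  weight_pos : forall i j, edge i j -> 0 < weight i j;
  weight_off : forall i j, ~~ edge i j -> weight i j = 0 }.

Section Vectors.
Context {R : realType} {d : nat}.
Implicit Types (x y : 'rV[R]_d).

Definition dot x y : R := \sum_i x 0 i * y 0 i.
Definition norm2 x : R := Num.sqrt (dot x x).
Definition norm_inf x : R := \big[Num.max/0]_i `|x 0 i|.

Definition simplex : set 'rV[R]_d :=
  [set x | (forall i, 0 <= x 0 i <= 1) /\ \sum_i x 0 i = 1].
Definition simplex_int : set 'rV[R]_d :=
  [set x | simplex x /\ forall i, 0 < x 0 i].
Definition simplex_ge (eps : R) : set 'rV[R]_d :=
  [set x | simplex x /\ forall i, eps <= x 0 i].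
Definition zero_sum : set 'rV[R]_d := [set x | \sum_i x 0 i = 0].

Definition grad_rho (f : 'rV[R]_d -> R) x : 'rV[R]_d :=
  \row_i 'D_(delta_mx 0 i) f x.

End Vectors.

Section Graph.
Context {R : realType} {d : nat} (G : wgraph R d).
Implicit Types (u : 'rV[R]_d) (p q : 'M[R]_d).

Definition skewE : set 'M[R]_d :=
  [set p | p^T = - p /\ forall i j, ~~ edge G i j -> p i j = 0].

Definition dotE p q : R :=
  2^-1 * \sum_i \sum_(j | edge G i j) p i j * q i j.
Definition normE p : R := Num.sqrt (dotE p p).
Definition normE_inf p : R :=
  \big[Num.max/0]_(e : 'I_d * 'I_d | edge G e.1 e.2) `|p e.1 e.2|.

Definition gradG u : 'M[R]_d :=
  \matrix_(i, j) (Num.sqrt (weight G i j) * (u 0 i - u 0 j)).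
Definition divG q : 'rV[R]_d :=
  \row_i - \sum_(j | edge G i j) Num.sqrt (weight G i j) * q i j.
Definition lapG u : 'rV[R]_d := divG (gradG u).

(* The element of [skewE] representing the derivative of [f] along [skewE]
   through [dotE]; its (i,j) entry is the derivative along the skew matrix
   e_ij - e_ji, because dotE p (e_ij - e_ji) = p i j on edges.
   See [dotE_grad_skew]. *)
Definition grad_skew (f : 'M[R]_d -> R) q : 'M[R]_d :=
  \matrix_(i, j) if edge G i j
                 then 'D_(delta_mx i j - delta_mx j i : 'M[R]_d) f q else 0.

Lemma skew_grad_skew (f : 'M[R]_d -> R) q :
  differentiable f q -> skewE (grad_skew f q).
Proof.
move=> df; split=> [|i j /negbTE nij]; last by rewrite mxE nij.
apply/matrixP => i j; rewrite !mxE edge_sym; case: ifP => _; last by rewrite oppr0.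
by rewrite -opprB !deriveE // linearN.
Qed.

Lemma dotE_grad_skew (f : 'M[R]_d -> R) q r :
  differentiable f q -> skewE r -> dotE (grad_skew f q) r = 'D_r f q.
Proof.
move=> df [rT r0].
have rsk i j : r j i = - r i j.
  by move/matrixP/(_ i j): rT; rewrite !mxE.
have Er : r = 2^-1 *: \sum_i \sum_(j | edge G i j)
    r i j *: (delta_mx i j - delta_mx j i : 'M[R]_d).
  have H i : \sum_(j | edge G i j) r i j *: (delta_mx i j - delta_mx j i : 'M[R]_d)
     = \sum_j r i j *: delta_mx i j + \sum_j r j i *: delta_mx j i.
    rewrite -big_split /= [LHS]big_mkcond /=; apply: eq_bigr => j _.
    case: ifPn => [_|/r0 rij]; first by rewrite scalerBr (rsk i j) scaleNr.
    by rewrite (rsk i j) rij oppr0 !scale0r addr0.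
  under eq_bigr => i _ do rewrite H.
  rewrite big_split /= [X in _ + X]exchange_big /= -!matrix_sum_delta.
  by rewrite -[X in _ *: X]mulr2n -[X in _ *: X]scaler_nat scalerA mulVf ?scale1r // pnatr_eq0.
rewrite deriveE // [in RHS]Er /dotE linearZ linear_sum /=; congr (_ * _).
apply: eq_bigr => i _; rewrite linear_sum /=; apply: eq_bigr => j ij.
by rewrite linearZ /= mxE ij deriveE // mulrC; congr (_ *: _).
Qed.

End Graph.

Section Problem.
Context {R : realType} {d : nat} (G : wgraph R d).
(* [H], [F], [UT] stand for the functions on P°(G) x S, P(G), P(G) together
   with the fixed smooth extensions to a neighbourhood; [L] is only used on
   P(G) x S. *)
Variables (H : 'rV[R]_d -> 'M[R]_d -> R) (F UT : 'rV[R]_d -> R)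
          (L : 'rV[R]_d -> 'M[R]_d -> \bar R).
Local Notation S := (skewE G).

Definition legendre_dual := forall rho q, simplex_int rho -> S q ->
  (H rho q)%:E = ereal_sup [set ((dotE G w q)%:E - L rho w)%E | w in S].

Definition strictly_convex_on (D : set 'rV[R]_d) (f : 'rV[R]_d -> R) :=
  forall x y (t : R), D x -> D y -> x != y -> 0 < t < 1 ->
  f (t *: x + (1 - t) *: y) < t * f x + (1 - t) * f y.

Record assumption_P : Prop := {
  P_H : C2_near (simplex_int `*` S) (fun z => H z.1 z.2);
  P_F : C2_near simplex F;
  P_UT : C2_near simplex UT;
  P_F_concave : strictly_convex_on simplex (- F);
  P_UT_convex : convex_function simplex UT;
  P_H_rho : forall rho q eta, simplex_int rho -> S q -> zero_sum eta ->
    'D_eta ('D_eta (fun r => H r q)) rho <= 0;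
  P_H_q : forall rho q r, simplex_int rho -> S q -> S r -> r != 0 ->
    0 < 'D_r ('D_r (H rho)) q;
  P_F_rho : forall rho eta, simplex_int rho -> zero_sum eta -> eta != 0 ->
    'D_eta ('D_eta F) rho < 0 }.

Record assumption_L : Prop := {
  L_not_ninfty : forall rho w, simplex rho -> S w -> L rho w != -oo%E;
  L_proper : exists rho w, [/\ simplex rho, S w & (L rho w < +oo)%E];
  L_lsc : @lower_semicontinuous (subspace (simplex `*` S)) R
            (fun z : 'rV[R]_d * 'M[R]_d => L z.1 z.2);
  L_convex : forall x y w v (t : R),
    simplex x -> simplex y -> S w -> S v -> 0 < t < 1 ->
    (L (t *: x + (1 - t) *: y)%R (t *: w + (1 - t) *: v)%R
       <= t%:E * L x w + (1 - t)%:E * L y v)%E;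
  L_strict : forall rho w v (t : R),
    simplex rho -> S w -> S v -> w != v -> 0 < t < 1 ->
    (L rho w < +oo)%E -> (L rho v < +oo)%E ->
    (L rho (t *: w + (1 - t) *: v)%R
       < t%:E * L rho w + (1 - t)%:E * L rho v)%E;
  L_sublevel : forall A : R, exists2 RA : R, 0 < RA &
    forall rho w, simplex rho -> S w -> (L rho w <= A%:E)%E -> normE G w <= RA;
  L_zero : forall rho, simplex_int rho -> (L rho 0%R < +oo)%E;
  L_boundary : forall rho w i, simplex rho -> S w -> (L rho w < +oo)%E ->
    rho 0 i = 0 -> forall j, edge G i j -> w i j = 0;
  L_fin : forall rho w, simplex_int rho -> S w -> L rho w \is a fin_num;
  L_C1 : C1_on (simplex_int `*` S) (fun z => fine (L z.1 z.2));
  L_superlinear : forall K : set 'rV[R]_d, compact K -> K `<=` simplex_int ->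
    ereal_inf [set (L z.1 z.2 * ((normE G z.2)^-1)%:E)%E |
               z in [set z | [/\ K z.1, S z.2 & r <= normE G z.2]]]
      @[r --> +oo%R] --> +oo%E }.

Section Discrete.
Variables (N : nat) (tau : R) (rho0 : 'rV[R]_d).
(* For n : 'I_N, the indices n and n + 1 in {0, ..., N}; [m n] stands
   for m^{n+1}. *)
Definition lo (n : 'I_N) : 'I_N.+1 := widen_ord (leqnSn N) n.
Definition hi (n : 'I_N) : 'I_N.+1 := lift ord0 n.
Implicit Types (rho : 'I_N.+1 -> 'rV[R]_d) (m : 'I_N -> 'M[R]_d).

Definition Gam rho m (n : 'I_N) : 'rV[R]_d :=
  tau^-1 *: (rho (hi n) - rho (lo n)) + divG G (m n).

Definition action rho m : \bar R :=
  (tau%:E * (\sum_(n < N) (L (rho (hi n)) (m n + gradG G (rho (hi n)))%R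
                          - (F (rho (hi n)))%:E))
   + (UT (rho ord_max))%:E)%E.

Definition feasible rho m :=
  [/\ forall n, simplex (rho n), forall n, S (m n),
      rho ord0 = rho0 & forall n, Gam rho m n = 0].

Definition minimizer rho m := feasible rho m /\
  forall rho' m', feasible rho' m' -> (action rho m <= action rho' m')%E.

Definition lagrangian rho m (phi : 'I_N -> 'rV[R]_d) : \bar R :=
  (action rho m - (tau * \sum_n dot (phi n) (Gam rho m n))%:E)%E.

Definition shift_rho rho (s : R) (eta : 'I_N -> 'rV[R]_d) (k : 'I_N.+1) :=
  if unlift ord0 k is Some n then rho k + s *: eta n else rho k.

(* The derivative along (eta, zeta) is written as the derivative at s = 0 on
   the line s |-> (rho + s eta, m + s zeta); the Lagrangian is finite near
   s = 0 when rho is interior. *)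
Definition KKT rho m (phi : 'I_N -> 'rV[R]_d) :=
  (forall n, Gam rho m n = 0) /\
  forall (eta : 'I_N -> 'rV[R]_d) (zeta : 'I_N -> 'M[R]_d),
    (forall n, zero_sum (eta n)) -> (forall n, S (zeta n)) ->
    is_derive (0 : R) (1 : R)
      (fun s : R => fine (lagrangian (shift_rho rho s eta)
                                     (fun n => m n + s *: zeta n) phi)) 0.

Definition scheme (phi rho : 'I_N.+1 -> 'rV[R]_d) :=
  [/\ rho ord0 = rho0,
      phi ord_max = grad_rho UT (rho ord_max),
      forall n : 'I_N, tau^-1 *: (phi (hi n) - phi (lo n)) =
        grad_rho (fun r => H r (- gradG G (phi (lo n)))) (rho (hi n))
        + grad_rho F (rho (hi n)) - lapG G (phi (lo n)) &
      forall n : 'I_N, tau^-1 *: (rho (hi n) - rho (lo n)) =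
        - divG G (grad_skew G (H (rho (hi n))) (- gradG G (phi (lo n))))
        + lapG G (rho (hi n))].

Definition interior_solution (phi rho : 'I_N.+1 -> 'rV[R]_d) :=
  scheme phi rho /\ forall n, simplex_int (rho n).

(* phi^n + a_n 1 for n < N, and D UT (rho^N) for n = N. *)
Definition lifted rho (phi : 'I_N -> 'rV[R]_d) (a : 'I_N -> R)
    (k : 'I_N.+1) : 'rV[R]_d :=
  if unlift ord_max k is Some n then phi n + const_mx (a n)
  else grad_rho UT (rho ord_max).

Definition flux (phi rho : 'I_N.+1 -> 'rV[R]_d) (n : 'I_N) : 'M[R]_d :=
  grad_skew G (H (rho (hi n))) (- gradG G (phi (lo n))) - gradG G (rho (hi n)).

End Discrete.

Definition coeff_H (rho : 'rV[R]_d) (p : 'M[R]_d) : 'rV[R]_d :=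
  grad_rho (fun r => H r (- p)) rho + grad_rho F rho.
Definition coeff_B (rho : 'rV[R]_d) (p : 'M[R]_d) : 'M[R]_d :=
  - grad_skew G (H rho) (- p).

End Problem.

Section Continuous.
Context {R : realType} {d : nat} (G : wgraph R d).
Variables (Hb : 'rV[R]_d -> 'M[R]_d -> 'rV[R]_d)
          (B : 'rV[R]_d -> 'M[R]_d -> 'M[R]_d) (g : 'rV[R]_d -> 'rV[R]_d).
Local Notation S := (skewE G).

Record mobility_bound (a : R -> 'M[R]_d -> R) : Prop := {
  mob_ge0 : forall (u : R) p, 0 < u -> S p -> 0 <= a u p;
  mob_locally_bounded : forall (u : R) p, 0 < u -> S p -> exists M : R,
    \forall z \near (u, p), 0 < z.1 -> S z.2 -> a z.1 z.2 <= M;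
  mob_bound : forall rho p i j, simplex_int rho -> S p -> edge G i j ->
    `|B rho p i j| <= (rho 0 i + rho 0 j) * a (rho 0 j / rho 0 i) p;
  mob_at_0 : forall p, S p -> exists2 V, nbhs p V &
    forall e : R, 0 < e ->
    \forall u \near 0^'+, forall p', V p' -> S p' -> a u p' < e;
  mob_at_infty : forall p, S p -> exists2 V, nbhs p V &
    forall e : R, 0 < e ->
    \forall u \near +oo, forall p', V p' -> S p' -> a u p' < e }.

Record assumption_A : Prop := {
  A_H : C1_on (simplex_int `*` S) (fun z => Hb z.1 z.2);
  A_B : C1_on (simplex_int `*` S) (fun z => B z.1 z.2);
  A_g : C1_on simplex g;
  A_bounds : exists C0 CH Cg : R,
    [/\ [/\ 0 <= C0, 0 <= CH & 0 <= Cg],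
        forall rho p, simplex_int rho -> S p ->
          dot (Hb rho p) rho - C0 <= dotE G (B rho p) p,
        forall rho p i, simplex_int rho -> S p -> - CH <= Hb rho p 0 i &
        forall rho, simplex rho -> norm_inf (g rho) <= Cg];
  A_mobility : exists a, mobility_bound a }.

(* C^2 on [0,T] is C^2 on a neighbourhood of [0,T]: the functions are extended
   beyond the end points, where the derivatives are then the one-sided ones. *)
Record exact_solution (T : R) (rho0 : 'rV[R]_d) (phi rho : R -> 'rV[R]_d)
  : Prop := {
  ex_phi_C2 : C2_near `[0, T] phi;
  ex_rho_C2 : C2_near `[0, T] rho;
  ex_int : forall t : R, 0 <= t <= T -> simplex_int (rho t);
  ex_phi_eq : forall t : R, 0 <= t <= T ->
    derive1 phi t = Hb (rho t) (gradG G (phi t)) - lapG G (phi t);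
  ex_rho_eq : forall t : R, 0 <= t <= T ->
    derive1 rho t = divG G (B (rho t) (gradG G (phi t))) + lapG G (rho t);
  ex_init : rho 0 = rho0;
  ex_final : phi T = g (rho T) }.

End Continuous.

Definition scheme_error {R : realType} {d : nat} (G : wgraph R d) (N : nat)
    (tau : R) (phiT rhoT : R -> 'rV[R]_d) (phi rho : 'I_N.+1 -> 'rV[R]_d) : R :=
  \big[Num.max/0]_(n < N.+1)
     (norm2 (rhoT (n%:R * tau) - rho n) + norm2 (phiT (n%:R * tau) - phi n))
  + Num.sqrt (tau * \sum_(n < N)
      normE G (gradG G (phiT (n%:R * tau)) - gradG G (phi (lo n))) ^+ 2).

(* Main.v *)
From HB Require Import structures.
Require Import Defs.
From mathcomp Require Import all_boot all_order all_algebra.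
From mathcomp Require Import all_classical all_reals all_analysis.
From mathcomp Require Import ring lra.
Import Order.TTheory GRing.Theory Num.Theory.
Local Open Scope classical_set_scope.
Local Open Scope ring_scope.

(** The scheme is the optimality system of a discrete mean field game: a backward
   Hamilton-Jacobi equation and a forward continuity equation, both with implicit
   diffusion, whose coefficients are the two partial derivatives of one Hamiltonian.

   The discrete problem.  Diffusion acts on the density at the new time.  If that
   density vanished at a vertex, finite cost would force the total flux [w] to
   vanish on the adjacent edges, so that [m = w - grad rho] only carries mass into
   the vertex, which is impossible when the previous density is positive there
   ([feasible_interior]).  Hence every competitor of finite cost is interior, and a
   minimizer, which exists by compactness and lower semicontinuity
   ([minimizer_exists]) and is unique by strict convexity ([minimizer_unique]),
   satisfies an Euler-Lagrange equation.  Variations of the flux by circulations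
   show that the slope of [L] in [w] is a graph gradient, whose potential is the
   multiplier ([multipliers_exist]).  Summation by parts in time writes the
   derivative of the Lagrangian as a sum of one bracket per time step
   ([d_lagrangianE]).  By Legendre duality the flux bracket says that
   [w = D_q H] at minus the gradient of the multiplier, after which the density
   bracket is the residual of the Hamilton-Jacobi equation ([d_lagrangian_young]).
   Density variations have zero sum, so the residual vanishes up to a constant per
   time step; summing these constants backward in time gives the unique shifts that
   turn the multiplier into a solution of the scheme ([scheme_of_multipliers]).
   Conversely a solution of the scheme makes all brackets vanish, and a stationary
   point of a convex problem is a minimizer ([scheme_minimizer]).

   A priori bounds.  The maximum principle bounds [phi] from above
   ([Phi_le_ceiling]).  The pairing of [phi] with the density changes in one step by
   a controlled amount, so it is bounded below at time zero ([pairing_lower]), and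
   as the initial density is at least [eps], so is [phi] at time zero.  The gap
   between [phi] and its upper barrier grows at most exponentially in time, which
   bounds [phi] at all times ([Phi_bound]).  Then [grad phi] is bounded, the mobility condition bounds
   the net inflow at a vertex below by a multiple of minus the density there
   ([inflow_bound]), and the density decays at most exponentially ([rho_lower]).
   The argument tolerates small residuals in both equations, so it applies to the
   exact solution sampled on a fine grid as well ([exact_bounds]).

   Convergence.  The sampled exact solution satisfies the scheme up to residuals of
   size [tau] ([residual_bound]).  In the pairing of the two errors, diffusion
   cancels, the initial error is zero, the final term has a sign by convexity of the
   terminal cost, and the Hamiltonian terms are coercive: this is Lasry-Lions
   monotonicity, quantified on the compact set that contains both solutions
   ([coeff_monotone], [energy_step]).  So the squared errors sum up to order [tau^2]
   without a Gronwall argument ([energy_bound]); summing the two equations turns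
   this into a uniform bound ([rho_error], [phi_error]). *)

Set Implicit Arguments.
Unset Strict Implicit.

(** * Graph calculus *)

Section SupNorm.
Context {R : realType}.

Lemma mx_entry_le m n (M : 'M[R]_(m, n)) i j : `|M i j| <= `|M|.
Proof.
rewrite [leRHS]/Num.norm /= mx_normrE.
by apply/bigmax_geP; right; exists (i, j).
Qed.

Lemma mx_norm_le m n (M : 'M[R]_(m, n)) c :
  0 <= c -> (forall i j, `|M i j| <= c) -> `|M| <= c.
Proof.
move=> c0 h; rewrite [leLHS]/Num.norm /= mx_normrE.
by apply/bigmax_leP; split => // -[i j] _; exact: h.
Qed.

Lemma mx_lipschitz_of_entries (T : Type) (D : set T) m n (f : T -> 'M[R]_(m, n))
    (dist : T -> T -> R) : (forall z z', 0 <= dist z z') ->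
  (forall i j, exists2 K, 0 <= K & forall z z', D z -> D z' ->
     `|f z' i j - f z i j| <= K * dist z z') ->
  exists2 K, 0 <= K & forall z z', D z -> D z' -> `|f z' - f z| <= K * dist z z'.
Proof.
move=> dist0 h.
have /choice[K hK] (ij : 'I_m * 'I_n) : exists K, 0 <= K /\ forall z z', D z -> D z' ->
    `|f z' ij.1 ij.2 - f z ij.1 ij.2| <= K * dist z z'.
  by have [K] := h ij.1 ij.2; exists K.
have S0 : 0 <= \sum_ij K ij by apply: sumr_ge0 => ij _; case: (hK ij).
exists (\sum_ij K ij) => // z z' Dz Dz'.
apply: mx_norm_le => [|i j]; first by rewrite mulr_ge0.
rewrite !mxE; apply: le_trans (proj2 (hK (i, j)) _ _ Dz Dz') _.
rewrite ler_wpM2r // (bigD1 (i, j)) //= lerDl.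
by apply: sumr_ge0 => ij _; case: (hK ij).
Qed.

Lemma mx_norm_attained m n (M : 'M[R]_(m, n)) :
  `|M| = 0 \/ exists i j, `|M| = `|M i j|.
Proof.
have [->|M0] := eqVneq M 0; first by left; rewrite normr0.
right; have /mx_norm_neq0[[i j] h] : mx_norm M != 0.
  by apply: contra_neq M0; exact: mx_norm_eq0.
by exists i, j.
Qed.

End SupNorm.

Lemma sum_le_card {R : realType} d (F : 'I_d -> R) (P : pred 'I_d) c :
  0 <= c -> (forall i, F i <= c) -> \sum_(i | P i) F i <= d%:R * c.
Proof.
move=> c0 h; rewrite big_mkcond mulr_natl -[d in _ *+ d]card_ord -sumr_const.
by apply: ler_sum => i _; case: ifP.
Qed.

Section Dot.
Context {R : realType} {d : nat}.
Implicit Types x y z : 'rV[R]_d.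

Lemma dotC x y : dot x y = dot y x.
Proof. by apply: eq_bigr => i _; rewrite mulrC. Qed.

Lemma dot_is_linear x : linear_for *%R (dot x).
Proof.
move=> a y z; rewrite /dot mulr_sumr -big_split /=; apply: eq_bigr => i _.
by rewrite !mxE; ring.
Qed.

HB.instance Definition _ x :=
  GRing.isLinear.Build R 'rV[R]_d R *%R (dot x) (dot_is_linear x).

Lemma dotDl x y z : dot (x + y) z = dot x z + dot y z.
Proof. by rewrite !(dotC _ z) linearD. Qed.
Lemma dotNl x z : dot (- x) z = - dot x z.
Proof. by rewrite !(dotC _ z) linearN. Qed.
Lemma dotBl x y z : dot (x - y) z = dot x z - dot y z.
Proof. by rewrite !(dotC _ z) linearB. Qed.
Lemma dotZl a x z : dot (a *: x) z = a * dot x z.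
Proof. by rewrite !(dotC _ z) linearZ. Qed.
Lemma dotDr x y z : dot z (x + y) = dot z x + dot z y.
Proof. exact: linearD. Qed.
Lemma dotNr x z : dot z (- x) = - dot z x.
Proof. exact: linearN. Qed.
Lemma dotBr x y z : dot z (x - y) = dot z x - dot z y.
Proof. exact: linearB. Qed.
Lemma dotZr a x z : dot z (a *: x) = a * dot z x.
Proof. exact: linearZ. Qed.
Lemma dot0r z : dot z 0 = 0. Proof. exact: linear0. Qed.

Lemma dot_const c x : dot (const_mx c) x = c * \sum_i x 0 i.
Proof. by rewrite /dot mulr_sumr; apply: eq_bigr => i _; rewrite mxE. Qed.

Lemma dot_ge0 x : 0 <= dot x x.
Proof. by apply: sumr_ge0 => i _; rewrite -expr2 sqr_ge0. Qed.

Lemma sqr_norm_le_dot x : `|x| ^+ 2 <= dot x x.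
Proof.
have [->|[i [j ->]]] := mx_norm_attained x; first by rewrite expr0n dot_ge0.
rewrite ord1 real_normK ?num_real // /dot (bigD1 j) //= -expr2 lerDl.
by apply: sumr_ge0 => k _; rewrite -expr2 sqr_ge0.
Qed.

Lemma norm_dot_le x y : `|dot x y| <= d%:R * (`|x| * `|y|).
Proof.
apply: le_trans (ler_norm_sum _ _ _) _.
apply: sum_le_card => [|i]; first by rewrite mulr_ge0.
by rewrite normrM ler_pM // mx_entry_le.
Qed.

Lemma dot_eq0 x : dot x x = 0 -> x = 0.
Proof.
move=> h; apply/eqP; rewrite -normr_eq0 -sqrf_eq0 eq_le sqr_ge0 andbT.
by rewrite -h sqr_norm_le_dot.
Qed.

Lemma norm2_le x : norm2 x <= d%:R * `|x|.
Proof.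
rewrite /norm2 -[leRHS]ger0_norm ?mulr_ge0 // -sqrtr_sqr ler_wsqrtr //.
apply: le_trans (ler_norm _) (le_trans (norm_dot_le _ _) _).
rewrite exprMn expr2 -mulrA ler_wpM2l //.
case: d x => [|k] x; first by rewrite [x]thinmx0 normr0 !mulr0.
by rewrite ler_peMl ?mulr_ge0 // ler1n.
Qed.

Lemma norm_inf_entry x i : `|x 0 i| <= norm_inf x.
Proof. exact: (le_bigmax _ (fun i => `|x 0 i|) i). Qed.

Lemma norm_inf_le x : norm_inf x <= `|x|.
Proof. by apply/bigmax_leP; split=> // i _; exact: mx_entry_le. Qed.

Lemma zero_sumP x : zero_sum x <-> dot (const_mx 1) x = 0.
Proof. by rewrite dot_const mul1r. Qed.

Lemma zero_sum0 : zero_sum (0 : 'rV[R]_d).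
Proof. by apply/zero_sumP; rewrite dot0r. Qed.

Lemma zero_sum_sub x y : zero_sum x -> zero_sum y -> zero_sum (x - y).
Proof.
by move=> /zero_sumP h1 /zero_sumP h2; apply/zero_sumP; rewrite dotBr h1 h2 subrr.
Qed.

Lemma zero_sumZ a x : zero_sum x -> zero_sum (a *: x).
Proof. by move=> /zero_sumP h; apply/zero_sumP; rewrite dotZr h mulr0. Qed.

End Dot.

Section Calculus.
Context {R : realType} {d : nat} (G : wgraph R d).
Implicit Types (u v : 'rV[R]_d) (p q : 'M[R]_d).
Local Notation S := (skewE G).

Lemma dotEC p q : dotE G p q = dotE G q p.
Proof.
congr (_ * _); apply: eq_bigr => i _; apply: eq_bigr => j _; exact: mulrC.
Qed.

Lemma dotE_is_linear p : linear_for *%R (dotE G p).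
Proof.
move=> a q r; rewrite /dotE mulrCA -mulrDr; congr (_ * _).
rewrite mulr_sumr -big_split /=; apply: eq_bigr => i _.
rewrite mulr_sumr -big_split /=; apply: eq_bigr => j _.
by rewrite !mxE; ring.
Qed.

HB.instance Definition _ p :=
  GRing.isLinear.Build R 'M[R]_d R *%R (dotE G p) (dotE_is_linear p).

Lemma dotEDl p q r : dotE G (p + q) r = dotE G p r + dotE G q r.
Proof. by rewrite !(dotEC _ r) linearD. Qed.
Lemma dotENl p r : dotE G (- p) r = - dotE G p r.
Proof. by rewrite !(dotEC _ r) linearN. Qed.
Lemma dotEBl p q r : dotE G (p - q) r = dotE G p r - dotE G q r.
Proof. by rewrite !(dotEC _ r) linearB. Qed.
Lemma dotEZl a p r : dotE G (a *: p) r = a * dotE G p r.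
Proof. by rewrite !(dotEC _ r) linearZ. Qed.
Lemma dotEDr p q r : dotE G r (p + q) = dotE G r p + dotE G r q.
Proof. exact: linearD. Qed.
Lemma dotENr p r : dotE G r (- p) = - dotE G r p.
Proof. exact: linearN. Qed.
Lemma dotEBr p q r : dotE G r (p - q) = dotE G r p - dotE G r q.
Proof. exact: linearB. Qed.
Lemma dotEZr a p r : dotE G r (a *: p) = a * dotE G r p.
Proof. exact: linearZ. Qed.

Lemma gradG_is_linear : linear (gradG G).
Proof. by move=> a u v; apply/matrixP => i j; rewrite !mxE; ring. Qed.

HB.instance Definition _ :=
  GRing.isLinear.Build R 'rV[R]_d 'M[R]_d *:%R (gradG G) gradG_is_linear.

Lemma divG_is_linear : linear (divG G).
Proof.
move=> a p q; apply/rowP => i; rewrite !mxE mulrN mulr_sumr -opprD -big_split /=.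
by congr (- _); apply: eq_bigr => j _; rewrite !mxE; ring.
Qed.

HB.instance Definition _ :=
  GRing.isLinear.Build R 'M[R]_d 'rV[R]_d *:%R (divG G) divG_is_linear.

Lemma lapG_is_linear : linear (lapG G).
Proof. by move=> a u v; rewrite /lapG !linearP. Qed.

HB.instance Definition _ :=
  GRing.isLinear.Build R 'rV[R]_d 'rV[R]_d *:%R (lapG G) lapG_is_linear.

Lemma skewE0 : S 0.
Proof. by split=> [|i j _]; rewrite ?trmx0 ?oppr0 // mxE. Qed.
Lemma skewED p q : S p -> S q -> S (p + q).
Proof.
move=> [p1 p2] [q1 q2]; split=> [|i j e]; last by rewrite mxE p2 ?q2 ?addr0.
by rewrite linearD /= p1 q1 opprD.
Qed.
Lemma skewEZ a p : S p -> S (a *: p).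
Proof.
move=> [p1 p2]; split=> [|i j e]; last by rewrite mxE p2 ?mulr0.
by rewrite linearZ /= p1 scalerN.
Qed.
Lemma skewEN p : S p -> S (- p).
Proof. by rewrite -scaleN1r; exact: skewEZ. Qed.
Lemma skewEB p q : S p -> S q -> S (p - q).
Proof. by move=> Sp Sq; apply: skewED => //; exact: skewEN. Qed.

Lemma skewE_opp p i j : S p -> p j i = - p i j.
Proof. by move=> [/matrixP/(_ i j)]; rewrite !mxE. Qed.

Lemma skewE_gradG u : S (gradG G u).
Proof.
split=> [|i j e]; last by rewrite mxE weight_off // sqrtr0 mul0r.
by apply/matrixP => i j; rewrite !mxE weight_sym -mulrN opprB.
Qed.

Hint Resolve skewE_gradG skewE0 : core.

Lemma gradG_const c : gradG G (const_mx c) = 0.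
Proof. by apply/matrixP => i j; rewrite !mxE subrr mulr0. Qed.

Lemma lapG_const c : lapG G (const_mx c) = 0.
Proof. by rewrite /lapG gradG_const linear0. Qed.

(** Summation by parts: the two orientations of an edge combine into one
   difference, which accounts for the factor 1/2 in the edge pairing. *)
Lemma dot_divG u q : S q -> dot u (divG G q) = - dotE G (gradG G u) q.
Proof.
move=> Sq; pose f i j := if edge G i j then Num.sqrt (weight G i j) * u 0 i * q i j else 0.
have -> : dot u (divG G q) = - \sum_i \sum_j f i j.
  rewrite -sumrN; apply: eq_bigr => i _; rewrite mxE mulrN mulr_sumr big_mkcond.
  by congr (- _); apply: eq_bigr => j _; rewrite /f; case: ifP => // _; ring.
have -> : dotE G (gradG G u) q = 2^-1 * \sum_i \sum_j (f i j + f j i).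
  congr (_ * _); apply: eq_bigr => i _; rewrite big_mkcond.
  apply: eq_bigr => j _; rewrite /f (edge_sym G j i); case: ifP => _; last by rewrite addr0.
  by rewrite mxE (weight_sym G j i) (skewE_opp i j Sq); ring.
congr (- _).
rewrite [in RHS](eq_bigr (fun i => \sum_j f i j + \sum_j f j i)) => [|i _]; last first.
  by rewrite big_split.
rewrite big_split /= [X in _ + X]exchange_big /=.
by rewrite -mulr2n -[X in _ * X]mulr_natl mulKf // pnatr_eq0.
Qed.

Lemma dot_lapG u v : dot u (lapG G v) = - dotE G (gradG G u) (gradG G v).
Proof. by rewrite dot_divG. Qed.

Lemma zero_sum_divG q : S q -> zero_sum (divG G q).
Proof.
move=> Sq; apply/zero_sumP; rewrite dot_divG // gradG_const.
by rewrite dotEC linear0 oppr0.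
Qed.

Lemma dotE_ge0 p : 0 <= dotE G p p.
Proof.
rewrite mulr_ge0 ?invr_ge0 //; apply: sumr_ge0 => i _; apply: sumr_ge0 => j _.
by rewrite -expr2 sqr_ge0.
Qed.

(** Each edge carries its value in both orientations, which cancels the 1/2. *)
Lemma sqr_norm_le_dotE p : S p -> `|p| ^+ 2 <= dotE G p p.
Proof.
move=> Sp; have [->|[i [j ->]]] := mx_norm_attained p.
  by rewrite expr0n dotE_ge0.
rewrite real_normK ?num_real //.
have [e|/(proj2 Sp)->] := boolP (edge G i j); last first.
  by rewrite expr0n dotE_ge0.
have ij : i != j by apply: contraTneq e => ->; rewrite edge_irr.
rewrite /dotE (bigD1 i) //= (bigD1 j) //= [X in _ + X](bigD1 j) 1?eq_sym //=.
rewrite [X in _ + (X + _)](bigD1 i) 1?edge_sym //=.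
rewrite (skewE_opp i j Sp).
set A := \sum_(_ | _) _; set B := \sum_(_ | _) _; set C := \sum_(_ | _) _.
have A0 : 0 <= A by apply: sumr_ge0 => k _; rewrite -expr2 sqr_ge0.
have B0 : 0 <= B by apply: sumr_ge0 => k _; rewrite -expr2 sqr_ge0.
have C0 : 0 <= C.
  by do 2!apply: sumr_ge0 => ? _; rewrite -expr2 sqr_ge0.
lra.
Qed.

Lemma norm_dotE_le p q : `|dotE G p q| <= d%:R ^+ 2 * (`|p| * `|q|).
Proof.
have pq0 : 0 <= `|p| * `|q| by rewrite mulr_ge0.
rewrite normrM ger0_norm ?invr_ge0 //.
suff h : `|\sum_i \sum_(j | edge G i j) p i j * q i j|
  <= d%:R ^+ 2 * (`|p| * `|q|) by have := normr_ge0 (\sum_i \sum_(j | edge G i j) p i j * q i j); lra.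
apply: le_trans (ler_norm_sum _ _ _) _.
rewrite expr2 -mulrA; apply: sum_le_card => [|i]; first by rewrite mulr_ge0.
apply: le_trans (ler_norm_sum _ _ _) _; apply: sum_le_card => // j.
by rewrite normrM ler_pM // mx_entry_le.
Qed.

Lemma dotE_eq0 p : S p -> dotE G p p = 0 -> p = 0.
Proof.
move=> Sp h; apply/eqP; rewrite -normr_eq0 -sqrf_eq0 eq_le sqr_ge0 andbT.
by rewrite -h sqr_norm_le_dotE.
Qed.

Lemma normE_sqr p : normE G p ^+ 2 = dotE G p p.
Proof. by rewrite sqr_sqrtr ?dotE_ge0. Qed.

Lemma norm_le_normE p : S p -> `|p| <= normE G p.
Proof.
move=> Sp; rewrite -ler_sqr ?nnegrE ?sqrtr_ge0 // normE_sqr.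
exact: sqr_norm_le_dotE.
Qed.

Lemma normE_le p : normE G p <= d%:R * `|p|.
Proof.
rewrite /normE -[leRHS]ger0_norm ?mulr_ge0 // -sqrtr_sqr ler_wsqrtr //.
rewrite exprMn [`|p| ^+ 2]expr2.
exact: le_trans (ler_norm _) (norm_dotE_le _ _).
Qed.

Lemma normE_inf_le p : normE_inf G p <= `|p|.
Proof. by apply/bigmax_leP; split=> // e _; exact: mx_entry_le. Qed.

(** Connectedness of the graph enters here. *)
Lemma gradG_eq0 u : gradG G u = 0 -> forall i j, u 0 i = u 0 j.
Proof.
move=> h i j.
have step a b : edge G a b -> u 0 a = u 0 b.
  move=> e; move/matrixP/(_ a b) : h; rewrite !mxE => /eqP.
  rewrite mulf_eq0 gt_eqF ?sqrtr_gt0 ?weight_pos //= subr_eq0.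
  by move/eqP.
have /connectP[s + ->] := edge_conn G i j.
elim: s i => //= a s IH i /andP[/step -> /IH].
exact.
Qed.

Lemma gradG_eq0_zero_sum u : zero_sum u -> gradG G u = 0 -> u = 0.
Proof.
move=> zu gu; apply/rowP => i; rewrite mxE.
have /eqP : \sum_(j < d) u 0 i = 0.
  rewrite (eq_bigr (fun j => u 0 j)) => [|j _]; last by apply: gradG_eq0 gu _ _.
  by rewrite zu.
rewrite sumr_const card_ord -mulr_natr mulf_eq0 => /orP[/eqP//|].
by rewrite pnatr_eq0 => /eqP d0; have := ltn_ord i; rewrite {2}d0.
Qed.

(** The Laplacian itself is singular.  Adding the rank one map onto the constants
   makes it injective, hence invertible, and does not change it on zero-sum
   vectors, so that the inverse of the sum inverts the Laplacian there. *)
Definition lap_reg : 'M[R]_d := lin1_mx (lapG G) + const_mx 1.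

Lemma const_mx0 : const_mx 0 = 0 :> 'rV[R]_d.
Proof. by apply/rowP => i; rewrite !mxE. Qed.

Lemma lap_regE u : u *m lap_reg = lapG G u + const_mx (\sum_i u 0 i).
Proof.
rewrite mulmxDr mul_rV_lin1; congr (_ + _).
by apply/rowP => i; rewrite !mxE; apply: eq_bigr => j _; rewrite mxE mulr1.
Qed.

Lemma d_neq0 (i : 'I_d) : d%:R != 0 :> R.
Proof. by rewrite pnatr_eq0 -lt0n (leq_ltn_trans _ (ltn_ord i)). Qed.

Lemma zero_sum_of_lap_reg u : zero_sum (u *m lap_reg) -> zero_sum u.
Proof.
rewrite lap_regE => /zero_sumP; rewrite dotDr.
have /zero_sumP -> : zero_sum (lapG G u) by exact: zero_sum_divG.
rewrite add0r dot_const mul1r; set s := \sum_i u 0 i.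
rewrite (eq_bigr (fun=> s)) => [|i _]; last by rewrite mxE.
rewrite sumr_const card_ord -mulr_natr => /eqP; rewrite mulf_eq0 /zero_sum /= -/s.
case/orP => [/eqP //|]; rewrite /s.
case: (pickP 'I_d) => [i _|d0]; first by rewrite (negbTE (d_neq0 i)).
by move=> _; rewrite big1 // => i; have := d0 i.
Qed.

Lemma lap_reg_unit : lap_reg \in unitmx.
Proof.
rewrite -row_free_unit -kermx_eq0; apply/eqP/row_matrixP => i; rewrite row0.
set u := row i _.
have uL : u *m lap_reg = 0.
  by apply/sub_kermxP; exact: row_sub.
have zu : zero_sum u.
  by apply: zero_sum_of_lap_reg; rewrite uL /zero_sum /= big1 // => j; rewrite mxE.
apply: gradG_eq0_zero_sum => //; apply: dotE_eq0 => //.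
have : dot u (lapG G u) = 0.
  by move: uL; rewrite lap_regE zu const_mx0 addr0 => ->; exact: dot0r.
by rewrite dot_lapG => /eqP; rewrite oppr_eq0 => /eqP.
Qed.

Definition lap_inv (b : 'rV[R]_d) : 'rV[R]_d := b *m invmx lap_reg.

Lemma lap_invK b : zero_sum b -> lapG G (lap_inv b) = b.
Proof.
move=> zb; have h : lap_inv b *m lap_reg = b.
  by rewrite /lap_inv mulmxKV // lap_reg_unit.
have z : zero_sum (lap_inv b) by apply: zero_sum_of_lap_reg; rewrite h.
by rewrite -[RHS]h lap_regE z const_mx0 addr0.
Qed.

(** A flow orthogonal to all circulations is a gradient: subtract from it the
   gradient with the same divergence. *)
Lemma gradG_of_orthogonal p : S p ->
  (forall q, S q -> divG G q = 0 -> dotE G p q = 0) ->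
  exists u, p = gradG G u.
Proof.
move=> Sp h; pose u := lap_inv (divG G p); exists u.
apply/eqP; rewrite -subr_eq0; apply/eqP; have Sd := skewEB Sp (skewE_gradG u).
have dv : divG G (p - gradG G u) = 0.
  by rewrite linearB /= -/(lapG G u) lap_invK ?subrr //; exact: zero_sum_divG.
apply: dotE_eq0 => //; rewrite dotEBl h //.
by rewrite -[X in _ - X]opprK -dot_divG // dv dot0r !oppr0 addr0.
Qed.

Lemma zero_sum_center u : (0 < d)%N ->
  zero_sum (u - const_mx ((\sum_i u 0 i) / d%:R)).
Proof.
move=> d0; rewrite /zero_sum /=.
rewrite (eq_bigr (fun i => u 0 i - (\sum_i u 0 i) / d%:R)) => [|i _]; last by rewrite !mxE.
rewrite big_split /= sumrN sumr_const card_ord -[X in _ - X]mulr_natr divfK ?subrr //.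
by rewrite pnatr_eq0 -lt0n.
Qed.

Lemma lapG_entry u i :
  lapG G u 0 i = \sum_(j | edge G i j) weight G i j * (u 0 j - u 0 i).
Proof.
rewrite mxE -sumrN; apply: eq_bigr => j e; rewrite mxE mulrA -expr2.
by rewrite sqr_sqrtr ?(ltW (weight_pos e)) // -mulrN opprB.
Qed.

Lemma weight_ge0 i j : 0 <= weight G i j.
Proof.
by have [e|/weight_off ->] := boolP (edge G i j); rewrite ?(ltW (weight_pos e)).
Qed.

Definition total_weight : R := \sum_i \sum_j weight G i j.

Lemma total_weight_ge0 : 0 <= total_weight.
Proof. by do 2!apply: sumr_ge0 => ? _; exact: weight_ge0. Qed.

Lemma degree_le i : \sum_(j | edge G i j) weight G i j <= total_weight.
Proof.
rewrite /total_weight [leRHS](bigD1 i) //=.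
apply: (@le_trans _ _ (\sum_j weight G i j)).
  rewrite [leLHS]big_mkcond /=; apply: ler_sum => j _.
  by case: ifP => // _; exact: weight_ge0.
by rewrite lerDl; do 2!apply: sumr_ge0 => ? _; exact: weight_ge0.
Qed.

Lemma weight_le_total i j : weight G i j <= total_weight.
Proof.
rewrite /total_weight (bigD1 i) //= (bigD1 j) //= -addrA lerDl.
rewrite addr_ge0 ?sumr_ge0 // => *; first exact: weight_ge0.
by apply: sumr_ge0 => *; exact: weight_ge0.
Qed.

Lemma gradG_bounded : exists2 C : R, 0 <= C & forall u, `|gradG G u| <= C * `|u|.
Proof.
exists (Num.sqrt total_weight * 2) => [|u]; first by rewrite mulr_ge0.
apply: mx_norm_le => [|i j]; first by rewrite !mulr_ge0.
rewrite mxE normrM (ger0_norm (sqrtr_ge0 _)) -mulrA ler_pM // ?ler_wsqrtr ?weight_le_total //.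
apply: le_trans (ler_normB _ _) _.
by have := mx_entry_le u 0 i; have := mx_entry_le u 0 j; lra.
Qed.

Lemma divG_bounded : exists2 C : R, 0 <= C & forall q, `|divG G q| <= C * `|q|.
Proof.
exists (d%:R * Num.sqrt total_weight) => [|q]; first by rewrite mulr_ge0.
apply: mx_norm_le => [|k i]; first by rewrite !mulr_ge0.
rewrite mxE normrN -mulrA; apply: le_trans (ler_norm_sum _ _ _) _.
apply: sum_le_card => [|j]; first by rewrite mulr_ge0.
rewrite normrM (ger0_norm (sqrtr_ge0 _)) ler_pM ?mx_entry_le // ler_wsqrtr //.
exact: weight_le_total.
Qed.

(** A Poincare inequality in weak form: a zero-sum vector is a Laplacian, and the
   Laplacian moves onto the other factor as a gradient. *)
Lemma poincare : exists2 C : R, 0 <= C & forall e r, zero_sum r ->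
  `|dot e r| <= C * (`|gradG G e| * `|r|).
Proof.
pose A := d%:R * `|invmx lap_reg|.
have [B B0 hg] := gradG_bounded.
have A0 : 0 <= A by rewrite mulr_ge0.
have hA (b : 'rV_d) : `|lap_inv b| <= A * `|b|.
  apply: mx_norm_le => [|i j]; first by rewrite mulr_ge0.
  rewrite mxE; apply: le_trans (ler_norm_sum _ _ _) _.
  rewrite /A -mulrA; apply: sum_le_card => [|k]; first by rewrite mulr_ge0.
  by rewrite normrM mulrC ler_pM // mx_entry_le.
exists (d%:R ^+ 2 * (B * A)); first by rewrite !mulr_ge0.
move=> e r zr; rewrite -[r in leLHS]lap_invK // dot_lapG normrN.
apply: le_trans (norm_dotE_le _ _) _.
have -> : d%:R ^+ 2 * (B * A) * (`|gradG G e| * `|r|) =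
  d%:R ^+ 2 * (`|gradG G e| * (B * (A * `|r|))) by ring.
do 2!apply: ler_wpM2l => //.
apply: le_trans (hg _) _; by rewrite ler_wpM2l // mulr_ge0.
Qed.

End Calculus.
#[export] Hint Resolve skewE_gradG skewE0 : core.

(** * Smooth functions in finitely many variables *)

Section Lines.
Context {R : realType} {E W : normedModType R}.
Implicit Types (f : E -> W) (x v : E).

Lemma line_quotient f x v (s : R) :
  (fun h : R => h^-1 *: (((fun t : R => f (x + t *: v)) \o shift s) (h *: 1)
                         - f (x + s *: v))) =
  (fun h : R => h^-1 *: ((f \o shift (x + s *: v)) (h *: v) - f (x + s *: v))).
Proof.
apply: funext => h; congr (_ *: (_ - _)) => /=; congr f.
by rewrite -[h *: 1]/(h * 1) mulr1 scalerDl addrCA.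
Qed.

Lemma derivable_line f x v s : derivable f (x + s *: v) v ->
  is_derive s 1 (fun t : R => f (x + t *: v)) ('D_v f (x + s *: v)).
Proof.
by move=> df; split; rewrite /derivable /derive line_quotient.
Qed.

Lemma is_derive_line f x v s : differentiable f (x + s *: v) ->
  is_derive s 1 (fun t : R => f (x + t *: v)) ('D_v f (x + s *: v)).
Proof. by move=> df; apply: derivable_line; exact: diff_derivable. Qed.

Lemma is_derive_sum_fun (I : Type) (r : seq I) (P : pred I) (h : I -> E -> W)
    (dh : I -> W) x v :
  (forall i, P i -> is_derive x v (h i) (dh i)) ->
  is_derive x v (fun y => \sum_(i <- r | P i) h i y) (\sum_(i <- r | P i) dh i).
Proof.
move=> H; elim: r => [|i r IH].
  rewrite big_nil (_ : (fun _ => _) = cst 0); first exact: is_derive_cst.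
  by apply: funext => y; rewrite big_nil.
rewrite big_cons; case: ifPn => Pi.
  rewrite (_ : (fun _ => _) = h i + (fun y => \sum_(i <- r | P i) h i y)).
    by apply: is_deriveD => //; exact: H.
  by apply: funext => y; rewrite big_cons Pi.
rewrite (_ : (fun _ => _) = (fun y => \sum_(i <- r | P i) h i y)) //.
by apply: funext => y; rewrite big_cons (negbTE Pi).
Qed.

Lemma cvg_sum_fun (T : Type) (F : set_system T) {FF : Filter F} (I : Type)
    (r : seq I) (P : pred I) (h : I -> T -> W) (l : I -> W) :
  (forall i, P i -> h i x @[x --> F] --> l i) ->
  (\sum_(i <- r | P i) h i x) @[x --> F] --> \sum_(i <- r | P i) l i.
Proof. by move=> H; apply: cvg_big => //; exact: add_continuous. Qed.

End Lines.

Section Taylor.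
Context {R : realType}.
Implicit Types g : R -> R.

Lemma is_derive_continuous g (s l : R) :
  is_derive s (1 : R) g l -> {for s, continuous g}.
Proof.
by move=> gl; apply/differentiable_continuous/derivable1_diffP; exact: ex_derive.
Qed.

Lemma mvt_itv g g' (a b : R) : a < b ->
  (forall s : R, a <= s <= b -> is_derive s (1 : R) g (g' s)) ->
  exists2 s, a < s < b & g b - g a = g' s * (b - a).
Proof.
move=> ab h; have [s||s] := @MVT R g g' a b ab.
- by rewrite in_itv /= => /andP[/ltW s1 /ltW s2]; apply: h; rewrite s1.
- apply: continuous_in_subspaceT => s; rewrite inE /= in_itv /= => hs.
  exact: is_derive_continuous (h _ hs).
by rewrite in_itv /= => hs ->; exists s.
Qed.

Lemma le_of_derive_ge0 g g' (a b : R) : a <= b ->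
  (forall s : R, a <= s <= b -> is_derive s (1 : R) g (g' s)) ->
  (forall s, a <= s <= b -> 0 <= g' s) -> g a <= g b.
Proof.
rewrite le_eqVlt => /predU1P[->//|ab] h h0.
have [s /andP[s1 s2] E] := mvt_itv ab h.
by rewrite -subr_ge0 E mulr_ge0 ?subr_ge0 ?(ltW ab) // h0 // !ltW.
Qed.

(** The factor [e] (plus or minus one in practice) treats convex and concave
   functions at once. *)
Lemma taylor2 g g' g'' (e c : R) :
  (forall s : R, 0 <= s <= 1 -> is_derive s (1 : R) g (g' s)) ->
  (forall s : R, 0 <= s <= 1 -> is_derive s (1 : R) g' (g'' s)) ->
  (forall s, 0 <= s <= 1 -> c <= e * g'' s) ->
  c / 2 <= e * (g 1 - g 0 - g' 0).
Proof.
move=> h1 h2 hc.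
pose k := fun s : R => e * (g s - g' 0 * s) - c / 2 * s ^+ 2.
pose k' := fun s : R => e * (g' s - g' 0) - c * s.
have dk (s : R) : 0 <= s <= 1 -> is_derive s (1 : R) k (k' s).
  move=> /h1 hs; rewrite /k /k'; apply: is_derive_eq.
  by rewrite /GRing.scale /=; field.
have : k 0 <= k 1.
  apply: (le_of_derive_ge0 ler01 dk) => s /andP[].
  rewrite le_eqVlt => /predU1P[<- _|s0 s1]; first by rewrite /k' subrr !mulr0 subr0.
  have [|t /andP[t0 t1] E2] := @mvt_itv g' g'' 0 s s0.
    by move=> t /andP[t0 t1]; apply: h2; rewrite t0 (le_trans t1).
  have ct : c <= e * g'' t by apply: hc; rewrite !ltW ?(lt_le_trans t1).
  by rewrite /k' E2 subr0 mulrA -mulrBl mulr_ge0 ?subr_ge0 // ltW.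
rewrite /k expr0n expr1n /= !mulr0 !mulr1 !subr0; lra.
Qed.

End Taylor.

Section FiniteBasis.
Context {R : realType} {E : normedModType R}.

(** An interface for coordinates, so that densities and pairs (density, flow) share
   one proof of the estimates below. *)
Record fin_basis := FinBasis {
  bas_idx : finType;
  bas_vec : bas_idx -> E;
  bas_coord : bas_idx -> E -> R;
  bas_sum : forall v, v = \sum_i bas_coord i v *: bas_vec i;
  bas_scal : forall i a v, bas_coord i (a *: v) = a * bas_coord i v;
  bas_le : forall i v, `|bas_coord i v| <= `|v|;
  bas_cont : forall i, continuous (bas_coord i) }.

Variable b : fin_basis.
Local Notation e := (@bas_vec b).
Local Notation c := (@bas_coord b).
Implicit Types (f : E -> R) (U K : set E).

Lemma derive_coord f x v : differentiable f x ->
  'D_v f x = \sum_i c i v * 'D_(e i) f x.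
Proof.
move=> df; rewrite deriveE // [in LHS](bas_sum b v) linear_sum /=.
by apply: eq_bigr => i _; rewrite linearZ /= deriveE.
Qed.

(** The second derivative along a varying direction becomes a sum of finitely many
   fixed continuous functions with coefficients quadratic in the direction; this is
   what makes compactness arguments over directions possible. *)
Lemma derive2_coord U f x v : open U -> U x -> C2_open U f ->
  'D_v ('D_v f) x =
  \sum_i \sum_j c i v * (c j v * 'D_(e j) ('D_(e i) f) x).
Proof.
move=> oU Ux [C1 C2].
have near_x : \forall y \near x, 'D_v f y = \sum_i c i v * 'D_(e i) f y.
  have : nbhs x U by exact: open_nbhs_nbhs.
  by apply: filterS => y /C1[df _]; exact: derive_coord.
rewrite (near_eq_derive v near_x).
have D i : is_derive x v (c i v *: 'D_(e i) f)
    (\sum_j c i v * (c j v * 'D_(e j) ('D_(e i) f) x)).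
  rewrite -mulr_sumr -derive_coord; last by case: (C2 (e i) x Ux).
  apply: is_deriveZ; apply: derivableP; apply: diff_derivable.
  by case: (C2 (e i) x Ux).
exact: (@derive_val _ _ _ _ _ _ _
  (is_derive_sum_fun (index_enum _) (P := xpredT) (fun i _ => D i))).
Qed.

Definition segment_convex K := forall x y (s : R), K x -> K y -> 0 <= s <= 1 ->
  K (x + s *: (y - x)).

Lemma compact_continuous_bounded K (f : E -> R) : compact K ->
  (forall x, K x -> {for x, continuous f}) ->
  exists2 M, 0 <= M & forall x, K x -> `|f x| <= M.
Proof.
move=> cK cf; have : compact (f @` K).
  apply: continuous_compact => //; apply: continuous_in_subspaceT => x.
  by rewrite inE; exact: cf.
move=> /compact_bounded[M [_ hM]]; exists (Num.max 0 (M + 1)).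
  by rewrite le_max lexx.
move=> x Kx; apply: le_trans (hM (M + 1) _ (f x) _) _; rewrite ?ltrDl //.
by rewrite le_max lexx orbT.
Qed.

(** Mean value theorem along segments, with the finitely many partial derivatives
   bounded by compactness. *)
Lemma lipschitz_of_C1 U K f : compact K -> segment_convex K -> K `<=` U ->
  C1_open U f ->
  exists2 C, 0 <= C & forall x y, K x -> K y -> `|f y - f x| <= C * `|y - x|.
Proof.
move=> cK sK KU C1.
have /choice[M hM] i : exists M, 0 <= M /\ forall x, K x -> `|'D_(e i) f x| <= M.
  have [|M M0 hM] := @compact_continuous_bounded K ('D_(e i) f) cK.
    by move=> x /KU/C1[_]; exact.
  by exists M.
exists (\sum_i M i); first by apply: sumr_ge0 => i _; case: (hM i).
move=> x y Kx Ky.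
have [|s /andP[s0 s1]] := @mvt_itv _ (fun t => f (x + t *: (y - x)))
    (fun t => 'D_(y - x) f (x + t *: (y - x))) 0 1 ltr01.
  move=> s hs; apply: is_derive_line.
  by case: (C1 (x + s *: (y - x)) _); first by apply: KU; exact: sK.
have -> : x + 1 *: (y - x) = y by rewrite scale1r addrC subrK.
rewrite scale0r addr0 subr0 mulr1 => ->.
have Ks : K (x + s *: (y - x)) by apply: sK => //; rewrite !ltW.
rewrite derive_coord; last by case: (C1 _ (KU _ Ks)).
apply: le_trans (ler_norm_sum _ _ _) _; rewrite mulr_suml.
apply: ler_sum => i _; rewrite normrM mulrC ler_pM ?bas_le //.
by case: (hM i) => _; exact.
Qed.

(** A second derivative of fixed sign along a closed cone of directions is
   bounded away from zero on a compact set, by homogeneity. *)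
Lemma elliptic_on_compact U K (P : set E) f (sg : R) :
  open U -> compact K -> K `<=` U -> C2_open U f ->
  (forall a v, P v -> P (a *: v)) -> compact (P `&` [set v | `|v| = 1]) ->
  (forall x v, K x -> P v -> v != 0 -> 0 < sg * 'D_v ('D_v f) x) ->
  exists2 m, 0 < m & forall x v, K x -> P v ->
    m * `|v| ^+ 2 <= sg * 'D_v ('D_v f) x.
Proof.
move=> oU cK KU C2 Pa cP pos.
pose Q (z : E * E) := sg *
  \sum_i \sum_j c i z.2 * (c j z.2 * 'D_(e j) ('D_(e i) f) z.1).
have QE x v : K x -> sg * 'D_v ('D_v f) x = Q (x, v).
  by move=> /KU Ux; rewrite (derive2_coord v oU Ux).
have Qhom x a v : Q (x, a *: v) = a ^+ 2 * Q (x, v).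
  rewrite /Q /= [RHS]mulrCA; congr (_ * _); rewrite mulr_sumr;  apply: eq_bigr => i _.
  by rewrite mulr_sumr; apply: eq_bigr => j _; rewrite !bas_scal; ring.
pose D := K `*` (P `&` [set v | `|v| = 1]).
have Qcont z : D z -> {for z, continuous Q}.
  case: z => x v [/KU Ux _]; apply: cvgMr.
  apply: cvg_sum_fun => i _; apply: cvg_sum_fun => j _.
  have cc k : c k z.2 @[z --> (x, v)] --> c k v.
    by apply: continuous_comp; [exact: cvg_snd|exact: bas_cont].
  apply: cvgM; first exact: cc.
  apply: cvgM; first exact: cc.
  apply: (@continuous_comp _ _ _ fst ('D_(e j) ('D_(e i) f))); first exact: cvg_fst.
  by case: C2 => _ /(_ (e i) x Ux)[_]; exact.
have [[z Dz]|D0] := pselect (D !=set0); last first.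
  exists 1 => // x v Kx Pv; rewrite QE //.
  have [->|v0] := eqVneq v 0.
    by rewrite -(scale0r (0 : E)) Qhom expr0n /= scale0r normr0 expr0n /= !mul0r mulr0.
  exfalso; apply: D0; exists (x, `|v|^-1 *: v); split=> //; split; first exact: Pa.
  by rewrite /= normrZ normfV normr_id mulVf // normr_eq0.
have [|[x0 v0] Dm hm] := @compact_EVT_min _ _ Q D (ex_intro _ z Dz) (compact_setX cK cP).
  by apply: continuous_in_subspaceT => y; rewrite inE; exact: Qcont.
rewrite inE in Dm; case: Dm => /= Kx0 [Pv0 nv0].
exists (Q (x0, v0)).
  by rewrite -QE //; apply: pos => //; rewrite -normr_gt0 nv0.
move=> x v Kx Pv; rewrite QE //.
have [->|vn0] := eqVneq v 0.
  by rewrite -(scale0r (0 : E)) Qhom expr0n /= scale0r normr0 expr0n /= !mul0r mulr0.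
have nv : `|v| != 0 by rewrite normr_eq0.
rewrite -[in leRHS](scale1r v) -(divff nv) -scalerA Qhom mulrC.
apply: (ler_wpM2l (sqr_ge0 `|v|)).
apply: (hm (x, `|v|^-1 *: v)); rewrite inE; split=> //; split.
  exact: Pa.
by rewrite /= normrZ normfV normr_id mulVf.
Qed.

Lemma taylor2_segment U f x v (sg m : R) : C2_open U f ->
  (forall s : R, 0 <= s <= 1 -> U (x + s *: v)) ->
  (forall s : R, 0 <= s <= 1 -> m <= sg * 'D_v ('D_v f) (x + s *: v)) ->
  m / 2 <= sg * (f (x + v) - f x - 'D_v f x).
Proof.
move=> [C1 C2] hU hm.
have h1 (s : R) : 0 <= s <= 1 ->
    is_derive s (1 : R) (fun s : R => f (x + s *: v)) ('D_v f (x + s *: v)).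
  by move=> /hU /C1[df _]; exact: is_derive_line.
have h2 (s : R) : 0 <= s <= 1 -> is_derive s (1 : R)
    (fun s : R => 'D_v f (x + s *: v)) ('D_v ('D_v f) (x + s *: v)).
  by move=> /hU /(C2 v)[df _]; exact: is_derive_line.
by have := taylor2 h1 h2 hm; rewrite scale1r scale0r addr0.
Qed.

End FiniteBasis.

(** * Compact sets of densities and flows *)

Section Compactness.
Context {R : realType}.

Lemma closed_forall (T : topologicalType) (I : Type) (A : I -> set T) :
  (forall i, closed (A i)) -> closed [set x | forall i, A i x].
Proof.
move=> h; rewrite (_ : [set _ | _] = \bigcap_i A i); first exact: closed_bigI.
by apply/seteqP; split=> x /= H i; [move=> _|]; apply: H.
Qed.

Lemma closed_le_fun (T : topologicalType) (f : T -> R) (c : R) :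
  continuous f -> closed [set x | f x <= c].
Proof.
by move=> cf; apply: (@preimage_closed _ _ f [set y | y <= c]);
  [move=> x _; exact: cf|exact: closed_le].
Qed.

Lemma closed_ge_fun (T : topologicalType) (f : T -> R) (c : R) :
  continuous f -> closed [set x | c <= f x].
Proof.
by move=> cf; apply: (@preimage_closed _ _ f [set y | c <= y]);
  [move=> x _; exact: cf|exact: closed_ge].
Qed.

Lemma closed_eq_fun (T : topologicalType) (f : T -> R) (c : R) :
  continuous f -> closed [set x | f x = c].
Proof.
by move=> cf; apply: (@preimage_closed _ _ f [set y | y = c]);
  [move=> x _; exact: cf|exact: closed_eq].
Qed.

Lemma mx_norm_continuous m n : continuous (fun M : 'M[R]_(m, n) => `|M|).
Proof. exact: norm_continuous. Qed.

Lemma rV_ball_compact n (C : R) : compact [set x : 'rV[R]_n | `|x| <= C].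
Proof.
apply: bounded_closed_compact; last exact/closed_le_fun/mx_norm_continuous.
exists C; split; first exact: num_real.
by move=> y Cy x /= /le_trans; apply; exact: ltW.
Qed.

(** Bounded closed sets are compact for row vectors; this carries the fact over to
   matrices. *)
Lemma vec_mx_continuous m n : continuous (@vec_mx R m n).
Proof.
move=> x A /nbhs_ballP[e e0 h]; apply/nbhs_ballP; exists e => // y [_ xy].
by apply: h; split=> // i j; rewrite !mxE; exact: xy.
Qed.

Lemma mx_ball_compact m n (C : R) : compact [set M : 'M[R]_(m, n) | `|M| <= C].
Proof.
have [C0|C0] := leP 0 C; last first.
  rewrite (_ : [set _ | _] = set0); first exact: compact0.
  by apply/seteqP; split=> // M /= /le_lt_trans/(_ C0); rewrite ltNge normr_ge0.
rewrite (_ : [set _ | _] = vec_mx @` [set x : 'rV[R]_(m * n) | `|x| <= C]).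
  apply: continuous_compact; last exact: rV_ball_compact.
  exact/continuous_subspaceT/vec_mx_continuous.
apply/seteqP; split=> [M /= hM|_ [x /= hx <-]]; last first.
  apply: mx_norm_le => // i j; rewrite mxE.
  exact: le_trans (mx_entry_le _ _ _) hx.
exists (mxvec M); last by rewrite mxvecK.
apply: mx_norm_le => // i k; rewrite ord1.
by case/mxvec_indexP: k => a b; rewrite mxvecE; exact: le_trans (mx_entry_le _ _ _) hM.
Qed.

Lemma mx_closed_bounded_compact m n (A : set 'M[R]_(m, n)) (C : R) :
  closed A -> (forall x, A x -> `|x| <= C) -> compact A.
Proof. by move=> cA hA; apply: (subclosed_compact cA (@mx_ball_compact m n C)). Qed.

Lemma cont_sum_fun (T : topologicalType) (I : Type) (r : seq I) (P : pred I)
    (h : I -> T -> R) :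
  (forall i, P i -> continuous (h i)) ->
  continuous (fun x => \sum_(i <- r | P i) h i x).
Proof. by move=> H x; apply: cvg_sum_fun => i Pi; exact: H. Qed.

End Compactness.

Section Sets.
Context {R : realType} {d : nat} (G : wgraph R d).
Local Notation S := (skewE G).

Lemma closed_skewE : closed S.
Proof.
have c a b := @coord_continuous R d d a b.
rewrite (_ : S = [set p | forall i, [set p | forall j, [set p | p j i + p i j = 0] p] p]
   `&` [set p | forall i, [set p | forall j,
         [set p | (if edge G i j then 0 else p i j) = 0] p] p]).
  apply: closedI; apply: closed_forall => i; apply: closed_forall => j.
    by apply: closed_eq_fun => p; exact: (cvgD (c _ _ p) (c _ _ p)).
  apply: closed_eq_fun; case: (edge G i j) => /=; last exact: c.
  exact: cst_continuous.
apply/seteqP; split=> p /=.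
  move=> Sp; split=> i j; first by rewrite (skewE_opp i j Sp) addNr.
  by case: ifPn => // /(proj2 Sp).
move=> [h1 h2]; split=> [|i j nij]; last by have := h2 i j; rewrite (negbTE nij).
apply/matrixP => i j; rewrite !mxE.
by apply/eqP; rewrite -addr_eq0 h1.
Qed.

Lemma dotE_continuous (q : 'M[R]_d) :
  continuous (fun w => dotE G w q).
Proof.
move=> w; apply: (@continuousM _ _ (fun=> 2^-1)); first exact: cst_continuous.
move: w; apply: cont_sum_fun => i _; apply: cont_sum_fun => j _ w.
apply: (@continuousM R _ (fun w : 'M[R]_d => w i j) (fun=> q i j) w).
  exact: coord_continuous.
exact: cst_continuous.
Qed.

Lemma compact_skew_ball (C : R) : compact (S `&` [set q | `|q| <= C]).
Proof.
apply: (@mx_closed_bounded_compact _ _ _ _ C); last by move=> q [].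
by apply: closedI; [exact: closed_skewE|exact/closed_le_fun/mx_norm_continuous].
Qed.

Lemma closed_zero_sum : closed (@zero_sum R d).
Proof.
by apply: closed_eq_fun; apply: cont_sum_fun => i _; exact: coord_continuous.
Qed.

Lemma simplex_norm_le (x : 'rV[R]_d) : simplex x -> `|x| <= 1.
Proof.
move=> [h _]; apply: mx_norm_le => // i j; rewrite ord1.
by have /andP[x0 x1] := h j; rewrite ger0_norm.
Qed.

Lemma simplex_dot_le (x y : 'rV[R]_d) c : simplex x -> (forall i, y 0 i <= c) ->
  dot y x <= c.
Proof.
move=> [x1 x2] h; rewrite -[leRHS]mulr1 -x2 mulr_sumr; apply: ler_sum => i _.
by rewrite ler_wpM2r //; case/andP: (x1 i).
Qed.

Lemma compact_simplex_ge (eps : R) : compact (@simplex_ge R d eps).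
Proof.
apply: (@mx_closed_bounded_compact _ _ _ _ 1); last by move=> x [/simplex_norm_le].
rewrite (_ : simplex_ge eps = [set x | forall i, [set x | 0 <= x 0 i] x] `&`
    [set x | forall i, [set x | x 0 i <= 1] x] `&` [set x | \sum_i x 0 i = 1] `&`
    [set x | forall i, [set x | eps <= x 0 i] x]).
  have cc i := @coord_continuous R 1 d 0 i.
  repeat apply: closedI; try (apply: closed_forall => i).
  - exact: closed_ge_fun.
  - exact: closed_le_fun.
  - by apply: closed_eq_fun; apply: cont_sum_fun => i _.
  - exact: closed_ge_fun.
apply/seteqP; split=> x /=.
  by move=> [[h1 h2] h3]; do !split=> //; move=> i; case/andP: (h1 i).
by move=> [[[h1 h2] h3] h4]; do !split=> //; move=> i; rewrite h1 h2.
Qed.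

Lemma simplex_ge0 : @simplex_ge R d 0 = simplex.
Proof.
by apply/seteqP; split=> x; [case|move=> h; split=> // i; case: h => /(_ i)/andP[]].
Qed.

Lemma compact_simplex : compact (@simplex R d).
Proof. by rewrite -simplex_ge0; exact: compact_simplex_ge. Qed.

Lemma simplex_ge_int (eps : R) : 0 < eps -> @simplex_ge R d eps `<=` simplex_int.
Proof. by move=> e0 x [h1 h2]; split=> // i; exact: lt_le_trans (h2 i). Qed.

Lemma zero_sumB (x y : 'rV[R]_d) : simplex x -> simplex y -> zero_sum (x - y).
Proof.
move=> [_ hx] [_ hy]; rewrite /zero_sum /=.
rewrite (eq_bigr (fun i => x 0 i - y 0 i)) => [|i _]; last by rewrite !mxE.
by rewrite big_split /= sumrN hx hy subrr.
Qed.

Lemma segment_simplex_ge (eps : R) : segment_convex (@simplex_ge R d eps).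
Proof.
move=> x y s [[x1 x2] x3] [[y1 y2] y3] /andP[s0 s1].
have E i : (x + s *: (y - x)) 0 i = (1 - s) * x 0 i + s * y 0 i by rewrite !mxE; ring.
split; [split|] => [i||i].
- rewrite E; have /andP[a b] := x1 i; have /andP[a' b'] := y1 i.
  by apply/andP; split; nra.
- by rewrite (eq_bigr _ (fun i _ => E i)) big_split /= -!mulr_sumr x2 y2; ring.
- by rewrite E; have := x3 i; have := y3 i; nra.
Qed.

(** The compact sets on which all constants of the error analysis live; they are
   convex, so that derivative bounds on them become Lipschitz bounds. *)
Definition phase (eps C : R) : set ('rV[R]_d * 'M[R]_d) :=
  simplex_ge eps `*` (S `&` [set q | `|q| <= C]).

Lemma compact_phase eps C : compact (phase eps C).
Proof.
by apply: compact_setX; [exact: compact_simplex_ge|exact: compact_skew_ball].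
Qed.

Lemma segment_phase eps C : segment_convex (phase eps C).
Proof.
move=> [x q] [y r] s [/= hx [Sq hq]] [/= hy [Sr hr]] hs; split=> /=.
  exact: segment_simplex_ge.
split; first by apply: skewED => //; apply: skewEZ; exact: skewEB.
have /andP[s0 s1] := hs.
have -> : q + s *: (r - q) = (1 - s) *: q + s *: r.
  by rewrite scalerBr scalerBl scale1r addrA addrAC.
apply: le_trans (ler_normD _ _) _; rewrite !normrZ !ger0_norm ?subr_ge0 //.
by move: hq hr => /=; nra.
Qed.

Lemma phase_int eps C : 0 < eps -> phase eps C `<=` simplex_int `*` S.
Proof. by move=> e0 z [/(simplex_ge_int e0) h1 [h2 _]]. Qed.

Lemma sphere_zero_sum : compact (@zero_sum R d `&` [set v | `|v| = 1]).
Proof.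
apply: (@mx_closed_bounded_compact _ _ _ _ 1); last by move=> x [_ /= ->].
by apply: closedI; [exact: closed_zero_sum|exact/closed_eq_fun/mx_norm_continuous].
Qed.

End Sets.

Section Bases.
Context {R : realType}.

Lemma rV_bas_sum d (v : 'rV[R]_d) : v = \sum_i v 0 i *: delta_mx 0 i.
Proof. exact: row_sum_delta. Qed.

Definition rV_basis d : @fin_basis R 'rV[R]_d :=
  @FinBasis R 'rV[R]_d 'I_d (delta_mx 0) (fun i v => v 0 i) (@rV_bas_sum d)
    (fun i a v => mxE _ _ _ _) (fun i v => mx_entry_le v 0 i)
    (fun i => @coord_continuous _ _ _ 0 i).

Definition pair_vec d (k : 'I_d + 'I_d * 'I_d) : 'rV[R]_d * 'M[R]_d :=
  match k with inl i => (delta_mx 0 i, 0) | inr (i, j) => (0, delta_mx i j) end.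
Definition pair_coord d (k : 'I_d + 'I_d * 'I_d) (z : 'rV[R]_d * 'M[R]_d) : R :=
  match k with inl i => z.1 0 i | inr (i, j) => z.2 i j end.

Lemma sum_pair (U V : lmodType R) (I : Type) (r : seq I) (P : pred I)
  (f : I -> U * V) : \sum_(i <- r | P i) f i =
  (\sum_(i <- r | P i) (f i).1, \sum_(i <- r | P i) (f i).2).
Proof.
elim: r => [|i r IH]; first by rewrite !big_nil.
by rewrite !big_cons; case: ifP => // _; rewrite IH; case: (f i).
Qed.

Lemma pair_bas_sum d (z : 'rV[R]_d * 'M[R]_d) :
  z = \sum_k pair_coord k z *: pair_vec k.
Proof.
rewrite big_sumType /= !sum_pair /=; case: z => x p; congr (_, _) => /=.
  rewrite -row_sum_delta [X in _ + X]big1 ?addr0 // => -[i j] _ /=.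
  by rewrite scaler0.
rewrite big1 => [|i _]; last by rewrite scaler0.
rewrite add0r [LHS]matrix_sum_delta pair_bigA /=.
by apply: eq_bigr => -[i j].
Qed.

Lemma pair_coord_le d k (z : 'rV[R]_d * 'M[R]_d) : `|pair_coord k z| <= `|z|.
Proof.
rewrite prod_normE le_max.
by case: k => [i|[i j]] /=; rewrite mx_entry_le ?orbT.
Qed.

Lemma pair_coord_cont d k : continuous (@pair_coord d k).
Proof.
case: k => [i|[i j]] z /=.
  by apply: (@continuous_comp _ _ _ fst (fun x : 'rV[R]_d => x 0 i) z);
    [exact: cvg_fst|exact: coord_continuous].
by apply: (@continuous_comp _ _ _ snd (fun p : 'M[R]_d => p i j) z);
  [exact: cvg_snd|exact: coord_continuous].
Qed.

Lemma pair_coord_scal d k a (z : 'rV[R]_d * 'M[R]_d) :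
  pair_coord k (a *: z) = a * pair_coord k z.
Proof. by case: k => [i|[i j]]; rewrite /= mxE. Qed.

Definition pair_basis d : @fin_basis R ('rV[R]_d * 'M[R]_d)%type :=
  FinBasis (@pair_bas_sum d) (@pair_coord_scal d) (@pair_coord_le d)
    (@pair_coord_cont d).

End Bases.

Section PartialDerivatives.
Context {R : realType} {d : nat}.
Variable H : 'rV[R]_d -> 'M[R]_d -> R.
Local Notation Hz := (fun z : 'rV[R]_d * 'M[R]_d => H z.1 z.2).

Lemma partial_q x q r : 'D_r (H x) q = 'D_((0, r) : 'rV[R]_d * 'M[R]_d) Hz (x, q).
Proof.
rewrite /derive; set f := (fun _ : R => _); set g := (fun _ : R => _).
suff -> : f = g by []; apply: funext => h; rewrite /f /g /=.
by rewrite scaler0 add0r.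
Qed.

Lemma partial_rho x q v :
  'D_v (fun y => H y q) x = 'D_((v, 0) : 'rV[R]_d * 'M[R]_d) Hz (x, q).
Proof.
rewrite /derive; set f := (fun _ : R => _); set g := (fun _ : R => _).
suff -> : f = g by []; apply: funext => h; rewrite /f /g /=.
by rewrite scaler0 add0r.
Qed.

End PartialDerivatives.

(** * One-dimensional convexity *)

Section Chords.
Context {R : realType}.

(** The tangent inequality, with chords towards a value [b] that need not be a limit
   of [g]: the Lagrangian may jump at the boundary of the simplex. *)
Lemma derive_le_chord (g : R -> R) (l b : R) :
  is_derive (0 : R) (1 : R) g l ->
  (forall t, 0 < t < 1 -> g t <= (1 - t) * g 0 + t * b) -> l <= b - g 0.
Proof.
move=> [dg El] H.
have /cvg_dnbhs_at_right C0 : (fun h : R => h^-1 *: ((g \o shift 0) (h *: 1) - g 0)) x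
    @[x --> 0^'] --> l by rewrite -El; exact: dg.
apply: (@closed_cvg _ _ _ _ _ [set y | y <= b - g 0] (@closed_le R _) _ _ C0).
near=> t.
have t0 : 0 < t by [].
have t1 : t < 1 by near: t; apply: nbhs_right_lt.
have := H t; rewrite t0 t1 => /(_ isT).
rewrite /= addr0 -[t *: 1]/(t * 1) mulr1 -[_ *: _]/(_ * _) ler_pdivrMl //.
by nra.
Unshelve. all: by end_near. Qed.

Lemma derive_ge0_of_min (g : R -> R) (l : R) :
  is_derive (0 : R) (1 : R) g l ->
  (\forall t \near (0 : R), g 0 <= g t) -> 0 <= l.
Proof.
move=> [dg El] H.
have /cvg_dnbhs_at_right C0 : (fun h : R => h^-1 *: ((g \o shift 0) (h *: 1) - g 0)) x
    @[x --> 0^'] --> l by rewrite -El; exact: dg.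
suff : [set y : R | 0 <= y] l by [].
apply: (@closed_cvg _ _ _ _ _ _ (@closed_ge R 0) _ _ C0).
near=> t.
have t0 : 0 < t by [].
have gt : g 0 <= g t.
  by near: t; apply: filterS H => y gy _.
rewrite /= addr0 -[t *: 1]/(t * 1) mulr1 -[_ *: _]/(_ * _).
by rewrite mulr_ge0 ?invr_ge0 ?subr_ge0 // ltW.
Unshelve. all: by end_near. Qed.

End Chords.

Section Gradients.
Context {R : realType} {d : nat}.

Lemma dot_grad_rho (f : 'rV[R]_d -> R) x v : differentiable f x ->
  dot (grad_rho f x) v = 'D_v f x.
Proof.
move=> df; rewrite (derive_coord (rV_basis d)) //.
by apply: eq_bigr => i _; rewrite mxE mulrC.
Qed.

End Gradients.

(** * Monotonicity and regularity of the data *)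

Section Data.
Context {R : realType} {d : nat} (G : wgraph R d).
Variables (H : 'rV[R]_d -> 'M[R]_d -> R) (F UT : 'rV[R]_d -> R).
Hypothesis hP : assumption_P G H F UT.
Local Notation S := (skewE G).
Local Notation Hz := (fun z : 'rV[R]_d * 'M[R]_d => H z.1 z.2).
Local Notation gR q := (grad_rho (fun r => H r q)).
Local Notation gS x := (grad_skew G (H x)).

Lemma diff_Hz x q : simplex_int x -> S q -> differentiable Hz (x, q).
Proof.
move=> ix Sq; have [U [_ KU [C1 _]]] := P_H hP.
by have [] := C1 (x, q) (KU (x, q) (conj ix Sq)).
Qed.

Lemma diff_H_rho x q : simplex_int x -> S q -> differentiable (fun r => H r q) x.
Proof.
move=> ix Sq.
apply: (@differentiable_comp _ _ _ _ (fun r : 'rV[R]_d => (r, q)) Hz).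
  by apply: differentiable_pair.
exact: diff_Hz.
Qed.

Lemma diff_H_q x q : simplex_int x -> S q -> differentiable (H x) q.
Proof.
move=> ix Sq.
apply: (@differentiable_comp _ _ _ _ (fun r : 'M[R]_d => (x, r)) Hz).
  by apply: differentiable_pair.
exact: diff_Hz.
Qed.

Lemma diff_UT x : simplex x -> differentiable UT x.
Proof. by move=> sx; have [U [_ KU [C1 _]]] := P_UT hP; have [] := C1 x (KU x sx). Qed.

Lemma diff_F x : simplex x -> differentiable F x.
Proof. by move=> sx; have [U [_ KU [C1 _]]] := P_F hP; have [] := C1 x (KU x sx). Qed.

Lemma dot_grad_H x q v : simplex_int x -> S q ->
  dot (gR q x) v = 'D_((v, 0) : 'rV[R]_d * 'M[R]_d) Hz (x, q).
Proof. by move=> ix Sq; rewrite dot_grad_rho ?partial_rho //; exact: diff_H_rho. Qed.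

Lemma dotE_grad_H x q v : simplex_int x -> S q -> S v ->
  dotE G (gS x q) v = 'D_((0, v) : 'rV[R]_d * 'M[R]_d) Hz (x, q).
Proof. by move=> ix Sq Sv; rewrite dotE_grad_skew ?partial_q //; exact: diff_H_q. Qed.

Lemma skewE_gradH x q : simplex_int x -> S q -> S (gS x q).
Proof. by move=> ix Sq; apply: skew_grad_skew; exact: diff_H_q. Qed.

Lemma partial_q2 x q r :
  'D_r ('D_r (H x)) q = 'D_((0, r) : 'rV[R]_d * 'M[R]_d)
                        ('D_((0, r) : 'rV[R]_d * 'M[R]_d) Hz) (x, q).
Proof.
have -> : 'D_r (H x) = fun q => 'D_((0, r) : 'rV[R]_d * 'M[R]_d) Hz (x, q).
  by apply: funext => q'; rewrite partial_q.
exact: (@partial_q _ _ (fun x q => 'D_((0, r) : 'rV[R]_d * 'M[R]_d) Hz (x, q))).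
Qed.

Lemma partial_rho2 x q v :
  'D_v ('D_v (fun r => H r q)) x = 'D_((v, 0) : 'rV[R]_d * 'M[R]_d)
                        ('D_((v, 0) : 'rV[R]_d * 'M[R]_d) Hz) (x, q).
Proof.
have -> : 'D_v (fun r => H r q) = fun x => 'D_((v, 0) : 'rV[R]_d * 'M[R]_d) Hz (x, q).
  by apply: funext => x'; rewrite partial_rho.
exact: (@partial_rho _ _ (fun x q => 'D_((v, 0) : 'rV[R]_d * 'M[R]_d) Hz (x, q))).
Qed.

(** Strict positivity of the second derivative in [q] becomes a uniform modulus of
   convexity by compactness, applied to the pairs with zero density component. *)
Lemma H_convex eps C : 0 < eps -> exists2 m, 0 < m & forall x q q',
  phase G eps C (x, q) -> phase G eps C (x, q') ->
  H x q + dotE G (gS x q) (q' - q) + m * `|q' - q| ^+ 2 <= H x q'.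
Proof.
move=> e0; have [U [oU KU C2]] := P_H hP.
pose P := [set v : 'rV[R]_d * 'M[R]_d | v.1 = 0 /\ S v.2].
have PU : phase G eps C `<=` U by move=> z /(phase_int e0)/KU.
have nE (r : 'M[R]_d) : `|((0, r) : 'rV[R]_d * 'M[R]_d)| = `|r|.
  by rewrite prod_normE /= normr0 max_r.
have [|||m m0 hm] := @elliptic_on_compact _ _ (pair_basis d) U (phase G eps C) P
    Hz 1 oU (@compact_phase R d G eps C) PU C2.
- by move=> a [v1 v2] [/= -> Sv]; split; [rewrite /= scaler0|exact: skewEZ].
- rewrite (_ : _ `&` _ = [set 0] `*` (S `&` [set q | `|q| = 1])).
    apply: compact_setX; first exact: compact_set1.
    apply: (@mx_closed_bounded_compact _ _ _ _ 1); last by move=> x [_ /= ->].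
    by apply: closedI; [exact: closed_skewE|exact/closed_eq_fun/mx_norm_continuous].
  apply/seteqP; split=> -[v1 v2] /= [].
    by move=> [/= -> Sv]; rewrite nE.
  by move=> -> [Sv nv]; rewrite nE.
- move=> [x q] [v1 v2] Kx [/= -> Sv] v0; rewrite mul1r.
  have [ix Sq] := phase_int e0 Kx.
  rewrite -(@partial_q2 x q v2); apply: (P_H_q hP) => //.
  by apply: contra_neq v0 => ->.
exists (m / 2); first by rewrite divr_gt0.
move=> x q q' Kq Kq'; have [ix Sq] := phase_int e0 Kq.
have [_ Sq'] := phase_int e0 Kq'.
have Sd : S (q' - q) by exact: skewEB.
have seg (s : R) : 0 <= s <= 1 ->
    phase G eps C ((x, q) + s *: ((0, q' - q) : 'rV[R]_d * 'M[R]_d)).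
  move=> hs; have := segment_phase Kq Kq' hs.
  by rewrite (_ : (x, q') - (x, q) = (0, q' - q)) // -[LHS]/(x - x, q' - q) subrr.
have := @taylor2_segment _ _ U Hz (x, q) (0, q' - q) 1 (m * `|q' - q| ^+ 2) C2 _ _.
rewrite -dotE_grad_H //.
have -> : (x, q) + ((0, q' - q) : 'rV[R]_d * 'M[R]_d) = (x, q').
  by rewrite -[LHS]/(x + 0, q + (q' - q)) addr0 addrC subrK.
move=> /= T.
suff : m * `|q' - q| ^+ 2 / 2 <= 1 * (H x q' - H x q - dotE G (gS x q) (q' - q)) by lra.
apply: T => s hs; first by apply: PU; exact: seg.
by rewrite -nE; apply: hm; [exact: seg|].
Qed.

Lemma H_concave x x' q : simplex_int x -> simplex_int x' -> S q ->
  H x' q <= H x q + dot (gR q x) (x' - x).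
Proof.
move=> ix ix' Sq; have [U [oU KU C2]] := P_H hP.
pose v : 'rV[R]_d * 'M[R]_d := (x' - x, 0).
have seg (s : R) : 0 <= s <= 1 -> simplex_int (x + s *: (x' - x)).
  move=> /andP[s0 s1]; have [sx px] := ix; have [sx' px'] := ix'.
  have [] := @segment_simplex_ge R d 0 x x' s; rewrite ?simplex_ge0 //.
    by rewrite s0.
  move=> sy _; split=> // i; rewrite !mxE.
  by have := px i; have := px' i; nra.
have E (s : R) : (x, q) + s *: v = (x + s *: (x' - x), q).
  by rewrite -[LHS]/(x + s *: (x' - x), q + s *: 0) scaler0 addr0.
have := @taylor2_segment _ _ U Hz (x, q) v (-1) 0 C2 _ _.
have := E 1; rewrite !scale1r => ->; rewrite -dot_grad_H //= (addrC x) subrK => T.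
suff : 0 / 2 <= -1 * (H x' q - H x q - dot (gR q x) (x' - x)) by lra.
apply: T => s hs; rewrite E; first by apply: KU; split=> //; exact: seg.
rewrite mulN1r oppr_ge0 -partial_rho2; apply: (P_H_rho hP) => //; first exact: seg.
by apply: zero_sumB; [case: ix'|case: ix].
Qed.

(** The Lasry-Lions monotonicity of the coefficients. Each pair of tangent
   inequalities is summed at two points, so that no mixed second derivative
   of the Hamiltonian occurs. *)
Lemma H_monotone eps C : 0 < eps -> exists2 m, 0 < m & forall x q x' q',
  phase G eps C (x, q) -> phase G eps C (x', q') ->
  dot (gR q' x' - gR q x) (x' - x) - dotE G (gS x' q' - gS x q) (q' - q)
    <= - m * `|q' - q| ^+ 2.
Proof.
move=> e0; have [m m0 hm] := H_convex C e0; exists (2 * m); first by rewrite mulr_gt0.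
move=> x q x' q' K K'.
have [ix Sq] := phase_int e0 K; have [ix' Sq'] := phase_int e0 K'.
have K1 : phase G eps C (x, q') by split; [case: K|case: K'].
have K2 : phase G eps C (x', q) by split; [case: K'|case: K].
have h1 := hm _ _ _ K K1; have h2 := hm _ _ _ K' K2.
have h3 := H_concave ix ix' Sq; have h4 := H_concave ix' ix Sq'.
move: h2 h4; rewrite -(opprB q') normrN -(opprB x') dotENr dotNr.
rewrite dotBl dotEBl => h2 h4; simpl in *; lra.
Qed.

(** On the compact set of densities at least [eps] the negative second derivative has
   a uniform bound, which the mean value theorem transfers to the gradient. *)
Lemma F_monotone eps : 0 < eps -> exists2 m, 0 < m & forall x x',
  simplex_ge eps x -> simplex_ge eps x' ->
  dot (grad_rho F x' - grad_rho F x) (x' - x) <= - m * `|x' - x| ^+ 2.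
Proof.
move=> e0; have [U [oU KU C2]] := P_F hP.
have PU : simplex_ge eps `<=` U by move=> z [/KU].
have [|||m m0 hm] := @elliptic_on_compact _ _ (rV_basis d) U (simplex_ge eps)
    zero_sum F (-1) oU (@compact_simplex_ge R d eps) PU C2.
- exact: zero_sumZ.
- exact: sphere_zero_sum.
- move=> x v /(simplex_ge_int e0) ix zv v0; rewrite mulN1r oppr_gt0.
  exact: (P_F_rho hP).
exists m => // x x' gx gx'.
have zv : zero_sum (x' - x) by apply: zero_sumB; [case: gx'|case: gx].
have seg (s : R) : 0 <= s <= 1 -> simplex_ge eps (x + s *: (x' - x)).
  exact: segment_simplex_ge.
have [|s /andP[s0 s1]] := @mvt_itv _ (fun s => 'D_(x' - x) F (x + s *: (x' - x)))
    (fun s => 'D_(x' - x) ('D_(x' - x) F) (x + s *: (x' - x))) 0 1 ltr01.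
  by move=> s hs; apply: is_derive_line; case: C2 => _ /(_ (x' - x) _ (PU _ (seg _ hs)))[].
have -> : x + 1 *: (x' - x) = x' by rewrite scale1r addrC subrK.
rewrite scale0r addr0 subr0 mulr1 => E.
rewrite dotBl !dot_grad_rho; [|by apply: diff_F; case: gx|by apply: diff_F; case: gx'].
have hs : 0 <= s <= 1 by rewrite !ltW.
by rewrite E; have := hm _ _ (seg s hs) zv; lra.
Qed.

(** The density may touch the boundary of the simplex here, where only the
   concavity inequality, not the sign of the second derivative, is available. *)
Lemma F_tangent x x' : simplex x -> simplex x' ->
  F x' <= F x + dot (grad_rho F x) (x' - x).
Proof.
move=> sx sx'; have [->|ne] := eqVneq x' x; first by rewrite subrr dot0r addr0.
have dF := diff_F sx; rewrite dot_grad_rho //.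
have D : is_derive (0 : R) (1 : R) (fun s : R => - F (x + s *: (x' - x)))
    (- 'D_(x' - x) F (x + 0 *: (x' - x))).
  by apply: is_deriveN; apply: is_derive_line; rewrite scale0r addr0.
have := derive_le_chord (b := - F x') D; rewrite !scale0r addr0 => h.
suff : - 'D_(x' - x) F x <= - F x' - - F x by lra.
apply: h => t t01; have := P_F_concave hP sx' sx ne t01.
have -> : t *: x' + (1 - t) *: x = x + t *: (x' - x).
  by rewrite scalerBr scalerBl scale1r addrCA.
by rewrite !fctE; lra.
Qed.

Lemma UT_tangent x x' : simplex x -> simplex x' ->
  dot (grad_rho UT x) (x' - x) <= UT x' - UT x.
Proof.
move=> sx sx'; rewrite dot_grad_rho; last exact: diff_UT.
have D : is_derive (0 : R) (1 : R) (fun s : R => UT (x + s *: (x' - x)))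
    ('D_(x' - x) UT (x + 0 *: (x' - x))).
  by apply: is_derive_line; rewrite scale0r addr0; exact: diff_UT.
have := derive_le_chord (b := UT x') D; rewrite !scale0r addr0; apply.
move=> t /andP[t0 t1].
have := P_UT_convex hP (Itv01 (ltW t0) (ltW t1)) (mem_set sx') (mem_set sx).
rewrite !convRE /= /conv /= /unstable.onem => h.
have -> : x + t *: (x' - x) = t *: x' + (1 - t) *: x.
  by rewrite scalerBr scalerBl scale1r addrCA.
by rewrite [leRHS]addrC.
Qed.

Lemma UT_monotone x x' : simplex x -> simplex x' ->
  0 <= dot (grad_rho UT x' - grad_rho UT x) (x' - x).
Proof.
move=> sx sx'; have := UT_tangent sx sx'; have := UT_tangent sx' sx.
rewrite dotBl -(opprB x') dotNr; lra.
Qed.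

Lemma lipschitz_derive_simplex (f : 'rV[R]_d -> R) v : C2_near (@simplex R d) f ->
  exists2 K, 0 <= K & forall x x', simplex x -> simplex x' ->
  `|'D_v f x' - 'D_v f x| <= K * `|x' - x|.
Proof.
move=> [U [oU KU [_ C2]]].
have sc : segment_convex (@simplex R d).
  by rewrite -simplex_ge0; exact: segment_simplex_ge.
exact: (@lipschitz_of_C1 _ _ (rV_basis d) U simplex _ (@compact_simplex R d) sc KU (C2 v)).
Qed.

Lemma UT_lipschitz : exists2 K, 0 <= K & forall x x',
  simplex x -> simplex x' -> `|grad_rho UT x' - grad_rho UT x| <= K * `|x' - x|.
Proof.
apply: (mx_lipschitz_of_entries (D := simplex)
  (dist := fun x x' : 'rV[R]_d => `|x' - x|)) => // k i.
have [K K0 h] := lipschitz_derive_simplex (delta_mx 0 i) (P_UT hP).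
by exists K => // x x' sx sx'; rewrite !mxE; exact: h.
Qed.

Lemma Hz_lipschitz eps C (v : 'rV[R]_d * 'M[R]_d) : 0 < eps ->
  exists2 K, 0 <= K & forall z z', phase G eps C z -> phase G eps C z' ->
  `|'D_v Hz z' - 'D_v Hz z| <= K * (`|z'.1 - z.1| + `|z'.2 - z.2|).
Proof.
move=> e0; have [U [oU KU [_ C2]]] := P_H hP.
have PU : phase G eps C `<=` U by move=> z /(phase_int e0)/KU.
have [K K0 h] := @lipschitz_of_C1 _ _ (pair_basis d) U (phase G eps C) _
  (@compact_phase R d G eps C) (@segment_phase R d G eps C) PU (C2 v).
exists K => // z z' pz pz'; apply: le_trans (h _ _ pz pz') _.
by rewrite ler_wpM2l // prod_normE ge_max lerDl lerDr !normr_ge0.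
Qed.

Lemma phaseN eps C x p : phase G eps C (x, p) -> phase G eps C (x, - p).
Proof. by move=> [h1 [h2 h3]]; split=> //; split; [exact: skewEN|rewrite /= normrN]. Qed.

Lemma coeff_H_lipschitz eps C : 0 < eps -> exists2 K, 0 <= K & forall x p x' p',
  phase G eps C (x, p) -> phase G eps C (x', p') ->
  `|coeff_H H F x' p' - coeff_H H F x p| <= K * (`|x' - x| + `|p' - p|).
Proof.
move=> e0; have [|k i|K K0 h] := @mx_lipschitz_of_entries R _ (phase G eps C) _ _
    (fun z => coeff_H H F z.1 z.2) (fun z z' => `|z'.1 - z.1| + `|z'.2 - z.2|).
- by move=> z z'; rewrite addr_ge0.
- have [K1 K10 h1] := Hz_lipschitz C (delta_mx 0 i, 0) e0.
  have [K2 K20 h2] := lipschitz_derive_simplex (delta_mx 0 i) (P_F hP).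
  exists (K1 + K2) => [|[x p] [x' p'] K K']; first exact: addr_ge0.
  have := h1 _ _ (phaseN K) (phaseN K'); rewrite -!partial_rho /= -opprD normrN => {}h1.
  have {}h2 := h2 x x' (proj1 (proj1 K)) (proj1 (proj1 K')).
  rewrite !mxE opprD addrACA; apply: le_trans (ler_normD _ _) _.
  rewrite mulrDl; apply: lerD => //; apply: le_trans h2 _.
  by rewrite ler_wpM2l // lerDl.
- by exists K => // x p x' p'; exact: (h (x, p) (x', p')).
Qed.

Lemma coeff_B_lipschitz eps C : 0 < eps -> exists2 K, 0 <= K & forall x p x' p',
  phase G eps C (x, p) -> phase G eps C (x', p') ->
  `|coeff_B G H x' p' - coeff_B G H x p| <= K * (`|x' - x| + `|p' - p|).
Proof.
move=> e0; have [|i j|K K0 h] := @mx_lipschitz_of_entries R _ (phase G eps C) _ _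
    (fun z => coeff_B G H z.1 z.2) (fun z z' => `|z'.1 - z.1| + `|z'.2 - z.2|).
- by move=> z z'; rewrite addr_ge0.
- have [K1 K10 h1] := Hz_lipschitz C (0, delta_mx i j - delta_mx j i) e0.
  exists K1 => // -[x p] [x' p'] K K'.
  rewrite !mxE; case: ifP => _; last by rewrite oppr0 subrr normr0 mulr_ge0 ?addr_ge0.
  have := h1 _ _ (phaseN K) (phaseN K'); rewrite -!partial_q /= -opprD normrN => {}h1.
  by rewrite -opprD normrN.
- by exists K => // x p x' p'; exact: (h (x, p) (x', p')).
Qed.

End Data.

(** * Convex duality between the Hamiltonian and the Lagrangian *)

Section Interior.
Context {R : realType} {d : nat}.

Lemma simplex_intP (x : 'rV[R]_d) :
  (forall i, 0 < x 0 i) -> \sum_i x 0 i = 1 -> simplex_int x.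
Proof.
move=> px sx; split=> //; split=> // i; rewrite ltW //= -sx (bigD1 i) //= lerDl.
by apply: sumr_ge0 => j _; exact: ltW.
Qed.

Lemma sum_addZ (x v : 'rV[R]_d) (s : R) :
  \sum_i (x + s *: v) 0 i = \sum_i x 0 i + s * \sum_i v 0 i.
Proof. by rewrite mulr_sumr -big_split; apply: eq_bigr => i _; rewrite !mxE. Qed.

Lemma simplex_int_near (x v : 'rV[R]_d) : simplex_int x -> zero_sum v ->
  \forall s \near (0 : R), simplex_int (x + s *: v).
Proof.
move=> [[_ sx] px] zv.
have P i : \forall s \near (0 : R), 0 < (x + s *: v) 0 i.
  have c : (fun s : R => (x + s *: v) 0 i) @ (0 : R) --> x 0 i.
    rewrite (_ : (fun _ => _) = fun s : R => x 0 i + s * v 0 i); last first.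
      by apply: funext => s; rewrite !mxE.
    rewrite -[X in _ --> X]addr0 -[X in _ --> _ + X](mul0r (v 0 i)).
    by apply: cvgD; [exact: cvg_cst|apply: cvgM; [exact: cvg_id|exact: cvg_cst]].
  exact: (cvgr_gt _ c _ (px i)).
near=> s; apply: simplex_intP; last by rewrite sum_addZ sx zv mulr0 addr0.
by near: s; exact: filter_forall.
Unshelve. all: by end_near. Qed.

Lemma simplex_int_conv (x y : 'rV[R]_d) (t : R) : simplex_int x -> simplex y ->
  0 <= t < 1 -> simplex_int (x + t *: (y - x)).
Proof.
move=> [sx px] sy /andP[t0 t1]; apply: simplex_intP => [i|].
  by have /andP[y0 _] := proj1 sy i; have := px i; rewrite !mxE; nra.
by rewrite sum_addZ (zero_sumB sy sx) mulr0 addr0; case: sx.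
Qed.

End Interior.

Section Duality.
Context {R : realType} {d : nat} (G : wgraph R d).
Variables (H : 'rV[R]_d -> 'M[R]_d -> R) (F UT : 'rV[R]_d -> R)
          (L : 'rV[R]_d -> 'M[R]_d -> \bar R).
Hypothesis hP : assumption_P G H F UT.
Hypothesis hL : assumption_L G L.
Hypothesis HL : legendre_dual G H L.
Local Notation S := (skewE G).
Local Notation gR q := (grad_rho (fun r => H r q)).
Local Notation gS x := (grad_skew G (H x)).
Local Notation Lr x w := (fine (L x w)).
Variable g : 'rV[R]_d * 'M[R]_d -> R.
Hypothesis dg : forall x w, simplex_int x -> S w -> differentiable g (x, w).
Hypothesis Lg : forall x w, simplex_int x -> S w -> Lr x w = g (x, w).
Implicit Types (x y eta : 'rV[R]_d) (w v q zeta : 'M[R]_d).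

Lemma L_EFin x w : simplex_int x -> S w -> L x w = (Lr x w)%:E.
Proof. by move=> ix Sw; rewrite fineK // (L_fin hL). Qed.

Lemma fenchel_young x w q : simplex_int x -> S w -> S q ->
  dotE G w q - Lr x w <= H x q.
Proof.
move=> ix Sw Sq; rewrite -lee_fin (HL ix Sq); apply: ereal_sup_ubound.
by exists w => //; rewrite (L_EFin ix Sw).
Qed.

Lemma pair_lineE x eta w zeta (s : R) :
  (x, w) + s *: ((eta, zeta) : 'rV[R]_d * 'M[R]_d) = (x + s *: eta, w + s *: zeta).
Proof. by []. Qed.

Lemma is_derive_L x w eta zeta : simplex_int x -> S w -> zero_sum eta -> S zeta ->
  is_derive (0 : R) (1 : R) (fun s : R => Lr (x + s *: eta) (w + s *: zeta))
    ('D_((eta, zeta) : 'rV[R]_d * 'M[R]_d) g (x, w)).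
Proof.
move=> ix Sw ze Sz.
have := @is_derive_line _ _ _ g (x, w) (eta, zeta) 0.
rewrite scale0r addr0 => /(_ (dg ix Sw)); apply: near_eq_is_derive.
near=> s; rewrite pair_lineE -Lg //; first by near: s; exact: simplex_int_near.
by apply: skewED => //; exact: skewEZ.
Unshelve. all: by end_near. Qed.

(** The comparison point may lie on the boundary of the simplex: only convexity of
   the Lagrangian along the segment is used there. *)
Lemma L_tangent x w y v : simplex_int x -> S w -> simplex y -> S v ->
  (L y v < +oo)%E ->
  'D_((y - x, v - w) : 'rV[R]_d * 'M[R]_d) g (x, w) <= Lr y v - Lr x w.
Proof.
move=> ix Sw sy Sv fin; have sx := proj1 ix.
have D := is_derive_L ix Sw (zero_sumB sy sx) (skewEB Sv Sw).
have := derive_le_chord (b := Lr y v) D; rewrite !scale0r !addr0; apply.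
move=> t /andP[t0 t1].
have ixt : simplex_int (x + t *: (y - x)).
  by apply: simplex_int_conv => //; rewrite t1 ltW.
have Swt : S (w + t *: (v - w)) by apply: skewED => //; apply: skewEZ; exact: skewEB.
have yfin : L y v = (Lr y v)%:E.
  rewrite fineK // fin_numE (L_not_ninfty hL sy Sv) /=.
  by rewrite -ltey.
have := @L_convex _ _ _ _ hL y x v w t sy sx Sv Sw; rewrite t0 t1 => /(_ isT).
have -> : t *: y + (1 - t) *: x = x + t *: (y - x).
  by rewrite scalerBr scalerBl scale1r addrCA.
have -> : t *: v + (1 - t) *: w = w + t *: (v - w).
  by rewrite scalerBr scalerBl scale1r addrCA.
rewrite yfin (L_EFin ix Sw) (L_EFin ixt Swt) -!EFinM -EFinD lee_fin; lra.
Qed.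

Lemma derive_opp x w eta zeta : simplex_int x -> S w ->
  'D_((- eta, - zeta) : 'rV[R]_d * 'M[R]_d) g (x, w) =
  - 'D_((eta, zeta) : 'rV[R]_d * 'M[R]_d) g (x, w).
Proof.
move=> ix Sw; rewrite !deriveE; [|exact: dg|exact: dg].
by rewrite -linearN.
Qed.

(** At a point of equality in the Fenchel-Young inequality the gap function is
   minimal, so the gradients on both sides match. *)
Lemma young_derive x w q eta zeta : simplex_int x -> S w -> S q ->
  H x q = dotE G w q - Lr x w -> zero_sum eta -> S zeta ->
  'D_((eta, zeta) : 'rV[R]_d * 'M[R]_d) g (x, w) =
  dotE G zeta q - dot (gR q x) eta.
Proof.
move=> ix Sw Sq E.
have K eta' zeta' : zero_sum eta' -> S zeta' ->
    0 <= 'D_((eta', zeta') : 'rV[R]_d * 'M[R]_d) g (x, w)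
         + dot (gR q x) eta' - dotE G zeta' q.
  move=> ze Sz.
  pose k s := Lr (x + s *: eta') (w + s *: zeta') + H (x + s *: eta') q
              - (dotE G w q + s * dotE G zeta' q).
  have Dk : is_derive (0 : R) (1 : R) k
      ('D_((eta', zeta') : 'rV[R]_d * 'M[R]_d) g (x, w)
         + dot (gR q x) eta' - dotE G zeta' q).
    have D1 := is_derive_L ix Sw ze Sz.
    have D2 : is_derive (0 : R) (1 : R) (fun s : R => H (x + s *: eta') q)
        (dot (gR q x) eta').
      have := @is_derive_line _ _ _ (fun r => H r q) x eta' 0.
      rewrite scale0r addr0 => /(_ (diff_H_rho hP ix Sq)).
      by rewrite dot_grad_rho //; exact: (diff_H_rho hP).
    rewrite /k; apply: is_derive_eq.
    by rewrite /GRing.scale /=; ring.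
  apply: (derive_ge0_of_min Dk); near=> s.
  have ixs : simplex_int (x + s *: eta') by near: s; exact: simplex_int_near.
  have Sws : S (w + s *: zeta') by apply: skewED => //; exact: skewEZ.
  have := fenchel_young ixs Sws Sq.
  rewrite /k !scale0r !addr0 mul0r addr0 E dotEDl dotEZl; lra.
move=> ze Sz; apply/eqP; rewrite eq_le; apply/andP; split; last first.
  by have := K _ _ ze Sz; lra.
have zN : zero_sum (- eta) by rewrite -scaleN1r; exact: zero_sumZ.
have := K _ _ zN (skewEN Sz).
by rewrite derive_opp // dotNr dotENl; lra.
Unshelve. all: by end_near. Qed.

(** As the slope varies near [q], with density and flux fixed, the Fenchel-Young gap
   is nonnegative and vanishes at [q], so its derivative there is zero. *)
Lemma young_gradH x w q : simplex_int x -> S w -> S q ->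
  H x q = dotE G w q - Lr x w -> gS x q = w.
Proof.
move=> ix Sw Sq E.
have K r : S r -> 0 <= dotE G (gS x q - w) r.
  move=> Sr.
  pose k s := H x (q + s *: r) - (dotE G w q + s * dotE G w r).
  have Dk : is_derive (0 : R) (1 : R) k (dotE G (gS x q - w) r).
    have D : is_derive (0 : R) (1 : R) (fun s : R => H x (q + s *: r))
        (dotE G (gS x q) r).
      have := @is_derive_line _ _ _ (H x) q r 0.
      rewrite scale0r addr0 => /(_ (diff_H_q hP ix Sq)).
      by rewrite dotE_grad_skew //; exact: (diff_H_q hP).
    rewrite /k; apply: is_derive_eq.
    by rewrite dotEBl /GRing.scale /=; ring.
  apply: (derive_ge0_of_min Dk); near=> s.
  have Sqs : S (q + s *: r) by apply: skewED => //; exact: skewEZ.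
  have := fenchel_young ix Sw Sqs.
  rewrite /k !scale0r !addr0 mul0r addr0 E dotEDr dotEZr; lra.
apply/eqP; rewrite -subr_eq0; apply/eqP.
have Sd : S (gS x q - w) by apply: skewEB => //; exact: (skewE_gradH hP).
apply: (dotE_eq0 Sd); apply/eqP; rewrite eq_le K // andbT.
by have := K _ (skewEN Sd); rewrite dotENr oppr_ge0.
Unshelve. all: by end_near. Qed.

(** The supremum defining the Hamiltonian is attained where [q] is the slope of the
   Lagrangian, by convexity. *)
Lemma young_of_slope x w q : simplex_int x -> S w -> S q ->
  (forall zeta, S zeta ->
     'D_((0, zeta) : 'rV[R]_d * 'M[R]_d) g (x, w) = dotE G q zeta) ->
  H x q = dotE G w q - Lr x w.
Proof.
move=> ix Sw Sq h; apply/eqP; rewrite eq_le fenchel_young // andbT.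
rewrite -lee_fin (HL ix Sq); apply: ge_ereal_sup => _ [v Sv <-].
rewrite (L_EFin ix Sv) -EFinB lee_fin.
have fin : (L x v < +oo)%E by rewrite (L_EFin ix Sv) ltry.
have := L_tangent ix Sw (proj1 ix) Sv fin.
rewrite subrr h; last exact: skewEB.
rewrite dotEBr (dotEC _ q v) (dotEC _ q w); lra.
Qed.

(** Superlinear growth makes the supremum a maximum. *)
Lemma young_attained x q : simplex_int x -> S q ->
  exists2 w, S w & H x q = dotE G w q - Lr x w.
Proof.
move=> ix Sq.
(* A flow [v] of size at least [r] costs [M |v|], more than [(v, q)] can return,
   so it does worse than the zero flow once its size exceeds the cost of the latter. *)
pose M := d%:R ^+ 2 * `|q| + 1.
have M0 : 0 < M by rewrite ltr_wpDl ?mulr_ge0.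
have [r [r0 hr]] : exists r : R, 0 < r /\ forall w, S w -> r <= normE G w ->
    M * normE G w <= Lr x w.
  have := L_superlinear hL (@compact_set1 _ x); rewrite sub1set inE => /(_ ix).
  move/cvgeyPge => /(_ M) /= h.
  near (pinfty_nbhs R) => r; exists r; split; first by near: r; exact: nbhs_pinfty_gt.
  have r0 : 0 < r by near: r; exact: nbhs_pinfty_gt.
  move=> w Sw rw; have nw : 0 < normE G w by exact: lt_le_trans rw.
  have : (M%:E <= L x w * ((normE G w)^-1)%:E)%E.
    have : (M%:E <= ereal_inf [set (L z.1 z.2 * ((normE G z.2)^-1)%:E)%E |
       z in [set z | [/\ [set x] z.1, S z.2 & (r <= normE G z.2)%R]]])%E.
      by near: r; exact: h.
    move=> /le_trans; apply; apply: ereal_inf_lbound.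
    by exists (x, w).
  by rewrite (L_EFin ix Sw) -EFinM lee_fin ler_pdivlMr.
pose B := Num.max r `|Lr x 0|.
pose K := S `&` [set w | `|w| <= B].
pose k w := dotE G w q - g (x, w).
have cK : compact K by exact: compact_skew_ball.
have K0 : K 0.
  by split; [exact: skewE0|rewrite /= normr0 le_max (ltW r0)].
have [|w0 Kw0 hw0] := @compact_EVT_max _ _ k K (ex_intro _ 0 K0) cK.
  apply: continuous_in_subspaceT => w; rewrite inE => -[Sw _].
  apply: (@continuousB R R _ (fun w => dotE G w q) (fun w => g (x, w)) w).
    exact: (@dotE_continuous R d G q w).
  apply: (@continuous_comp _ _ _ (fun w => (x, w)) g w).
    by apply/differentiable_continuous; apply: differentiable_pair.
  exact/differentiable_continuous/dg.
rewrite inE in Kw0; have [Sw0 _] := Kw0; exists w0 => //.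
apply/eqP; rewrite eq_le fenchel_young // andbT.
rewrite -lee_fin (HL ix Sq); apply: ge_ereal_sup => _ [v Sv <-].
rewrite (L_EFin ix Sv) -EFinB lee_fin (Lg ix Sw0) -/(k w0).
have [vB|vB] := leP `|v| B; first by rewrite (Lg ix Sv); apply: hw0; rewrite inE.
apply: (@le_trans _ _ (k 0)); last by apply: hw0; rewrite inE.
have vN := norm_le_normE Sv.
move: vB; rewrite /B gt_max => /andP[rv Lv].
have := hr v Sv (le_trans (ltW rv) vN).
have h1 : M * `|v| <= M * normE G v by rewrite ler_wpM2l // ltW.
have h2 := le_trans (ler_norm _) (norm_dotE_le G v q).
have h3 := ler_norm (Lr x 0).
rewrite /k (dotEC _ 0) linear0 -(Lg ix (skewE0 G)).
rewrite /M in h1; move: h1 h2 h3 Lv; rewrite !mulrDl mul1r; lra.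
Unshelve. all: by end_near. Qed.

Lemma young_at_gradH x q : simplex_int x -> S q ->
  H x q = dotE G (gS x q) q - Lr x (gS x q).
Proof.
by move=> ix Sq; have [w Sw E] := young_attained ix Sq; rewrite (young_gradH ix Sw Sq E).
Qed.

End Duality.

(** * First variation of the discrete action *)

Section TimeSteps.
Variable N : nat.

Lemma sum_telescope (V : zmodType) (f : 'I_N.+1 -> V) :
  \sum_(n < N) (f (hi n) - f (lo n)) = f ord_max - f ord0.
Proof.
have E1 : \sum_k f k = f ord0 + \sum_(n < N) f (hi n) by rewrite big_ord_recl.
have E2 : \sum_k f k = \sum_(n < N) f (lo n) + f ord_max by rewrite big_ord_recr.
rewrite sumrB; apply/eqP; rewrite subr_eq addrAC eq_sym subr_eq.
by rewrite [f ord_max + _]addrC -E2 E1 addrC.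
Qed.

Lemma ord_max_hi : (0 < N)%N -> exists n : 'I_N, ord_max = hi n.
Proof.
by case: (unliftP ord0 (ord_max : 'I_N.+1)) => [n|/(congr1 val)/= ->]; first exists n.
Qed.

Lemma ord0P (P : 'I_N.+1 -> Prop) :
  P ord0 -> (forall n : 'I_N, P (hi n)) -> forall k, P k.
Proof. by move=> P0 Ph k; case: (unliftP ord0 k) => [n|] -> //; exact: Ph. Qed.

Lemma ord_maxP (P : 'I_N.+1 -> Prop) :
  P ord_max -> (forall n : 'I_N, P (lo n)) -> forall k, P k.
Proof.
move=> P0 Ph k; case: (unliftP ord_max k) => [n|] -> //.
by rewrite (_ : lift ord_max n = lo n) //; apply: val_inj; rewrite /= /bump leqNgt ltn_ord.
Qed.

Lemma ord_fwd_ind (P : 'I_N.+1 -> Prop) :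
  P ord0 -> (forall n : 'I_N, P (lo n) -> P (hi n)) -> forall k, P k.
Proof.
move=> P0 Ph [k kN]; elim: k kN => [|k IH] kN.
  by rewrite (_ : Ordinal kN = ord0) //; exact: val_inj.
have kN' : (k < N)%N by [].
rewrite (_ : Ordinal kN = hi (Ordinal kN')); last exact: val_inj.
apply: Ph; rewrite (_ : lo _ = Ordinal (ltnW kN)); last exact: val_inj.
exact: IH.
Qed.

Lemma ord_back_ind (P : 'I_N.+1 -> Prop) :
  P ord_max -> (forall n : 'I_N, P (hi n) -> P (lo n)) -> forall k, P k.
Proof.
move=> P0 Ph k; rewrite -(rev_ordK k).
apply: (ord_fwd_ind (P := fun k => P (rev_ord k))).
  by rewrite (_ : rev_ord _ = ord_max) //; apply: val_inj; rewrite /= subn1.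
move=> n h; rewrite (_ : rev_ord (hi n) = lo (rev_ord n)); last first.
  by apply: val_inj; rewrite /= /bump /= add1n subSS.
apply: Ph; rewrite (_ : hi _ = rev_ord (lo n)) //.
by apply: val_inj; rewrite /= /bump /= add1n subSS subnSK // ltn_ord.
Qed.

Lemma unlift_lo (n : 'I_N) : unlift ord_max (lo n) = Some n.
Proof.
rewrite (_ : lo n = lift ord_max n) ?liftK //.
by apply: val_inj; rewrite /= /bump leqNgt ltn_ord.
Qed.

Context {R : realType} {d : nat}.
Implicit Types eta : 'I_N -> 'rV[R]_d.

(** Extension of a density variation by zero to the initial time, where the density is
   prescribed. *)
Definition ext eta (k : 'I_N.+1) : 'rV[R]_d :=
  if unlift ord0 k is Some n then eta n else 0.

Lemma ext_hi eta n : ext eta (hi n) = eta n.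
Proof. by rewrite /ext liftK. Qed.

Lemma ext0 eta : ext eta ord0 = 0.
Proof. by rewrite /ext unlift_none. Qed.

Lemma shift_rhoE rho s eta k : shift_rho rho s eta k = rho k + s *: ext eta k.
Proof. by rewrite /shift_rho /ext; case: unlift => //; rewrite scaler0 addr0. Qed.

Lemma zero_sum_ext eta k : (forall n, zero_sum (eta n)) -> zero_sum (ext eta k).
Proof.
move=> h; rewrite /ext; case: unlift => [n|]; first exact: h.
by apply/zero_sumP; rewrite dot0r.
Qed.

Lemma ext_oppr eta k : ext (fun n => - eta n) k = - ext eta k.
Proof. by rewrite /ext; case: unlift => //; rewrite oppr0. Qed.

End TimeSteps.

Section Variation.
Context {R : realType} {d : nat} (G : wgraph R d).
Variables (H : 'rV[R]_d -> 'M[R]_d -> R) (F UT : 'rV[R]_d -> R)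
          (L : 'rV[R]_d -> 'M[R]_d -> \bar R).
Hypothesis hP : assumption_P G H F UT.
Hypothesis hL : assumption_L G L.
Local Notation S := (skewE G).
Local Notation gR q := (grad_rho (fun r => H r q)).
Local Notation gS x := (grad_skew G (H x)).
Local Notation Lr x w := (fine (L x w)).
Variable g : 'rV[R]_d * 'M[R]_d -> R.
Hypothesis dg : forall x w, simplex_int x -> S w -> differentiable g (x, w).
Hypothesis Lg : forall x w, simplex_int x -> S w -> Lr x w = g (x, w).
Variables (N : nat) (tau : R).
Hypothesis tau0 : 0 < tau.
Implicit Types (rho : 'I_N.+1 -> 'rV[R]_d) (m zeta : 'I_N -> 'M[R]_d)
  (eta phi : 'I_N -> 'rV[R]_d).

(** The argument [w] of the Lagrangian: the flow plus its diffusive part. *)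
Definition total_flux rho m (n : 'I_N) : 'M[R]_d := m n + gradG G (rho (hi n)).

(** The derivative of the action at [(rho, m)]; [g] stands for a differentiable
   extension of the Lagrangian beyond the simplex. *)
Definition d_action rho m eta zeta : R :=
  tau * \sum_(n < N) ('D_((eta n, zeta n + gradG G (eta n)) : 'rV[R]_d * 'M[R]_d)
                        g (rho (hi n), total_flux rho m n)
                      - dot (grad_rho F (rho (hi n))) (eta n))
  + dot (grad_rho UT (rho ord_max)) (ext eta ord_max).

Definition d_lagrangian rho m phi eta zeta : R :=
  d_action rho m eta zeta - tau * \sum_n dot (phi n) (Gam G tau (ext eta) zeta n).

Lemma Gam_shift rho m eta zeta (s : R) n :
  Gam G tau (shift_rho rho s eta) (fun n => m n + s *: zeta n) n =
  Gam G tau rho m n + s *: Gam G tau (ext eta) zeta n.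
Proof.
rewrite /Gam !shift_rhoE.
have -> : divG G (m n + s *: zeta n) = divG G (m n) + s *: divG G (zeta n).
  by rewrite linearD linearZ.
rewrite (scalerDr s) addrACA; congr (_ + _).
by rewrite scalerA [s * _]mulrC -scalerA -scalerDr opprD addrACA -scalerBr.
Qed.

Lemma skewE_drift rho m n : S (m n) -> S (total_flux rho m n).
Proof. by move=> Sm; apply: skewED => //; exact: skewE_gradG. Qed.

Lemma zero_sum_Gam (rho : 'I_N.+1 -> 'rV[R]_d) m n :
  zero_sum (rho (hi n) - rho (lo n)) -> S (m n) -> zero_sum (Gam G tau rho m n).
Proof.
move=> z Sm; apply/zero_sumP; rewrite dotDr dotZr.
by have /zero_sumP -> := z; have /zero_sumP -> := zero_sum_divG Sm; rewrite mulr0 addr0.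
Qed.

Lemma action_fin rho m :
  (forall n, L (rho (hi n)) (total_flux rho m n) = (Lr (rho (hi n)) (total_flux rho m n))%:E) ->
  action G F UT L tau rho m =
  (tau * (\sum_(n < N) (Lr (rho (hi n)) (total_flux rho m n) - F (rho (hi n))))
   + UT (rho ord_max))%:E.
Proof.
move=> h; rewrite /action (eq_bigr (fun n =>
  (Lr (rho (hi n)) (total_flux rho m n) - F (rho (hi n)))%:E)).
  by rewrite sumEFin -EFinM -EFinD.
by move=> n _; rewrite -/(total_flux rho m n) h.
Qed.

Lemma action_int rho m : (forall k, simplex_int (rho k)) -> (forall n, S (m n)) ->
  action G F UT L tau rho m =
  (tau * (\sum_(n < N) (Lr (rho (hi n)) (total_flux rho m n) - F (rho (hi n))))
   + UT (rho ord_max))%:E.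
Proof.
move=> ir Sm; apply: action_fin => n; apply: (L_EFin hL) => //.
exact: skewE_drift.
Qed.

Lemma drift_shift rho m eta zeta (s : R) n :
  total_flux (shift_rho rho s eta) (fun n => m n + s *: zeta n) n =
  total_flux rho m n + s *: (zeta n + gradG G (eta n)).
Proof.
by rewrite /total_flux shift_rhoE ext_hi linearD linearZ /= scalerDr addrACA.
Qed.

Lemma shift_int_near rho eta : (forall k, simplex_int (rho k)) ->
  (forall n, zero_sum (eta n)) ->
  \forall s \near (0 : R), forall k, simplex_int (shift_rho rho s eta k).
Proof.
move=> ir ze.
have h k : \forall s \near (0 : R), simplex_int (shift_rho rho s eta k).
  have := simplex_int_near (ir k) (zero_sum_ext k ze).
  by apply: filterS => s; rewrite shift_rhoE.
exact: filter_forall h.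
Qed.

Lemma is_derive_lagrangian rho m phi eta zeta :
  (forall k, simplex_int (rho k)) -> (forall n, S (m n)) ->
  (forall n, zero_sum (eta n)) -> (forall n, S (zeta n)) ->
  is_derive (0 : R) (1 : R)
    (fun s : R => fine (lagrangian G F UT L tau (shift_rho rho s eta)
                               (fun n => m n + s *: zeta n) phi))
    (d_lagrangian rho m phi eta zeta).
Proof.
move=> ir Sm ze Sz.
pose f s := tau * (\sum_(n < N) (Lr (rho (hi n) + s *: eta n)
      (total_flux rho m n + s *: (zeta n + gradG G (eta n))) - F (rho (hi n) + s *: eta n)))
   + UT (rho ord_max + s *: ext eta ord_max)
   - tau * \sum_n (dot (phi n) (Gam G tau rho m n)
                   + s * dot (phi n) (Gam G tau (ext eta) zeta n)).
apply: (@near_eq_is_derive _ _ _ f).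
  near=> s; rewrite /lagrangian action_int; first last.
  - by move=> n; apply: skewED => //; exact: skewEZ.
  - by near: s; exact: shift_int_near.
  rewrite -EFinB /= /f; congr (tau * _ + _ - tau * _).
  - by apply: eq_bigr => n _; rewrite drift_shift shift_rhoE ext_hi.
  - by rewrite shift_rhoE.
  - by apply: eq_bigr => n _; rewrite Gam_shift dotDr dotZr.
have D1 n : is_derive (0 : R) (1 : R) (fun s : R => Lr (rho (hi n) + s *: eta n)
      (total_flux rho m n + s *: (zeta n + gradG G (eta n))) - F (rho (hi n) + s *: eta n))
   ('D_((eta n, zeta n + gradG G (eta n)) : 'rV[R]_d * 'M[R]_d)
                        g (rho (hi n), total_flux rho m n)
                      - dot (grad_rho F (rho (hi n))) (eta n)).
  apply: is_deriveB.
    apply: (is_derive_L dg Lg) => //; first exact: skewE_drift.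
    by apply: skewED => //; exact: skewE_gradG.
  have dF : differentiable F (rho (hi n)) by apply: (diff_F hP); case: (ir (hi n)).
  rewrite dot_grad_rho //.
  have := @is_derive_line _ _ _ F (rho (hi n)) (eta n) 0.
  by rewrite scale0r addr0; exact.
have D2 : is_derive (0 : R) (1 : R) (fun s : R => UT (rho ord_max + s *: ext eta ord_max))
    (dot (grad_rho UT (rho ord_max)) (ext eta ord_max)).
  have dU : differentiable UT (rho ord_max) by apply: (diff_UT hP); case: (ir ord_max).
  rewrite dot_grad_rho //.
  have := @is_derive_line _ _ _ UT (rho ord_max) (ext eta ord_max) 0.
  by rewrite scale0r addr0; exact.
have D3 n : is_derive (0 : R) (1 : R) (fun s : R => dot (phi n) (Gam G tau rho m n)
     + s * dot (phi n) (Gam G tau (ext eta) zeta n))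
     (dot (phi n) (Gam G tau (ext eta) zeta n)).
  by apply: is_derive_eq; rewrite /GRing.scale /=; ring.
have S1 := is_derive_sum_fun (index_enum _) (P := xpredT) (fun n _ => D1 n).
have S3 := is_derive_sum_fun (index_enum _) (P := xpredT) (fun n _ => D3 n).
rewrite /f /d_lagrangian /d_action; by apply: is_deriveB.
Unshelve. all: by end_near. Qed.

(** Summation by parts in time absorbs the final cost into the terminal value
   of the multiplier, leaving one bracket per time step. *)
Lemma d_lagrangianE rho m phi (Phi : 'I_N.+1 -> 'rV[R]_d) eta zeta :
  Phi ord_max = grad_rho UT (rho ord_max) ->
  (forall n x, zero_sum x -> dot (phi n) x = dot (Phi (lo n)) x) ->
  (forall n, zero_sum (eta n)) -> (forall n, S (zeta n)) ->
  d_lagrangian rho m phi eta zeta =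
  tau * \sum_(n < N) ('D_((eta n, zeta n + gradG G (eta n)) : 'rV[R]_d * 'M[R]_d)
                        g (rho (hi n), total_flux rho m n)
     - dot (grad_rho F (rho (hi n))) (eta n)
     - dot (Phi (lo n)) (divG G (zeta n))
     + dot (tau^-1 *: (Phi (hi n) - Phi (lo n))) (eta n)).
Proof.
move=> PN Plo ze Sz.
rewrite /d_lagrangian /d_action.
have -> : dot (grad_rho UT (rho ord_max)) (ext eta ord_max) =
    \sum_(n < N) (dot (Phi (hi n)) (ext eta (hi n)) - dot (Phi (lo n)) (ext eta (lo n))).
  by rewrite (sum_telescope (fun k => dot (Phi k) (ext eta k))) ext0 dot0r subr0 PN.
have tn0 : tau != 0 by rewrite gt_eqF.
rewrite -[X in _ + X - _](mulVKf tn0) -mulrDr -mulrBr; congr (_ * _).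
rewrite mulr_sumr -big_split -sumrB /=; apply: eq_bigr => n _.
have zE : zero_sum (ext eta (hi n) - ext eta (lo n)).
  by apply: zero_sum_sub; exact: zero_sum_ext.
rewrite Plo; last exact: zero_sum_Gam.
rewrite /Gam ext_hi dotDr !dotZr dotBr dotZl dotBl; ring.
Qed.

(** When the flow is optimal for the slope [- grad Phi], Legendre duality replaces
   the derivatives of the Lagrangian by those of the Hamiltonian.  The terms in
   [zeta] cancel, and what remains in each bracket is the residual of the discrete
   Hamilton-Jacobi equation. *)
Lemma d_lagrangian_young rho m phi (Phi : 'I_N.+1 -> 'rV[R]_d) eta zeta :
  legendre_dual G H L ->
  (forall k, simplex_int (rho k)) -> (forall n, S (m n)) ->
  Phi ord_max = grad_rho UT (rho ord_max) ->
  (forall n x, zero_sum x -> dot (phi n) x = dot (Phi (lo n)) x) ->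
  (forall n, H (rho (hi n)) (- gradG G (Phi (lo n))) =
     dotE G (total_flux rho m n) (- gradG G (Phi (lo n)))
     - Lr (rho (hi n)) (total_flux rho m n)) ->
  (forall n, zero_sum (eta n)) -> (forall n, S (zeta n)) ->
  d_lagrangian rho m phi eta zeta =
  tau * \sum_(n < N) dot (tau^-1 *: (Phi (hi n) - Phi (lo n))
     - gR (- gradG G (Phi (lo n))) (rho (hi n)) - grad_rho F (rho (hi n))
     + lapG G (Phi (lo n))) (eta n).
Proof.
move=> HL ir Sm PN Plo E ze Sz; rewrite (d_lagrangianE _ PN) //; congr (_ * _).
apply: eq_bigr => n _.
have Sq : S (- gradG G (Phi (lo n))) by apply: skewEN; exact: skewE_gradG.
have Szn : S (zeta n + gradG G (eta n)) by apply: skewED => //; exact: skewE_gradG.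
rewrite (young_derive hP hL HL dg Lg (ir (hi n)) (skewE_drift rho (Sm n)) Sq (E n) (ze n) Szn).
rewrite dotENr dotEDl (dotEC _ (zeta n)) -[X in - (X + _)]opprK -dot_divG //.
rewrite -[dotE G (gradG G (eta n)) _]opprK -dot_lapG.
rewrite dotDl !dotBl (dotC (lapG _ _)); ring.
Qed.

End Variation.

(** * Lagrange multipliers and the scheme *)

Section Multipliers.
Context {R : realType} {d : nat} (G : wgraph R d).
Variables (H : 'rV[R]_d -> 'M[R]_d -> R) (F UT : 'rV[R]_d -> R)
          (L : 'rV[R]_d -> 'M[R]_d -> \bar R).
Hypothesis d0 : (0 < d)%N.
Hypothesis HL : legendre_dual G H L.
Hypothesis hP : assumption_P G H F UT.
Hypothesis hL : assumption_L G L.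
Local Notation S := (skewE G).
Local Notation gR q := (grad_rho (fun r => H r q)).
Local Notation gS x := (grad_skew G (H x)).
Local Notation Lr x w := (fine (L x w)).
Variable g : 'rV[R]_d * 'M[R]_d -> R.
Hypothesis dg : forall x w, simplex_int x -> S w -> differentiable g (x, w).
Hypothesis Lg : forall x w, simplex_int x -> S w -> Lr x w = g (x, w).
Variables (N : nat) (tau : R) (rho0 : 'rV[R]_d).
Hypothesis tau0 : 0 < tau.
Implicit Types (rho : 'I_N.+1 -> 'rV[R]_d) (m zeta : 'I_N -> 'M[R]_d)
  (eta phi psi : 'I_N -> 'rV[R]_d).
Local Notation d_act := (d_action G F UT g tau).
Local Notation d_lag := (d_lagrangian G F UT g tau).
Local Notation drift := (total_flux G).

Definition admissible eta zeta :=
  (forall n, zero_sum (eta n)) /\ (forall n, S (zeta n)).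

Lemma KKT_d_lagrangian rho m phi :
  (forall k, simplex_int (rho k)) -> (forall n, S (m n)) ->
  KKT G F UT L tau rho m phi <->
  (forall n, Gam G tau rho m n = 0) /\
  (forall eta zeta, admissible eta zeta -> d_lag rho m phi eta zeta = 0).
Proof.
move=> ir Sm; split=> -[G0 h]; split=> //.
  move=> eta zeta [ze Sz].
  have D := is_derive_lagrangian hP hL dg Lg tau phi ir Sm ze Sz.
  by have D' := h _ _ ze Sz; rewrite -(@derive_val _ _ _ _ _ _ _ D) (@derive_val _ _ _ _ _ _ _ D').
move=> eta zeta ze Sz.
have D := is_derive_lagrangian hP hL dg Lg tau phi ir Sm ze Sz.
by rewrite h in D.
Qed.

Lemma diff_g_w x w : simplex_int x -> S w -> differentiable (fun v => g (x, v)) w.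
Proof.
move=> ix Sw; apply: (@differentiable_comp _ _ _ _ (fun v : 'M[R]_d => (x, v)) g).
  by apply: differentiable_pair.
exact: dg.
Qed.

Lemma derive_flux x w (z : 'M[R]_d) : simplex_int x -> S w -> S z ->
  'D_((0, z) : 'rV[R]_d * 'M[R]_d) g (x, w) =
  dotE G (grad_skew G (fun v => g (x, v)) w) z.
Proof.
move=> ix Sw Sz; rewrite dotE_grad_skew //; last exact: diff_g_w.
by rewrite (@partial_q _ _ (fun x v => g (x, v))) /=;
  congr ('D_ _ _ _); apply: funext => -[].
Qed.

Lemma derive_flux_sub x w (e : 'rV[R]_d) (z z' : 'M[R]_d) : simplex_int x -> S w ->
  'D_((e, z) : 'rV[R]_d * 'M[R]_d) g (x, w)
  - 'D_((e, z') : 'rV[R]_d * 'M[R]_d) g (x, w) =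
  'D_((0, z - z') : 'rV[R]_d * 'M[R]_d) g (x, w).
Proof.
move=> ix Sw; rewrite !deriveE; try exact: dg.
rewrite -linearB; congr ('d _ _ _).
by rewrite -[LHS]/(e - e, z - z') subrr.
Qed.

Lemma Gam_sub (E : 'I_N.+1 -> 'rV[R]_d) zeta zeta' n :
  Gam G tau E zeta n - Gam G tau E zeta' n = divG G (zeta n - zeta' n).
Proof. by rewrite /Gam opprD addrACA subrr add0r linearB. Qed.

(** Circulations in a single time step are feasible variations, so the slope of the
   Lagrangian in the flux is orthogonal to them and is therefore a gradient; its
   potential, centred, is the multiplier up to sign.  An arbitrary variation differs
   from a feasible one by a change of flux only, and on such changes the multiplier
   gives the derivative of the action by its construction. *)
Lemma multipliers_exist rho m :
  (forall k, simplex_int (rho k)) -> (forall n, S (m n)) ->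
  (forall eta zeta, admissible eta zeta ->
     (forall n, Gam G tau (ext eta) zeta n = 0) -> d_act rho m eta zeta = 0) ->
  exists phi, (forall n, zero_sum (phi n)) /\
    forall eta zeta, admissible eta zeta -> d_lag rho m phi eta zeta = 0.
Proof.
move=> ir Sm st.
pose p n := grad_skew G (fun v => g (rho (hi n), v)) (drift rho m n).
have Sdr n : S (drift rho m n) by exact: skewE_drift.
have Sp n : S (p n) by apply: skew_grad_skew; exact: diff_g_w.
have diffE eta zeta zeta' : admissible eta zeta -> admissible eta zeta' ->
    d_act rho m eta zeta - d_act rho m eta zeta' =
    tau * \sum_n dotE G (p n) (zeta n - zeta' n).
  move=> [ze Sz] [_ Sz'].
  have rg1 (a b c : R) : tau * a + c - (tau * b + c) = tau * (a - b) by ring.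
  have rg2 (a b c : R) : a - c - (b - c) = a - b by ring.
  rewrite /d_action rg1; congr (_ * _); rewrite -sumrB; apply: eq_bigr => n _.
  rewrite rg2 derive_flux_sub //.
  have -> : zeta n + gradG G (eta n) - (zeta' n + gradG G (eta n)) = zeta n - zeta' n.
    by rewrite opprD addrACA subrr addr0.
  by rewrite derive_flux //; exact: skewEB.
have pgrad n : exists u, p n = gradG G u.
  apply: gradG_of_orthogonal => // q Sq dq.
  pose zeta k := if k == n then q else 0.
  have Sz k : S (zeta k) by rewrite /zeta; case: ifP => _ //; exact: skewE0.
  have a1 : admissible (fun=> 0) zeta by split=> // k; exact: zero_sum0.
  have a2 : admissible (fun=> 0) (fun=> 0).
    by split=> k; [exact: zero_sum0|exact: skewE0].
  have E0 k : ext (fun _ : 'I_N => 0 : 'rV[R]_d) k = 0 by rewrite /ext; case: unlift.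
  have := diffE _ _ _ a1 a2; rewrite !st //.
  - move=> /esym/eqP; rewrite subrr mulf_eq0 gt_eqF //= (bigD1 n) //= big1.
      by rewrite addr0 /zeta eqxx subr0 => /eqP.
    by move=> k /negbTE kn; rewrite /zeta kn subr0 linear0.
  - by move=> k; rewrite /Gam !E0 subrr scaler0 add0r linear0.
  - move=> k; rewrite /Gam !E0 subrr scaler0 add0r /zeta.
    by case: ifP => _ //; rewrite linear0.
have /choice[u hu] := pgrad.
pose phi n := - (u n - const_mx ((\sum_i u n 0 i) / d%:R)).
have gphi n : gradG G (phi n) = - p n by rewrite linearN linearB /= gradG_const subr0 hu.
have zphi n : zero_sum (phi n).
  by rewrite /phi -scaleN1r; apply: zero_sumZ; exact: zero_sum_center.
exists phi; split=> // eta zeta [ze Sz].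
pose zeta' n := - gradG G (lap_inv G (tau^-1 *: (ext eta (hi n) - ext eta (lo n)))).
have Sz' n : S (zeta' n) by apply: skewEN; exact: skewE_gradG.
have G0 n : Gam G tau (ext eta) zeta' n = 0.
  rewrite /Gam /zeta' linearN /= -/(lapG G _) lap_invK ?subrr //.
  by apply: zero_sumZ; apply: zero_sum_sub; exact: zero_sum_ext.
have := diffE eta zeta zeta' (conj ze Sz) (conj ze Sz').
rewrite (st eta zeta') // subr0 /d_lagrangian => ->; apply/eqP; rewrite subr_eq0.
apply/eqP; congr (_ * _); apply: eq_bigr => n _.
rewrite -[Gam _ _ _ _ _]subr0 -(G0 n) Gam_sub dot_divG; last exact: skewEB.
by rewrite gphi dotENl [RHS]opprK.
Qed.

(** Testing with the gradient of the difference of two multipliers gives the sum of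
   its squared edge norms. *)
Lemma multipliers_unique rho m phi psi :
  (forall k, simplex_int (rho k)) -> (forall n, S (m n)) ->
  (forall n, zero_sum (phi n)) -> (forall n, zero_sum (psi n)) ->
  (forall eta zeta, admissible eta zeta -> d_lag rho m phi eta zeta = 0) ->
  (forall eta zeta, admissible eta zeta -> d_lag rho m psi eta zeta = 0) ->
  phi = psi.
Proof.
move=> ir Sm zphi zpsi h1 h2.
pose zeta n := gradG G (phi n - psi n).
have a : admissible (fun=> 0) zeta.
  by split=> [n|n]; [exact: zero_sum0|exact: skewE_gradG].
have E0 k : ext (fun _ : 'I_N => 0 : 'rV[R]_d) k = 0 by rewrite /ext; case: unlift.
have /eqP := h1 _ _ a; rewrite -(h2 _ _ a) /d_lagrangian.
rewrite (inj_eq (addrI _)) eqr_opp -subr_eq0 -mulrBr mulf_eq0 gt_eqF //= -sumrB.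
rewrite (eq_bigr (fun n => - dotE G (zeta n) (zeta n))) => [|n _]; last first.
  rewrite -dotBl /Gam !E0 subrr scaler0 add0r dot_divG //; exact: skewE_gradG.
rewrite sumrN oppr_eq0 psumr_eq0 => [/allP h|n _]; last exact: dotE_ge0.
apply: funext => n; apply/eqP; rewrite -subr_eq0; apply/eqP.
apply: (@gradG_eq0_zero_sum _ _ G); first exact: zero_sum_sub.
apply: (dotE_eq0 (skewE_gradG _ _)); apply/eqP.
by have := h n (mem_index_enum n).
Qed.

(** Zero at the final time, where the terminal condition leaves no freedom. *)
Definition shift_of a (k : 'I_N.+1) : R := if unlift ord_max k is Some n then a n else 0.

Lemma liftedE rho phi (a : 'I_N -> R) k :
  lifted UT rho phi a k = lifted UT rho phi (fun=> 0) k + const_mx (shift_of a k).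
Proof.
rewrite /lifted /shift_of; case: unlift => [n|]; last by rewrite const_mx0 addr0.
by rewrite const_mx0 addr0.
Qed.

Lemma lifted_lo rho phi a n :
  lifted UT rho phi a (lo n) = phi n + const_mx (a n).
Proof. by rewrite /lifted unlift_lo. Qed.

Lemma lifted_max rho phi a :
  lifted UT rho phi a ord_max = grad_rho UT (rho ord_max).
Proof. by rewrite /lifted unlift_none. Qed.

Lemma orthogonal_zero_sum_const (b : 'rV[R]_d) :
  (forall e, zero_sum e -> dot b e = 0) -> exists c, b = const_mx c.
Proof.
move=> h; pose c := (\sum_i b 0 i) / d%:R; exists c; apply/eqP.
have z := zero_sum_center b d0; rewrite -subr_eq0; apply/eqP/dot_eq0.
by rewrite dotBl h // dot_const z mulr0 subrr.
Qed.

Definition hj_residual rho (Phi : 'I_N.+1 -> 'rV[R]_d) n : 'rV[R]_d :=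
  tau^-1 *: (Phi (hi n) - Phi (lo n))
  - gR (- gradG G (Phi (lo n))) (rho (hi n)) - grad_rho F (rho (hi n))
  + lapG G (Phi (lo n)).

Lemma hj_residual0 rho Phi n : hj_residual rho Phi n = 0 <->
  tau^-1 *: (Phi (hi n) - Phi (lo n)) =
  gR (- gradG G (Phi (lo n))) (rho (hi n)) + grad_rho F (rho (hi n))
  - lapG G (Phi (lo n)).
Proof.
have -> : hj_residual rho Phi n = tau^-1 *: (Phi (hi n) - Phi (lo n)) -
    (gR (- gradG G (Phi (lo n))) (rho (hi n)) + grad_rho F (rho (hi n))
     - lapG G (Phi (lo n))) by rewrite !opprD opprK !addrA.
by split=> [/subr0_eq|->]; rewrite ?subrr.
Qed.

(** Flux variations identify the slope of the Lagrangian with [- grad phi], so that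
   duality yields the continuity equation.  Density variations have zero sum, so the
   Hamilton-Jacobi residual is a constant vector at each time step.  Shifting the
   multiplier by constants changes no gradient, and the shifts that remove these
   constants solve a recursion started at the final time. *)
Lemma scheme_of_multipliers rho m phi :
  (forall k, simplex_int (rho k)) -> (forall n, S (m n)) ->
  rho ord0 = rho0 -> (forall n, Gam G tau rho m n = 0) ->
  (forall eta zeta, admissible eta zeta -> d_lag rho m phi eta zeta = 0) ->
  exists! a : 'I_N -> R, scheme G H F UT tau rho0 (lifted UT rho phi a) rho.
Proof.
move=> ir Sm r0 G0 st.
have Sdr n : S (drift rho m n) by exact: skewE_drift.
pose Phi := lifted UT rho phi (fun=> 0).
have gPhi a n : gradG G (lifted UT rho phi a (lo n)) = gradG G (phi n).
  by rewrite lifted_lo linearD /= gradG_const addr0.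
have dPhi n x : zero_sum x -> dot (phi n) x = dot (Phi (lo n)) x.
  by move=> zx; rewrite /Phi lifted_lo const_mx0 addr0.
have PN : Phi ord_max = grad_rho UT (rho ord_max) by exact: lifted_max.
have Sq n : S (- gradG G (Phi (lo n))) by apply: skewEN; exact: skewE_gradG.
have slope n z : S z -> 'D_((0, z) : 'rV[R]_d * 'M[R]_d) g
    (rho (hi n), drift rho m n) = dotE G (- gradG G (Phi (lo n))) z.
  move=> Sz; pose zeta k := if k == n then z else 0.
  have Szk k : S (zeta k) by rewrite /zeta; case: ifP => _ //; exact: skewE0.
  have ze (k : 'I_N) : zero_sum (0 : 'rV[R]_d) by exact: zero_sum0.
  have := st (fun=> 0) zeta (conj ze Szk).
  rewrite (d_lagrangianE _ _ tau0 _ PN) // => /eqP; rewrite mulf_eq0 gt_eqF //=.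
  rewrite (bigD1 n) //= big1 => [|k /negbTE kn].
    rewrite /zeta eqxx linear0 addr0 dot_divG // !dot0r subr0 !addr0 opprK dotENl.
    by rewrite addr_eq0 => /eqP.
  rewrite /zeta kn [gradG G 0]linear0 [divG G 0]linear0 addr0 !dot0r !subr0 addr0.
  by rewrite deriveE ?linear0 //; exact: dg.
have young n : H (rho (hi n)) (- gradG G (Phi (lo n))) =
     dotE G (drift rho m n) (- gradG G (Phi (lo n)))
     - Lr (rho (hi n)) (drift rho m n).
  by apply: (young_of_slope hL HL dg Lg) => // z Sz; exact: slope.
have driftE n : gS (rho (hi n)) (- gradG G (Phi (lo n))) = drift rho m n.
  exact: (young_gradH hP hL HL).
have orth n e : zero_sum e -> dot (hj_residual rho Phi n) e = 0.
  move=> ze; pose eta k := if k == n then e else 0.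
  have zek k : zero_sum (eta k) by rewrite /eta; case: ifP => _ //; exact: zero_sum0.
  have Szk (k : 'I_N) : S 0 by exact: skewE0.
  have := st eta (fun=> 0) (conj zek Szk).
  rewrite (d_lagrangian_young hP hL dg Lg _ HL ir Sm PN dPhi) // => /eqP.
  rewrite mulf_eq0 gt_eqF //= (bigD1 n) //= big1 => [|k /negbTE kn].
    by rewrite addr0 /eta eqxx => /eqP.
  by rewrite /eta kn dot0r.
have /choice[c hc] n := orthogonal_zero_sum_const (orth n).
have resE a n : hj_residual rho (lifted UT rho phi a) n =
    const_mx (tau^-1 * (shift_of a (hi n) - shift_of a (lo n)) + c n).
  rewrite /hj_residual gPhi !(liftedE rho phi a) -/Phi.
  have := hc n; rewrite /hj_residual gPhi.
  rewrite [lapG G (_ + _)]linearD /= lapG_const addr0.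
  set A := gR _ _; set B := grad_rho F _; set D := lapG _ _ => E.
  have -> : Phi (hi n) + const_mx (shift_of a (hi n)) - (Phi (lo n) + const_mx (shift_of a (lo n)))
    = (Phi (hi n) - Phi (lo n)) + const_mx (shift_of a (hi n) - shift_of a (lo n)).
    by apply/rowP => i; rewrite !mxE; ring.
  apply/rowP => i; move/rowP/(_ i): E; rewrite !mxE => <-; ring.
have scheme_iff a : scheme G H F UT tau rho0 (lifted UT rho phi a) rho <->
    forall n, tau^-1 * (shift_of a (hi n) - shift_of a (lo n)) + c n = 0.
  split=> [[_ _ h _] n|h].
    have /hj_residual0 := h n; rewrite resE => /rowP E.
    by have := E (Ordinal d0); rewrite !mxE.
  split=> //; first exact: lifted_max.
    by move=> n; apply/hj_residual0; rewrite resE h const_mx0.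
  move=> n; rewrite gPhi -(gPhi (fun=> 0)) driftE.
  have := G0 n; rewrite /Gam => /eqP; rewrite addr_eq0 => /eqP ->.
  by rewrite /total_flux linearD /= -/(lapG G _) opprD addrNK.
(* The solution of the recursion, accumulated backward from the final time. *)
pose ahat (k : 'I_N.+1) := tau * \sum_(n < N | (k <= n)%N) c n.
exists (fun n => ahat (lo n)); split.
  apply/scheme_iff => n.
  have cE k : shift_of (fun n => ahat (lo n)) k = ahat k.
    elim/ord_maxP: k => [|k]; last by rewrite /shift_of unlift_lo.
    rewrite /shift_of unlift_none /ahat big_pred0 ?mulr0 // => j.
    by rewrite leqNgt ltn_ord.
  rewrite !cE /ahat -mulrBr mulKf ?gt_eqF // [X in _ - X](bigD1 n) //=.
  rewrite (eq_bigl (fun i : 'I_N => (n <= i)%N && (i != n))) => [|i]; last first.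
    by rewrite /= /bump /= add1n ltn_neqAle eq_sym andbC.
  by rewrite opprD addrCA subrr addr0 addNr.
move=> a /scheme_iff ha; apply: funext => n.
suff cE k : shift_of a k = ahat k by rewrite -cE /shift_of unlift_lo.
elim/ord_back_ind: k => [|k IH].
  rewrite /shift_of unlift_none /ahat big_pred0 ?mulr0 // => j.
  by rewrite leqNgt ltn_ord.
have /eqP := ha k; rewrite IH addr_eq0 => /eqP E.
have {}E : shift_of a (lo k) = ahat (hi k) + tau * c k.
  apply: (mulfI (x := tau^-1)); first by rewrite invr_eq0 gt_eqF.
  rewrite mulrDr [tau^-1 * (tau * c k)]mulKf ?gt_eqF //; move: E; rewrite mulrBr; lra.
rewrite E /ahat -mulrDr [in RHS](bigD1 k) //= addrC; congr (tau * (_ + _)).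
by apply: eq_bigl => i; rewrite /= /bump /= add1n ltn_neqAle eq_sym andbC.
Qed.

End Multipliers.

(** * Lower semicontinuous functions on compact sets *)

Section LowerSemicontinuity.
Context {R : realType} {X : topologicalType}.
Implicit Types (K : set X) (J : X -> \bar R).
Local Open Scope ereal_scope.

Lemma ereal_between (x y : \bar R) : x < y -> exists a : R, x < a%:E /\ a%:E < y.
Proof.
case: x y => [r||] [s||] //; rewrite ?ltxx //.
- rewrite lte_fin => rs; exists ((r + s) / 2)%R; rewrite !lte_fin.
  by rewrite midf_lt // midf_lt.
- by move=> _; exists (r + 1)%R; rewrite lte_fin ltrDl ltr01 ltry.
- by move=> _; exists (s - 1)%R; rewrite lte_fin gtrBl ltr01 ltNyr.
- by move=> _; exists 0%R; rewrite ltNyr ltry.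
Qed.

Definition lsc_at K J (x : X) := forall a : R, a%:E < J x ->
  \forall y \near x, K y -> a%:E < J y.

(** The sublevel sets above the infimum form a filter base on the compact set; lower
   semicontinuity makes any cluster point a minimizer. *)
Lemma lsc_attains_min K J : compact K -> K !=set0 ->
  (forall x, K x -> lsc_at K J x) ->
  exists2 x, K x & forall y, K y -> J x <= J y.
Proof.
move=> cK [x0 Kx0] lJ; set m := ereal_inf (J @` K).
have hm y : K y -> m <= J y by move=> Ky; apply: ereal_inf_lbound; exists y.
have [/eqP mE|mlt] := boolP (m == +oo).
  by exists x0 => // y /hm; rewrite mE leye_eq => /eqP ->; rewrite leey.
pose B c := K `&` [set x | J x < c].
pose FF := filter_from [set c | m < c] B.
have FFF : ProperFilter FF.
  apply: filter_from_proper; last first.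
    by move=> c /= /ereal_inf_lt[_ [x Kx <-] xc]; exists x.
  apply: filter_from_filter; first by exists +oo; rewrite /= ltey.
  move=> c c' /= mc mc'; exists (Order.min c c'); first by rewrite lt_min mc.
  by move=> x [Kx] /=; rewrite lt_min => /andP[h h']; split.
have FK : FF K by exists +oo; [rewrite /= ltey|move=> x []].
have [x [Kx cx]] := cK FF FFF FK; exists x => // y Ky.
apply: le_trans (hm y Ky); rewrite leNgt; apply/negP => /ereal_between[a [ma aJ]].
have Ba : FF (B a%:E) by exists a%:E.
have [z [[Kz za] /(_ Kz) az]] := cx _ _ Ba (lJ x Kx a aJ).
by have := lt_trans za az; rewrite ltxx.
Qed.

Lemma lsc_at_continuous K (f : X -> R) x : {for x, continuous f} ->
  lsc_at K (fun y => (f y)%:E) x.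
Proof.
move=> cf a; rewrite lte_fin => af.
have : \forall y \near x, (a < f y)%R by exact: (cvgr_gt _ cf _ af).
by apply: filterS => y ay _; rewrite lte_fin.
Qed.

Lemma lsc_atD K J1 J2 x : lsc_at K J1 x -> lsc_at K J2 x ->
  J1 x != -oo -> J2 x != -oo -> lsc_at K (fun y => J1 y + J2 y) x.
Proof.
move=> l1 l2 n1 n2 a aJ.
have [a1 [a2 [h1 h2 h]]] : exists a1 a2 : R,
    [/\ a1%:E < J1 x, a2%:E < J2 x & a = (a1 + a2)%R].
  case: (J1 x) (J2 x) n1 n2 aJ => [r||] [s||] // _ _.
  - rewrite -EFinD lte_fin => ars; exists (r - (r + s - a) / 2)%R, (s - (r + s - a) / 2)%R.
    by rewrite !lte_fin; split; lra.
  - by move=> _; exists (r - 1)%R, (a - r + 1)%R; rewrite lte_fin ltry; split=> //; lra.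
  - by move=> _; exists (a - s + 1)%R, (s - 1)%R; rewrite lte_fin ltry; split=> //; lra.
  - by move=> _; exists a, 0%R; rewrite !ltry addr0.
have := l1 _ h1; have := l2 _ h2; apply: filterS2 => y g2 g1 Ky.
by rewrite h EFinD lteD ?g1 ?g2.
Qed.

Lemma lsc_at_sum K (I : Type) (r : seq I) (J : I -> X -> \bar R) x :
  (forall i, lsc_at K (J i) x) -> (forall i, J i x != -oo) ->
  lsc_at K (fun y => \sum_(i <- r) J i y) x.
Proof.
move=> lJ nJ; elim: r => [|i r IH].
  by move=> a h; apply: nearW => y _; rewrite big_nil; rewrite big_nil in h.
have E y : \sum_(i <- i :: r) J i y = J i y + \sum_(i <- r) J i y by rewrite big_cons.
move=> a; rewrite E => /(lsc_atD (lJ i) IH (nJ i)) h.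
have : \sum_(i <- r) J i x != -oo.
  by elim/big_ind: _ => // u v; case: u => [?||]; case: v => [?||].
by move=> /h; apply: filterS => y; rewrite E.
Qed.

Lemma lsc_at_scale K J x (t : R) : (0 < t)%R -> lsc_at K J x ->
  lsc_at K (fun y => t%:E * J y) x.
Proof.
move=> t0 lJ a; rewrite -lte_pdivrMl // => /lJ.
by apply: filterS => y h /h; rewrite EFinM lte_pdivrMl.
Qed.

End LowerSemicontinuity.

(** * Existence, uniqueness and positivity of minimizers *)

Section Minimization.
Context {R : realType} {d : nat} (G : wgraph R d).
Variables (H : 'rV[R]_d -> 'M[R]_d -> R) (F UT : 'rV[R]_d -> R)
          (L : 'rV[R]_d -> 'M[R]_d -> \bar R).
Hypothesis d0 : (0 < d)%N.
Hypothesis hP : assumption_P G H F UT.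
Hypothesis hL : assumption_L G L.
Local Notation S := (skewE G).
Local Notation Lr x w := (fine (L x w)).
Variables (N : nat) (tau : R) (rho0 : 'rV[R]_d).
Hypothesis tau0 : 0 < tau.
Hypothesis N0 : (0 < N)%N.
Hypothesis irho0 : simplex_int rho0.
Implicit Types (rho : 'I_N.+1 -> 'rV[R]_d) (m zeta : 'I_N -> 'M[R]_d).
Local Notation drift := (total_flux G).
Local Notation action := (action G F UT L tau).
Local Notation feasible := (feasible G tau rho0).

Lemma L_fin_num x w : simplex x -> S w -> (L x w < +oo)%E -> L x w = (Lr x w)%:E.
Proof.
move=> sx Sw fin; rewrite fineK // fin_numE (L_not_ninfty hL sx Sw) /=.
by rewrite -ltey.
Qed.

Lemma action_pinfty rho m n : feasible rho m ->
  L (rho (hi n)) (drift rho m n) = +oo%E -> action rho m = +oo%E.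
Proof.
move=> [sr Sm _ _] Ln; rewrite /Defs.action.
have -> : (\sum_(n < N) (L (rho (hi n)) (m n + gradG G (rho (hi n)))%R
    - (F (rho (hi n)))%:E) = +oo)%E.
  apply/esum_eqyP; first by move=> k _; rewrite adde_eq_ninfty negb_or
    (L_not_ninfty hL (sr _) (skewE_drift _ (Sm k))).
  by exists n; split; rewrite ?mem_index_enum // -/(drift rho m n) Ln.
by rewrite gt0_muley ?lte_fin.
Qed.

(** Where the new density vanishes, the total flux on the adjacent edges vanishes as
   well, so the continuity equation only lets mass diffuse into the vertex: the old
   density could not have been positive there. *)
Lemma feasible_interior rho m : feasible rho m ->
  (forall n, (L (rho (hi n)) (drift rho m n) < +oo)%E) ->
  forall k, simplex_int (rho k).
Proof.
move=> [sr Sm r0 G0] fin; apply: ord_fwd_ind; first by rewrite r0.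
move=> n [_ pl]; split=> // i; rewrite lt_neqAle.
have /andP[-> _] := proj1 (sr (hi n)) i; rewrite andbT eq_sym.
apply/eqP => ri.
have w0 j : edge G i j -> drift rho m n i j = 0.
  by apply: (L_boundary hL (sr (hi n)) (skewE_drift _ (Sm n)) (fin n) ri).
have /rowP/(_ i) := G0 n; rewrite !mxE ri add0r => E.
have E2 : \sum_(j | edge G i j) Num.sqrt (weight G i j) * m n i j =
    \sum_(j | edge G i j) weight G i j * rho (hi n) 0 j.
  apply: eq_bigr => j e; have := w0 j e; rewrite /total_flux !mxE ri add0r mulrN.
  move=> /eqP; rewrite subr_eq0 => /eqP ->.
  by rewrite mulrA -expr2 sqr_sqrtr // ltW // weight_pos.
have h1 : 0 <= \sum_(j | edge G i j) weight G i j * rho (hi n) 0 j.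
  apply: sumr_ge0 => j e; rewrite mulr_ge0 ?(ltW (weight_pos e)) //.
  by have /andP[] := proj1 (sr (hi n)) j.
have h2 : 0 < tau^-1 * rho (lo n) 0 i by rewrite mulr_gt0 ?invr_gt0.
by move: E; rewrite E2 mulrN; lra.
Qed.

Lemma feasible_cases rho m : feasible rho m ->
  action rho m = +oo%E \/ forall n, (L (rho (hi n)) (drift rho m n) < +oo)%E.
Proof.
move=> fe; have [h|/existsNP[n]] := pselect (forall n, (L (rho (hi n)) (drift rho m n) < +oo)%E).
  by right.
by move/negP; rewrite -leNgt leye_eq => /eqP h; left; exact: action_pinfty fe h.
Qed.

Lemma stationary_feasible : feasible (fun _ : 'I_N.+1 => rho0) (fun=> 0).
Proof.
split=> //; first by move=> n; case: irho0.
by move=> n; rewrite /Gam subrr scaler0 add0r linear0.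
Qed.

Lemma minimizer_interior rho m : minimizer G F UT L tau rho0 rho m ->
  forall k, simplex_int (rho k).
Proof.
move=> [fe mi]; have [inf|h] := feasible_cases fe; last exact: feasible_interior fe h.
have := mi _ _ stationary_feasible; rewrite inf leye_eq.
rewrite (action_int F UT hL) //; by move=> n; exact: skewE0.
Qed.

Lemma Gam_mid rho rho' m m' n : Gam G tau rho m n = 0 -> Gam G tau rho' m' n = 0 ->
  Gam G tau (fun k => 2^-1 *: rho k + (1 - 2^-1) *: rho' k)
            (fun k => 2^-1 *: m k + (1 - 2^-1) *: m' k) n = 0.
Proof.
move=> h h'; transitivity (2^-1 *: Gam G tau rho m n + (1 - 2^-1) *: Gam G tau rho' m' n).
  rewrite /Gam !linearD !linearZ /=.
  by apply/rowP => i; rewrite !mxE; ring.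
by rewrite h h' !scaler0 addr0.
Qed.

Lemma UT_convex_half x y : simplex x -> simplex y ->
  UT (2^-1 *: x + (1 - 2^-1) *: y) <= 2^-1 * UT x + (1 - 2^-1) * UT y.
Proof.
move=> sx sy.
have t0 : 0 <= 2^-1 :> R by rewrite invr_ge0.
have t1 : 2^-1 <= 1 :> R by rewrite invf_le1 // ler1n.
exact: (P_UT_convex hP (Itv01 t0 t1) (mem_set sx) (mem_set sy)).
Qed.

(** At the midpoint of two minimizers every convexity inequality must be an equality;
   strict concavity of [F] then identifies the densities, and strict convexity of
   the Lagrangian in the flux identifies the fluxes. *)
Lemma minimizer_unique rho m rho' m' :
  minimizer G F UT L tau rho0 rho m -> minimizer G F UT L tau rho0 rho' m' ->
  rho = rho' /\ m = m'.
Proof.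
move=> mi mi'; have ir := minimizer_interior mi; have ir' := minimizer_interior mi'.
case: mi mi' => [[sr Sm r0 G0] mi] [[sr' Sm' r0' G0'] mi'].
have h01 : 0 < (2^-1 : R) < 1 by rewrite invr_gt0 ltr0n invf_lt1 // ltr1n.
pose rm k := 2^-1 *: rho k + (1 - 2^-1) *: rho' k.
pose mm k := 2^-1 *: m k + (1 - 2^-1) *: m' k.
have irm k : simplex_int (rm k).
  rewrite /rm; have -> : 2^-1 *: rho k + (1 - 2^-1) *: rho' k
      = rho k + 2^-1 *: (rho' k - rho k).
    by apply/rowP => i; rewrite !mxE; field.
  apply: simplex_int_conv => //; move: h01 => /andP[/ltW -> ->] //.
have Smm n : S (mm n) by apply: skewED; exact: skewEZ.
have fe : feasible rm mm.
  split=> //; first by move=> k; case: (irm k).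
    by rewrite /rm r0 r0' -scalerDl addrC subrK scale1r.
  by move=> n; exact: Gam_mid.
have dE n : drift rm mm n = 2^-1 *: drift rho m n + (1 - 2^-1) *: drift rho' m' n.
  by rewrite /total_flux /rm /mm linearD !linearZ /= !scalerDr addrACA.
have a1 := mi _ _ fe; have a2 := mi' _ _ fe; move: a1 a2.
rewrite !(action_int F UT hL) // !lee_fin => a1 a2.
have hU := UT_convex_half (sr ord_max) (sr' ord_max).
pose l n := Lr (rho (hi n)) (drift rho m n) - F (rho (hi n)).
pose l' n := Lr (rho' (hi n)) (drift rho' m' n) - F (rho' (hi n)).
pose lm n := Lr (rm (hi n)) (drift rm mm n) - F (rm (hi n)).
have Sd n : S (drift rho m n) by exact: skewE_drift.
have Sd' n : S (drift rho' m' n) by exact: skewE_drift.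
have Sdm n : S (drift rm mm n) by exact: skewE_drift.
have hLc n : Lr (rm (hi n)) (drift rm mm n) <=
    2^-1 * Lr (rho (hi n)) (drift rho m n) + (1 - 2^-1) * Lr (rho' (hi n)) (drift rho' m' n).
  have := L_convex hL (sr (hi n)) (sr' (hi n)) (Sd n) (Sd' n) h01.
  rewrite -dE -/(rm (hi n)) (L_EFin hL (irm _) (Sdm n)) (L_EFin hL (ir _) (Sd n))
    (L_EFin hL (ir' _) (Sd' n)) -!EFinM -EFinD lee_fin.
  exact.
have hFs n : rho (hi n) != rho' (hi n) ->
    2^-1 * F (rho (hi n)) + (1 - 2^-1) * F (rho' (hi n)) < F (rm (hi n)).
  move=> ne; have := P_F_concave hP (sr (hi n)) (sr' (hi n)) ne h01.
  by rewrite !fctE -/(rm (hi n)); lra.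
have hF n : 2^-1 * F (rho (hi n)) + (1 - 2^-1) * F (rho' (hi n)) <= F (rm (hi n)).
  have [E|/hFs/ltW //] := eqVneq (rho (hi n)) (rho' (hi n)).
  have -> : rm (hi n) = rho (hi n) by rewrite /rm -E -scalerDl addrC subrK scale1r.
  rewrite -E; lra.
have gap n : 0 <= 2^-1 * l n + (1 - 2^-1) * l' n - lm n.
  by have := hLc n; have := hF n; rewrite /l /l' /lm; lra.
have gap0 : \sum_n (2^-1 * l n + (1 - 2^-1) * l' n - lm n) = 0.
  apply/eqP; rewrite eq_le; apply/andP; split; last by apply: sumr_ge0.
  rewrite sumrB big_split /= -!mulr_sumr subr_le0.
  rewrite -(ler_pM2l tau0) mulrDr.
  move: a1 a2 hU; rewrite -/(rm ord_max) /l /l' /lm; lra.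
have each n : 2^-1 * l n + (1 - 2^-1) * l' n = lm n.
  apply/eqP; rewrite -subr_eq0; apply/eqP; move: gap0 => /eqP.
  by rewrite psumr_eq0 // => /allP/(_ n (mem_index_enum _))/eqP.
have Er n : rho (hi n) = rho' (hi n).
  apply/eqP/negPn/negP => /hFs; have := each n; have := hLc n.
  by rewrite /l /l' /lm; lra.
have Ed n : drift rho m n = drift rho' m' n.
  apply/eqP/negPn/negP => ne.
  have f1 : (L (rho (hi n)) (drift rho m n) < +oo)%E by rewrite (L_EFin hL) // ltry.
  have f2 : (L (rho (hi n)) (drift rho' m' n) < +oo)%E by rewrite (L_EFin hL) // ltry.
  have := L_strict hL (sr (hi n)) (Sd n) (Sd' n) ne h01 f1 f2.
  have Em : rm (hi n) = rho (hi n).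
    by rewrite /rm -Er -scalerDl addrC subrK scale1r.
  rewrite -dE -Em (L_EFin hL (irm _) (Sdm n)) (L_EFin hL (irm _) (Sd n))
    (L_EFin hL (irm _) (Sd' n)) -!EFinM -EFinD lte_fin Em.
  have := each n; rewrite /l /l' /lm Em -Er; lra.
split; apply: funext.
  by apply: ord0P => [|n]; rewrite ?r0 ?r0' ?Er.
by move=> n; have := Ed n; rewrite /total_flux Er => /addIr.
Qed.

Lemma lsc_L (K : set ('rV[R]_d * 'M[R]_d)) z : K `<=` simplex `*` S -> K z ->
  lsc_at K (fun z => L z.1 z.2) z.
Proof.
move=> KA Kz a /(L_lsc hL)[V]; rewrite /nbhs /= -nbhs_subspace_in; last exact: KA.
move=> nV hV; move: nV; rewrite /within /=; apply: filterS => y h /KA/h.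
exact: hV.
Qed.

(** Where the Lagrangian is nonpositive the flux stays in a ball, and a lower
   semicontinuous function is bounded below on the compact product. *)
Lemma L_bounded_below : exists2 b : R, b <= 0 & forall x w, simplex x -> S w ->
  (b%:E <= L x w)%E.
Proof.
have [r0 r0p hr] := L_sublevel hL 0.
pose K : set ('rV[R]_d * 'M[R]_d) := simplex `*` (S `&` [set w | `|w| <= r0]).
have cK : compact K.
  by apply: compact_setX; [exact: compact_simplex|exact: compact_skew_ball].
have K0 : K (rho0, 0).
  by split; [case: irho0|split; [exact: skewE0|rewrite /= normr0 ltW]].
have lsc x : K x -> lsc_at K (fun z => L z.1 z.2) x.
  by move=> Kx; apply: lsc_L => // -[y v] [sy [Sv _]].
have [[x w] [/= sx [Sw _]] hmin] := lsc_attains_min cK (ex_intro _ _ K0) lsc.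
pose b := Num.min 0 (Lr x w).
have hb y v : simplex y -> S v -> (L y v <= 0)%E -> (b%:E <= L y v)%E.
  move=> sy Sv Ly; have Kyv : K (y, v).
    by split=> //; split=> //; exact: le_trans (norm_le_normE Sv) (hr _ _ sy Sv Ly).
  have h := hmin _ Kyv; have fin : (L x w < +oo)%E.
    by apply: le_lt_trans h (le_lt_trans Ly _); exact: ltry.
  by apply: le_trans h; rewrite (L_fin_num sx Sw fin) lee_fin ge_min lexx orbT.
exists b; first by rewrite ge_min lexx.
move=> y v sy Sv; have [/(hb _ _ sy Sv)//|/ltW h] := leP (L y v) 0%E.
by apply: le_trans h; rewrite lee_fin ge_min lexx.
Qed.

(** Competitors are parametrised by the density and the total flux after each step,
   in the order in which the Lagrangian takes them, so that the action is a sum of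
   functions of one coordinate of a product space. *)
Local Notation step := ('rV[R]_d * 'M[R]_d)%type.
Local Notation path_space := (prod_topology (fun _ : 'I_N => step)).
Definition rho_of (y : 'I_N -> step) (k : 'I_N.+1) : 'rV[R]_d :=
  if unlift ord0 k is Some n then (y n).1 else rho0.
Definition m_of (y : 'I_N -> step) (n : 'I_N) : 'M[R]_d := (y n).2 - gradG G (y n).1.

Lemma rho_of_hi y n : rho_of y (hi n) = (y n).1.
Proof. by rewrite /rho_of liftK. Qed.

Lemma drift_of y n : drift (rho_of y) (m_of y) n = (y n).2.
Proof. by rewrite /total_flux /m_of rho_of_hi subrK. Qed.

Lemma step_continuous n : continuous (fun y : path_space => y n).
Proof. exact: (@proj_continuous _ (fun _ : 'I_N => step) n). Qed.

Lemma rho_entry_continuous k i : continuous (fun y : path_space => rho_of y k 0 i).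
Proof.
rewrite /rho_of; case: unlift => [n|]; last by move=> y; exact: cst_continuous.
move=> y; apply: (@continuous_comp _ _ _ (fun y : path_space => y n)
  (fun z : step => z.1 0 i)); first exact: step_continuous.
exact: (@pair_coord_cont R d (inl i)).
Qed.

Lemma drift_entry_continuous n i j : continuous (fun y : path_space => (y n).2 i j).
Proof.
move=> y; apply: (@continuous_comp _ _ _ (fun y : path_space => y n)
  (fun z : step => z.2 i j)); first exact: step_continuous.
exact: (@pair_coord_cont R d (inr (i, j))).
Qed.

Lemma Gam_entry_continuous n i :
  continuous (fun y : path_space => Gam G tau (rho_of y) (m_of y) n 0 i).
Proof.
have E (y : path_space) : Gam G tau (rho_of y) (m_of y) n 0 i =
    tau^-1 * (rho_of y (hi n) 0 i - rho_of y (lo n) 0 i) -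
    \sum_(j | edge G i j) Num.sqrt (weight G i j) * ((y n).2 i j
      - Num.sqrt (weight G i j) * (rho_of y (hi n) 0 i - rho_of y (hi n) 0 j)).
  rewrite !mxE; congr (_ - _); apply: eq_bigr => j _.
  by rewrite /m_of !mxE rho_of_hi.
rewrite (funext E) => y.
have cr k a := @rho_entry_continuous k a y.
have cd a b := @drift_entry_continuous n a b y.
apply: (@continuousB R R path_space).
  apply: (@continuousM R path_space (fun=> _)); first exact: cst_continuous.
  by apply: (@continuousB R R path_space); exact: cr.
move: y {cr cd}; apply: cont_sum_fun => j _ y.
apply: (@continuousM R path_space (fun=> _)); first exact: cst_continuous.
apply: (@continuousB R R path_space); first exact: drift_entry_continuous.
apply: (@continuousM R path_space (fun=> _)); first exact: cst_continuous.
by apply: (@continuousB R R path_space); exact: rho_entry_continuous.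
Qed.

Definition feasible_paths (B : R) : set path_space :=
  [set y | forall n, (simplex `*` (S `&` [set w | `|w| <= B])) (y n)]
  `&` [set y | forall n, [set y | forall i,
        [set y | Gam G tau (rho_of y) (m_of y) n 0 i = 0] y] y].

Lemma compact_feasible_paths B : @compact path_space (feasible_paths B).
Proof.
have cS : compact (S `&` [set w | `|w| <= B]) by exact: compact_skew_ball.
have cK1 : @compact path_space
    [set y | forall n, (simplex `*` (S `&` [set w | `|w| <= B])) (y n)].
  apply: (@tychonoff 'I_N (fun=> step) (fun=> simplex `*` (S `&` [set w | `|w| <= B]))).
  by move=> n; exact: (compact_setX (@compact_simplex R d) cS).
apply: compact_closedI => //.
apply: closed_forall => n; apply: closed_forall => i.
exact/closed_eq_fun/Gam_entry_continuous.
Qed.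

Lemma F_continuous x : simplex x -> {for x, continuous F}.
Proof. by move=> sx; exact/differentiable_continuous/(diff_F hP). Qed.

Lemma UT_continuous x : simplex x -> {for x, continuous UT}.
Proof. by move=> sx; exact/differentiable_continuous/(diff_UT hP). Qed.

Lemma lsc_action B y : feasible_paths B y ->
  lsc_at (feasible_paths B) (fun y => action (rho_of y) (m_of y)) y.
Proof.
move=> Ky; have [nmax Emax] := ord_max_hi N0.
have stepK n z : feasible_paths B z -> (simplex `*` S) (z n) by case=> /(_ n)[? []].
have JE z : action (rho_of z) (m_of z) =
    (tau%:E * (\sum_n (L (z n).1 (z n).2 + (- F (z n).1)%:E))
     + (UT (z nmax).1)%:E)%E.
  rewrite /Defs.action Emax rho_of_hi; congr (_ * _ + _)%E; apply: eq_bigr => n _.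
  by rewrite -/(drift _ _ _) drift_of rho_of_hi.
have cfst n (f : 'rV[R]_d -> R) : {for (y n).1, continuous f} ->
    {for y, continuous (fun z : path_space => f (z n).1)}.
  move=> cf.
  have c1 : {for y, continuous (fun z : path_space => (z n).1)}.
    apply: (@continuous_comp path_space step 'rV[R]_d (fun z => z n) fst y).
      exact: step_continuous.
    exact: cvg_fst.
  exact: (@continuous_comp path_space 'rV[R]_d R (fun z => (z n).1) f y c1 cf).
have sy n : simplex (y n).1 by case: (stepK n y Ky).
have lL n : lsc_at (feasible_paths B) (fun z : path_space => L (z n).1 (z n).2) y.
  move=> a aL; have near_step := lsc_L (fun _ => id) (stepK n y Ky) aL.
  have near_path := @step_continuous n y _ near_step.
  apply: (@filterS _ (nbhs (y : path_space)) (nbhs_filter _) _ _ _ near_path).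
  by move=> z h Kz; apply: h; exact: stepK.
have lF n : lsc_at (feasible_paths B) (fun z : path_space => (- F (z n).1)%:E) y.
  apply: lsc_at_continuous; apply: (cfst n (fun x => - F x)).
  by apply: (@continuousN R R _ F); exact: F_continuous.
have nL n : L (y n).1 (y n).2 != -oo%E.
  by apply: (L_not_ninfty hL) => //; case: (stepK n y Ky).
rewrite (funext JE); apply: lsc_atD => //.
- apply: lsc_at_scale => //; apply: lsc_at_sum => n.
    by apply: lsc_atD.
  by case: (L _ _) (nL n).
- by apply: lsc_at_continuous; apply: cfst; exact: UT_continuous.
- have : (\sum_n (L (y n).1 (y n).2 + (- F (y n).1)%:E) != -oo)%E.
    elim/big_ind: _ => // [u v|n _]; first by case: u => [?||]; case: v => [?||].
    by case: (L _ _) (nL n).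
  by case: (\sum_n _)%E => [r||] // _; rewrite gt0_muley ?lte_fin.
Qed.

(** The other terms of the action being bounded below, a bound on the action bounds
   each Lagrangian term and hence each flux: the competitors no worse than the
   constant path form a compact set. *)
Lemma minimizer_exists : exists rho m, minimizer G F UT L tau rho0 rho m.
Proof.
have [b b0 hb] := L_bounded_below.
have [MF MF0 hMF] := compact_continuous_bounded (@compact_simplex R d) F_continuous.
have [MU MU0 hMU] := compact_continuous_bounded (@compact_simplex R d) UT_continuous.
pose A0 := fine (action (fun _ : 'I_N.+1 => rho0) (fun=> 0)).
have EA0 : action (fun _ : 'I_N.+1 => rho0) (fun=> 0) = A0%:E.
  by rewrite /A0 (action_int F UT hL).
(* An upper bound for each single Lagrangian term of such a competitor. *)
pose c := tau^-1 * (A0 + MU) + N%:R * (MF - b) + MF.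
have [B B0 hB] := L_sublevel hL c.
have bound rho m : feasible rho m -> (action rho m <= A0%:E)%E ->
    forall n, normE G (drift rho m n) <= B.
  move=> fe le n; have [inf|fin] := feasible_cases fe.
    by move: le; rewrite inf leye_eq.
  have [sr Sm _ _] := fe.
  have Lf k : L (rho (hi k)) (drift rho m k) = (Lr (rho (hi k)) (drift rho m k))%:E.
    by apply: L_fin_num => //; exact: skewE_drift.
  apply: (hB (rho (hi n))) => //; first exact: skewE_drift.
  rewrite Lf lee_fin; move: le; rewrite (action_fin F UT tau Lf) lee_fin => le.
  have hlow k : b - MF <= Lr (rho (hi k)) (drift rho m k) - F (rho (hi k)).
    have := hb _ _ (sr (hi k)) (skewE_drift rho (Sm k)); rewrite Lf lee_fin => h.
    by have := hMF _ (sr (hi k)); rewrite ler_norml => /andP[_ h2]; lra.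
  have hn : Lr (rho (hi n)) (drift rho m n) - F (rho (hi n)) <=
     \sum_k (Lr (rho (hi k)) (drift rho m k) - F (rho (hi k))) + N%:R * (MF - b).
    rewrite -[N in N%:R]card_ord -sum1_card natr_sum mulr_suml -big_split /=.
    rewrite (bigD1 n) //= mul1r -addrA lerDl addr_ge0 ?sumr_ge0 //.
      by have := b0; lra.
    by move=> k _; have := hlow k; lra.
  have := hMF _ (sr (hi n)); rewrite ler_norml => /andP[h1 h2].
  have := hMU _ (sr ord_max); rewrite ler_norml => /andP[h3 h4].
  have : \sum_k (Lr (rho (hi k)) (drift rho m k) - F (rho (hi k))) <= tau^-1 * (A0 + MU).
    by rewrite ler_pdivlMl //; lra.
  by rewrite /c; lra.
pose K : set path_space := feasible_paths B.
have cK : compact K by exact: compact_feasible_paths.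
have fK y : K y -> feasible (rho_of y) (m_of y).
  move=> [h1 h2]; split.
  - by apply: ord0P => [|n]; [rewrite /rho_of unlift_none; case: irho0
                             |rewrite rho_of_hi; case: (h1 n)].
  - move=> n; apply: skewEB; last exact: skewE_gradG.
    by case: (h1 n) => _ [].
  - by rewrite /rho_of unlift_none.
  - by move=> n; apply/rowP => i; rewrite [RHS]mxE; exact: h2.
have Kf rho m : feasible rho m -> (action rho m <= A0%:E)%E ->
    exists y, [/\ K y, rho = rho_of y & m = m_of y].
  move=> fe le; exists (fun n => (rho (hi n), drift rho m n)).
  have Er : rho = rho_of (fun n => (rho (hi n), drift rho m n)).
    apply: funext; apply: ord0P => [|n]; last by rewrite rho_of_hi.
    by rewrite /rho_of unlift_none; case: fe.
  have Em : m = m_of (fun n => (rho (hi n), drift rho m n)).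
    by apply: funext => n; rewrite /m_of /= /total_flux addrK.
  split=> //; split.
    move=> n; have [sr Sm _ _] := fe; split=> //=; split; first exact: skewE_drift.
    exact: le_trans (norm_le_normE (skewE_drift rho (Sm n))) (bound _ _ fe le n).
  by move=> n i /=; rewrite -Er -Em; case: fe => _ _ _ ->; rewrite mxE.
have lscJ y : K y -> lsc_at K (fun y => action (rho_of y) (m_of y)) y.
  exact: lsc_action.
have [|y0 [Ky0 _ _]] := Kf _ _ stationary_feasible; first by rewrite EA0.
have [y Ky hmin] := lsc_attains_min cK (ex_intro _ _ Ky0) lscJ.
exists (rho_of y), (m_of y); split; first exact: fK.
move=> rho m fe; have [le|/ltW lt] := leP (action rho m) A0%:E.
  by have [z [Kz -> ->]] := Kf _ _ fe le; exact: hmin.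
apply: le_trans lt; have [|z [Kz Er Em]] := Kf _ _ stationary_feasible; first by rewrite EA0.
by rewrite -EA0 Er Em; exact: hmin.
Qed.

End Minimization.

(** * Optimality conditions *)

Section Converse.
Context {R : realType} {d : nat} (G : wgraph R d).
Variables (H : 'rV[R]_d -> 'M[R]_d -> R) (F UT : 'rV[R]_d -> R)
          (L : 'rV[R]_d -> 'M[R]_d -> \bar R).
Hypothesis d0 : (0 < d)%N.
Hypothesis HL : legendre_dual G H L.
Hypothesis hP : assumption_P G H F UT.
Hypothesis hL : assumption_L G L.
Local Notation S := (skewE G).
Local Notation gR q := (grad_rho (fun r => H r q)).
Local Notation gS x := (grad_skew G (H x)).
Local Notation Lr x w := (fine (L x w)).
Variable g : 'rV[R]_d * 'M[R]_d -> R.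
Hypothesis dg : forall x w, simplex_int x -> S w -> differentiable g (x, w).
Hypothesis Lg : forall x w, simplex_int x -> S w -> Lr x w = g (x, w).
Variables (N : nat) (tau : R) (rho0 : 'rV[R]_d).
Hypothesis tau0 : 0 < tau.
Hypothesis N0 : (0 < N)%N.
Hypothesis irho0 : simplex_int rho0.
Implicit Types (rho Phi : 'I_N.+1 -> 'rV[R]_d) (m zeta : 'I_N -> 'M[R]_d).
Local Notation drift := (total_flux G).
Local Notation action := (action G F UT L tau).
Local Notation feasible := (feasible G tau rho0).
Local Notation minimizer := (minimizer G F UT L tau rho0).

(** Convexity turns stationarity of the action along feasible variations into
   global minimality. *)
Lemma stationary_minimizer rho m phi :
  (forall k, simplex_int (rho k)) -> feasible rho m ->
  (forall eta zeta, admissible G eta zeta ->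
     d_lagrangian G F UT g tau rho m phi eta zeta = 0) ->
  minimizer rho m.
Proof.
move=> ir fe st; split=> // rho' m' fe'.
have [->|fin] := feasible_cases F UT hL tau0 fe'; first by rewrite leey.
have [sr Sm r0 G0] := fe; have [sr' Sm' r0' G0'] := fe'.
have Sd n : S (drift rho m n) by exact: skewE_drift.
have Sd' n : S (drift rho' m' n) by exact: skewE_drift.
have Lf' n := L_fin_num hL (sr' (hi n)) (Sd' n) (fin n).
rewrite (action_int F UT hL) // (action_fin F UT tau Lf') lee_fin.
pose eta n := rho' (hi n) - rho (hi n).
pose zeta n := m' n - m n.
have ze n : zero_sum (eta n) by exact: zero_sumB.
have Sz n : S (zeta n) by exact: skewEB.
have EE k : ext eta k = rho' k - rho k.
  by move: k; apply: ord0P => [|n]; rewrite ?ext0 ?ext_hi // r0 r0' subrr.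
have GE n : Gam G tau (ext eta) zeta n = 0.
  transitivity (Gam G tau rho' m' n - Gam G tau rho m n); last by rewrite G0 G0' subrr.
  have dz : divG G (zeta n) = divG G (m' n) - divG G (m n) by exact: linearB.
  rewrite /Gam !EE dz; move: (divG G (m' n)) (divG G (m n)) => a b.
  by apply/rowP => i; rewrite !mxE; ring.
have := st _ _ (conj ze Sz); rewrite /d_lagrangian.
rewrite big1 => [|n _]; last by rewrite GE dot0r.
rewrite mulr0 subr0 /d_action EE => st0.
have hU := UT_tangent hP (sr ord_max) (sr' ord_max).
have hn n : 'D_((eta n, zeta n + gradG G (eta n)) : 'rV[R]_d * 'M[R]_d)
     g (rho (hi n), drift rho m n) - dot (grad_rho F (rho (hi n))) (eta n)
    <= (Lr (rho' (hi n)) (drift rho' m' n) - F (rho' (hi n)))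
       - (Lr (rho (hi n)) (drift rho m n) - F (rho (hi n))).
  have := L_tangent hL dg Lg (ir (hi n)) (Sd n) (sr' (hi n)) (Sd' n) (fin n).
  have -> : drift rho' m' n - drift rho m n = zeta n + gradG G (eta n).
    by rewrite /total_flux /zeta /eta linearB opprD addrACA.
  by have := F_tangent hP (sr (hi n)) (sr' (hi n)); rewrite /eta; lra.
have /(ler_wpM2l (ltW tau0)) := ler_sum (index_enum _) (fun n (_ : true) => hn n).
by rewrite [in leRHS]sumrB [leRHS]mulrBr; lra.
Qed.

(** Along the scheme the flux is optimal for the slope [- grad Phi], so the derivative
   of the Lagrangian is a sum of Hamilton-Jacobi residuals, all zero. *)
Lemma scheme_minimizer Phi rho : interior_solution G H F UT tau rho0 Phi rho ->
  minimizer rho (flux G H Phi rho).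
Proof.
move=> [[r0 PN hj ce] ir]; pose m := flux G H Phi rho.
have Sq n : S (- gradG G (Phi (lo n))) by apply: skewEN; exact: skewE_gradG.
have Sw n : S (gS (rho (hi n)) (- gradG G (Phi (lo n)))) by exact: (skewE_gradH hP).
have Sm n : S (m n) by apply: skewEB => //; exact: skewE_gradG.
have dE n : drift rho m n = gS (rho (hi n)) (- gradG G (Phi (lo n))).
  by rewrite /total_flux /m /flux subrK.
have G0 n : Gam G tau rho m n = 0.
  rewrite /Gam ce /m /flux linearB /= -/(lapG G _).
  by rewrite addrACA addNr add0r subrr.
have fe : feasible rho m by split=> // k; case: (ir k).
apply: (@stationary_minimizer rho m (fun n => Phi (lo n)) ir fe) => eta zeta [ze Sz].
rewrite (d_lagrangian_young hP hL dg Lg tau0 HL ir Sm PN) //.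
  rewrite big1 ?mulr0 // => n _.
  have /hj_residual0 := hj n; rewrite /hj_residual => ->.
  by rewrite dotC dot0r.
by move=> n; rewrite dE; exact: (young_at_gradH hP hL HL dg Lg).
Qed.

(** Because the minimizer is interior, small multiples of a feasible variation and of
   its opposite are both admissible. *)
Lemma minimizer_stationary rho m eta zeta : minimizer rho m ->
  admissible G eta zeta -> (forall n, Gam G tau (ext eta) zeta n = 0) ->
  d_action G F UT g tau rho m eta zeta = 0.
Proof.
move=> mi; have ir := minimizer_interior hL tau0 irho0 mi.
have [[sr Sm r0 G0] mi'] := mi.
have K e z : admissible G e z -> (forall n, Gam G tau (ext e) z n = 0) ->
    0 <= d_action G F UT g tau rho m e z.
  move=> [ze Sz] Ge.
  have D := is_derive_lagrangian hP hL dg Lg tau (fun=> 0) ir Sm ze Sz.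
  have := derive_ge0_of_min D; rewrite /d_lagrangian big1 => [|n _]; last first.
    by rewrite dotC dot0r.
  rewrite mulr0 subr0; apply; near=> s.
  have irs : forall k, simplex_int (shift_rho rho s e k).
    by near: s; exact: shift_int_near.
  have Sms (t : R) n : S (m n + t *: z n) by apply: skewED => //; exact: skewEZ.
  have z0 (k : 'I_N) x : dot (0 : 'rV[R]_d) x = 0 by rewrite dotC dot0r.
  have lagE (t : R) : (forall k, simplex_int (shift_rho rho t e k)) ->
      lagrangian G F UT L tau (shift_rho rho t e) (fun n => m n + t *: z n) (fun=> 0)
      = action (shift_rho rho t e) (fun n => m n + t *: z n).
    move=> irt; rewrite /lagrangian big1 => [|n _]; last exact: z0.
    by rewrite mulr0 sube0.
  have ir0 k : simplex_int (shift_rho rho 0 e k) by rewrite shift_rhoE scale0r addr0.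
  have E0 : shift_rho rho 0 e = rho.
    by apply: funext => k; rewrite shift_rhoE scale0r addr0.
  have Em0 : (fun n => m n + 0 *: z n) = m.
    by apply: funext => n; rewrite scale0r addr0.
  rewrite !lagE // E0 Em0 fine_le //.
  - by rewrite (action_int F UT hL).
  - by rewrite (action_int F UT hL).
  apply: mi'; split=> //.
  - by move=> k; case: (irs k).
  - by rewrite shift_rhoE ext0 scaler0 addr0.
  - by move=> n; rewrite Gam_shift G0 Ge scaler0 addr0.
move=> [ze Sz] Ge; apply/eqP; rewrite eq_le K // andbT -oppr_ge0.
have zN n : zero_sum (- eta n) by rewrite -scaleN1r; exact: zero_sumZ.
have GN n : Gam G tau (ext (fun n => - eta n)) (fun n => - zeta n) n = 0.
  transitivity (- Gam G tau (ext eta) zeta n); last by rewrite Ge oppr0.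
  have dN : divG G (- zeta n) = - divG G (zeta n) by exact: linearN.
  rewrite /Gam !ext_oppr dN; move: (divG G (zeta n)) => a.
  by apply/rowP => i; rewrite !mxE; ring.
have := K _ _ (conj zN (fun n => skewEN (Sz n))) GN.
suff -> : d_action G F UT g tau rho m (fun n => - eta n) (fun n => - zeta n) =
    - d_action G F UT g tau rho m eta zeta by [].
rewrite /d_action ext_oppr dotNr opprD -mulrN; congr (tau * _ + _).
rewrite -sumrN; apply: eq_bigr => n _.
have -> : - zeta n + gradG G (- eta n) = - (zeta n + gradG G (eta n)).
  by rewrite linearN opprD.
rewrite dotNr (derive_opp dg) ?opprB ?opprK; [by rewrite addrC|exact: ir|].
exact: skewE_drift.
Unshelve. all: by end_near. Qed.

End Converse.

(** * Uniform a priori bounds *)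

Section Apriori.
Context {R : realType} {d : nat} (G : wgraph R d).
Variables (Hb : 'rV[R]_d -> 'M[R]_d -> 'rV[R]_d)
          (B : 'rV[R]_d -> 'M[R]_d -> 'M[R]_d) (g : 'rV[R]_d -> 'rV[R]_d).
Local Notation S := (skewE G).
Hypothesis d0 : (0 < d)%N.
Hypothesis hA : assumption_A G Hb B g.
Hypothesis SB : forall x p, simplex_int x -> S p -> S (B x p).

(** The residuals [r] and [s] allow the same bounds to serve the discrete solution
   and the exact solution sampled on the grid. *)
Record perturbed_scheme N (tau : R) (Phi rho : 'I_N.+1 -> 'rV[R]_d)
    (r s : 'I_N -> 'rV[R]_d) : Prop := {
  ps_int : forall k, simplex_int (rho k);
  ps_final : Phi ord_max = g (rho ord_max);
  ps_phi : forall n : 'I_N, Phi (hi n) - Phi (lo n) =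
    tau *: (Hb (rho (hi n)) (gradG G (Phi (lo n))) - lapG G (Phi (lo n)) + r n);
  ps_rho : forall n : 'I_N, rho (hi n) - rho (lo n) =
    tau *: (divG G (B (rho (hi n)) (gradG G (Phi (lo n)))) + lapG G (rho (hi n)) + s n) }.

Section Mobility.
Variable a : R -> 'M[R]_d -> R.
Hypothesis ha : mobility_bound G B a.
Local Notation ball_S C := (S `&` [set q | `|q| <= C]).

(** The mobility conditions are local in [p]; compactness of bounded flows makes them
   uniform.  The same applies to the next two lemmas. *)
Lemma mobility_infty (C e : R) : 0 < e -> exists U : R, 0 < U /\
  forall u p, U < u -> ball_S C p -> a u p <= e.
Proof.
move=> e0; have := @compact_skew_ball R d G C => /compact_near_coveringP.
move=> /(_ _ (+oo%R : set_system R) (fun u p => S p -> a u p <= e) _) /=.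
case.
  move=> p [Sp _]; have [V nV hV] := mob_at_infty ha Sp.
  exists (V, [set u | forall p', V p' -> S p' -> a u p' < e]).
    by split => //; exact: hV.
  by move=> [p' u] [/= Vp' h] Sp'; exact/ltW/h.
move=> U [Ur hU]; exists (Num.max U 1); split; first by rewrite lt_max ltr01 orbT.
move=> u p; rewrite gt_max => /andP[Uu _] [Sp pC].
by apply: (hU u Uu p _ Sp).
Qed.

Lemma mobility_zero (C : R) : exists u0 : R, 0 < u0 /\
  forall u p, 0 < u < u0 -> ball_S C p -> a u p <= 1.
Proof.
have := @compact_skew_ball R d G C => /compact_near_coveringP.
move=> /(_ _ (0^'+ : set_system R) (fun u p => S p -> a u p <= 1) _) /=.
case.
  move=> p [Sp _]; have [V nV hV] := mob_at_0 ha Sp.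
  exists (V, [set u | forall p', V p' -> S p' -> a u p' < 1]).
    by split => //; exact: hV.
  by move=> [p' u] [/= Vp' h] Sp'; exact/ltW/h.
move=> u0 /= u0p hu; exists u0; split=> // u p /andP[u1 u2] [Sp pC].
apply: (hu u _ u1 p) => //.
by rewrite /ball /= sub0r normrN gtr0_norm.
Qed.

Lemma mobility_middle (C u0 U : R) : 0 < u0 -> exists2 M : R, 0 <= M &
  forall u p, u0 <= u <= U -> ball_S C p -> a u p <= M.
Proof.
move=> u0p.
have cK := compact_setX (@segment_compact R u0 U) (@compact_skew_ball R d G C).
move/compact_near_coveringP: cK.
move=> /(_ _ (+oo%R : set_system R)
  (fun M z => 0 < z.1 -> S z.2 -> a z.1 z.2 <= M) _) /=.
case.
  move=> [u p] [/= uI [Sp _]].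
  have up : 0 < u by move: uI; rewrite in_itv /= => /andP[/(lt_le_trans u0p)].
  have [M hM] := mob_locally_bounded ha up Sp.
  exists ([set z | 0 < z.1 -> S z.2 -> a z.1 z.2 <= M], [set M' | M < M']).
    by split=> //=; apply: nbhs_pinfty_gt; rewrite num_real.
  by move=> [z M'] [/= h /ltW MM'] z1 z2; exact: le_trans (h z1 z2) MM'.
move=> M [Mr hM]; exists (Num.max (M + 1) 0); first by rewrite le_max lexx orbT.
move=> u p uI [Sp pC]; apply: (@le_trans _ _ (M + 1)); last by rewrite le_max lexx.
have up : 0 < u by move: uI => /andP[/(lt_le_trans u0p)].
by apply: (hM (M + 1) _ (u, p)) => //; rewrite ltrDl.
Qed.

(** Convection along an edge is at most the sum of the two densities times the
   mobility factor.  If the neighbour is not much denser, this sum is comparable to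
   the density at [i] and the factor is bounded.  If it is much denser, the factor
   is so small that diffusion brings in more than convection can remove. *)
Lemma edge_inflow (C : R) i j : edge G i j -> exists2 k : R, 0 <= k &
  forall x p, simplex_int x -> S p -> `|p| <= C ->
  - k * x 0 i <= - (Num.sqrt (weight G i j) * B x p i j)
                 + weight G i j * (x 0 j - x 0 i).
Proof.
move=> e; set s := Num.sqrt (weight G i j).
have s0 : 0 < s by rewrite sqrtr_gt0 weight_pos.
have ws : weight G i j = s * s by rewrite -expr2 sqr_sqrtr ?ltW ?weight_pos.
(* Beyond the ratio [U] the factor is at most [s / 2], so convection takes at most
   half of the diffusive inflow [s * s * x 0 j], plus a multiple of [x 0 i]. *)
have [U [U0 hU]] := mobility_infty C (divr_gt0 s0 (ltr0n R 2)).
have [u0 [u0p hu]] := mobility_zero C.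
have [M M0 hM] := mobility_middle C U u0p.
pose M1 := Num.max 1 M.
have M1p : 0 <= M1 by rewrite le_max ler01.
exists (s * (1 + U) * M1 + 2 * (s * s)).
  have h1 := ltW s0; have h2 := ltW U0.
  by rewrite addr_ge0 ?mulr_ge0 ?addr_ge0.
move=> x p ix Sp pC; have [_ px] := ix.
have xi := px i; have xj := px j; rewrite ws.
pose u := x 0 j / x 0 i.
have up : 0 < u by rewrite divr_gt0.
have xjE : x 0 j = u * x 0 i by rewrite /u divfK // gt_eqF.
have a0 := mob_ge0 ha up Sp.
have hB : s * B x p i j <= s * ((x 0 i + x 0 j) * a u p).
  rewrite ler_pM2l //; apply: le_trans (ler_norm _) _.
  exact: (mob_bound ha).
suff : - (s * (1 + U) * M1 + 2 * (s * s)) * x 0 i <=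
  - (s * ((x 0 i + x 0 j) * a u p)) + s * s * (x 0 j - x 0 i) by lra.
have ss : 0 < s * s by rewrite mulr_gt0.
have bp : ball_S C p by [].
have [uU|uU] := ltP U u.
  have au := hU u p uU bp.
  have h1 : s * ((x 0 i + x 0 j) * a u p) <= s * ((x 0 i + x 0 j) * (s / 2)).
    by rewrite ler_pM2l // ler_wpM2l // addr_ge0 ?ltW.
  have h2 : 0 <= s * (1 + U) * M1 * x 0 i.
    have s0' := ltW s0; have U0' := ltW U0; have xi' := ltW xi.
    by rewrite !mulr_ge0 ?addr_ge0.
  have h3 := mulr_gt0 ss xi; have h4 := mulr_gt0 ss xj.
  by move: h1; rewrite !mulrDl !mulrDr !mulrN; lra.
have au : a u p <= M1.
  have [uu|uu] := ltP u u0; first by rewrite le_max hu // up.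
  by rewrite le_max (hM u p) ?orbT // uu.
have h1 : s * ((x 0 i + x 0 j) * a u p) <= s * (((1 + U) * x 0 i) * M1).
  rewrite ler_pM2l // ler_pM // ?addr_ge0 ?(ltW xi) ?(ltW xj) //.
  by rewrite xjE mulrDl mul1r lerD2l ler_wpM2r // ltW.
have h4 := mulr_gt0 ss xj; have h3 := mulr_gt0 ss xi.
by move: h1; rewrite !mulrDl !mulrDr !mulrN; lra.
Qed.

Lemma inflow_bound (C : R) : exists2 k : R, 0 <= k &
  forall x p i, simplex_int x -> S p -> `|p| <= C ->
  - k * x 0 i <= (divG G (B x p) + lapG G x) 0 i.
Proof.
have /choice[k hk] (ij : 'I_d * 'I_d) : exists k : R, 0 <= k /\
    (edge G ij.1 ij.2 -> forall x p, simplex_int x -> S p -> `|p| <= C ->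
  - k * x 0 ij.1 <= - (Num.sqrt (weight G ij.1 ij.2) * B x p ij.1 ij.2)
                 + weight G ij.1 ij.2 * (x 0 ij.2 - x 0 ij.1)).
  case: ij => i j /=; have [e|e] := boolP (edge G i j); last by exists 0.
  by have [k k0 h] := edge_inflow C e; exists k.
have K0 : 0 <= \sum_ij k ij by apply: sumr_ge0 => ij _; case: (hk ij).
exists (\sum_ij k ij) => // x p i ix Sp pC; have [_ px] := ix.
have -> : (divG G (B x p) + lapG G x) 0 i = \sum_(j | edge G i j)
    (- (Num.sqrt (weight G i j) * B x p i j) + weight G i j * (x 0 j - x 0 i)).
  by rewrite [LHS]mxE lapG_entry [divG G _ 0 i]mxE -sumrN -big_split.
apply: (@le_trans _ _ (\sum_(j | edge G i j) - k (i, j) * x 0 i)); last first.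
  by apply: ler_sum => j e; apply: (proj2 (hk (i, j))).
rewrite -mulr_suml ler_wpM2r ?(ltW (px i)) // sumrN lerN2.
have -> : \sum_ij k ij = \sum_i \sum_j k (i, j).
  by rewrite pair_bigA /=; apply: eq_bigr => -[].
rewrite big_mkcond /= [leRHS](bigD1 i) //=.
rewrite -[leLHS]addr0 lerD //; last first.
  by apply: sumr_ge0 => a' _; apply: sumr_ge0 => b' _; case: (hk (a', b')).
by apply: ler_sum => j _; case: ifP => // _; case: (hk (i, j)).
Qed.

End Mobility.
Section Bounds.
Variables (N : nat) (tau T : R) (Phi rho : 'I_N.+1 -> 'rV[R]_d)
  (r s : 'I_N -> 'rV[R]_d).
Variables (C0 CH Cg : R).
Hypothesis tau0 : 0 < tau.
Hypothesis tauN : tau * N%:R = T.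
Hypothesis ps : perturbed_scheme tau Phi rho r s.
Hypothesis r1 : forall n i, `|r n 0 i| <= 1.
Hypothesis s1 : forall n, dot (Phi (lo n)) (s n) <= 1.
Hypotheses (C00 : 0 <= C0) (CH0 : 0 <= CH) (Cg0 : 0 <= Cg).
Hypothesis hC0 : forall x p, simplex_int x -> S p ->
  dot (Hb x p) x - C0 <= dotE G (B x p) p.
Hypothesis hCH : forall x p i, simplex_int x -> S p -> - CH <= Hb x p 0 i.
Hypothesis hCg : forall x, simplex x -> norm_inf (g x) <= Cg.

(** An upper barrier for the value function; the summand 1 pays for the residual. *)
Definition ceiling (k : 'I_N.+1) : R := Cg + (CH + 1) * (tau * (N - k)%:R).

Lemma ceiling_step (n : 'I_N) : ceiling (lo n) = ceiling (hi n) + tau * (CH + 1).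
Proof.
rewrite /ceiling /= /bump /= add1n -[(N - n)%N](@subnSK n N) ?ltn_ord //.
by rewrite -addn1 natrD; ring.
Qed.

Lemma ceiling_le k : ceiling k <= Cg + (CH + 1) * T.
Proof.
rewrite lerD2l -tauN ler_wpM2l ?addr_ge0 // ler_wpM2l ?(ltW tau0) //.
by rewrite ler_nat leq_subr.
Qed.

Lemma Phi_step n i : Phi (lo n) 0 i = Phi (hi n) 0 i
  - tau * (Hb (rho (hi n)) (gradG G (Phi (lo n))) 0 i - lapG G (Phi (lo n)) 0 i + r n 0 i).
Proof.
have /rowP/(_ i) := ps_phi ps n; move: (lapG _ _) => l; rewrite !mxE.
by move=> <-; ring.
Qed.

Lemma Hb_r_ge n i :
  - (CH + 1) <= Hb (rho (hi n)) (gradG G (Phi (lo n))) 0 i + r n 0 i.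
Proof.
have := hCH i (ps_int ps (hi n)) (skewE_gradG G (Phi (lo n))).
by have := r1 n i; rewrite ler_norml => /andP[]; lra.
Qed.

(** Maximum principle: at a maximum point the Laplacian is nonpositive. *)
Lemma Phi_le_ceiling k i : Phi k 0 i <= ceiling k.
Proof.
move: k i; apply: ord_back_ind => [i|n IH].
  rewrite (ps_final ps) /ceiling subnn mulr0 mulr0 addr0.
  apply: le_trans (ler_norm _) (le_trans (norm_inf_entry _ i) _).
  by apply: hCg; case: (ps_int ps ord_max).
have [i _ im] := @Order.TotalTheory.arg_maxP _ _ 'I_d (Ordinal d0) xpredT
  (fun i => Phi (lo n) 0 i) isT.
move=> j; apply: le_trans (im j isT) _; rewrite Phi_step ceiling_step.
have L0 : lapG G (Phi (lo n)) 0 i <= 0.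
  rewrite lapG_entry; apply: sumr_le0 => l e.
  by rewrite pmulr_rle0 ?weight_pos // subr_le0; exact: im.
have := Hb_r_ge n i; have := IH i => h1 h2.
have : 0 <= tau * (Hb (rho (hi n)) (gradG G (Phi (lo n))) 0 i + r n 0 i + (CH + 1)
   - lapG G (Phi (lo n)) 0 i) by rewrite mulr_ge0 ?(ltW tau0) //; lra.
by rewrite !mulrDr !mulrN; lra.
Qed.

(** The diffusion terms cancel in the increment of the pairing, and the structural
   inequality between the two coefficients bounds the rest; the constant 2 pays for
   the two residuals. *)
Lemma pairing_lower (k : 'I_N.+1) : - (Cg + (C0 + 2) * (tau * (N - k)%:R)) <= dot (Phi k) (rho k).
Proof.
move: k; apply: ord_back_ind => [|n IH].
  rewrite subnn mulr0 mulr0 addr0 (ps_final ps) -[leRHS]opprK lerN2 -dotNl.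
  apply: simplex_dot_le => [|i]; first by case: (ps_int ps ord_max).
  rewrite mxE; apply: le_trans (ler_norm _) _; rewrite normrN.
  apply: le_trans (norm_inf_entry _ i) _.
  by apply: hCg; case: (ps_int ps ord_max).
have ix := ps_int ps (hi n); have Sp := skewE_gradG G (Phi (lo n)).
set p := gradG G (Phi (lo n)) in Sp *; set x := rho (hi n) in ix IH *.
have E : dot (Phi (hi n)) x - dot (Phi (lo n)) (rho (lo n)) =
    tau * (dot (Hb x p) x - dotE G (B x p) p + dot (r n) x + dot (Phi (lo n)) (s n)).
  have -> : dot (Phi (hi n)) x - dot (Phi (lo n)) (rho (lo n)) =
      dot (Phi (hi n) - Phi (lo n)) x + dot (Phi (lo n)) (x - rho (lo n)).
    by rewrite dotBl dotBr; ring.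
  rewrite (ps_phi ps) (ps_rho ps) -/x -/p dotZl dotZr -mulrDr; congr (_ * _).
  rewrite !dotDl !dotDr dotNl (dotC (lapG _ _)) !dot_lapG.
  rewrite dot_divG; last exact: SB.
  rewrite -/p (dotEC _ (B x p)) (dotEC _ (gradG G x)); ring.
have h1 := hC0 ix Sp; have h2 := s1 n.
have h3 : dot (r n) x <= 1.
  apply: simplex_dot_le => [|i]; first by case: ix.
  exact: le_trans (ler_norm _) (r1 n i).
have h4 : tau * (dot (Hb x p) x - dotE G (B x p) p + dot (r n) x + dot (Phi (lo n)) (s n))
    <= tau * (C0 + 2) by rewrite ler_pM2l //; lra.
move: IH E; rewrite /= /bump /= add1n -[(N - n)%N](@subnSK n N) ?ltn_ord //.
rewrite -[(N - n.+1).+1]addn1 natrD !mulrDr !mulr1; lra.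
Qed.

Local Notation W := (total_weight G).

(** The other vertices lie below the barrier as well, so the Laplacian can pull the
   value function up at [i] by at most the degree times the gap at [i]. *)
Lemma gap_step n i : ceiling (hi n) - Phi (hi n) 0 i <=
  (1 + tau * W) * (ceiling (lo n) - Phi (lo n) 0 i).
Proof.
have pos j : 0 <= ceiling (lo n) - Phi (lo n) 0 j by rewrite subr_ge0 Phi_le_ceiling.
have L : lapG G (Phi (lo n)) 0 i <= W * (ceiling (lo n) - Phi (lo n) 0 i).
  rewrite lapG_entry; apply: (@le_trans _ _ (\sum_(j | edge G i j)
    weight G i j * (ceiling (lo n) - Phi (lo n) 0 i))).
    apply: ler_sum => j e; rewrite ler_wpM2l ?weight_ge0 //.
    by have := pos j; lra.
  by rewrite -mulr_suml ler_wpM2r // degree_le.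
have := Phi_step n i; have := Hb_r_ge n i; have := ceiling_step n.
set h := Hb _ _ 0 i; set l := lapG _ _ 0 i in L *; move=> E1 h1 E2.
have h2 : 0 <= tau * (h + r n 0 i + (CH + 1)) by rewrite mulr_ge0 ?(ltW tau0) //; lra.
have h3 : tau * l <= tau * (W * (ceiling (lo n) - Phi (lo n) 0 i)) by rewrite ler_pM2l.
by move: E2 h2 h3; rewrite !mulrDl mul1r !mulrDr !mulrN -!mulrA; lra.
Qed.

Lemma power_le_exp (c : R) k : 0 <= c -> (k <= N)%N ->
  1 <= (1 + tau * c) ^+ k <= expR (c * T).
Proof.
move=> c0 kN; have h : 1 <= 1 + tau * c by rewrite lerDl mulr_ge0 ?(ltW tau0).
rewrite exprn_ege1 //=; apply: (@le_trans _ _ ((1 + tau * c) ^+ N)).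
  exact: ler_weXn2l.
apply: (@le_trans _ _ (expR (tau * c) ^+ N)).
  by rewrite lerXn2r ?nnegrE ?expR_ge0 ?(le_trans ler01 h) ?expR_ge1Dx.
rewrite -expRM_natl -tauN.
by have -> : N%:R * (tau * c) = c * (tau * N%:R) by ring.
Qed.

(** Weighted with the initial density, the gaps at time zero have a bounded sum; as the
   weights are at least [eps], each gap is bounded.  The gap then grows at most
   exponentially in time. *)
Lemma Phi_bound eps : 0 < eps -> simplex_ge eps (rho ord0) ->
  forall k i, `|Phi k 0 i| <=
    Cg + (CH + 1) * T + expR (W * T) * ((Cg + (CH + 1) * T + (Cg + (C0 + 2) * T)) / eps).
Proof.
move=> e0 [[x1 x2] xe].
have T0 : 0 <= T by rewrite -tauN mulr_ge0 ?(ltW tau0).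
pose M := Cg + (CH + 1) * T; pose E := Cg + (C0 + 2) * T.
have M0 : 0 <= M by rewrite !addr_ge0 ?mulr_ge0 ?addr_ge0.
have E0 : 0 <= E by rewrite !addr_ge0 ?mulr_ge0 ?addr_ge0.
have gap_pos k j : 0 <= ceiling k - Phi k 0 j by rewrite subr_ge0 Phi_le_ceiling.
have g0 i : ceiling ord0 - Phi ord0 0 i <= (M + E) / eps.
  rewrite ler_pdivlMr //.
  have h1 : \sum_j (ceiling ord0 - Phi ord0 0 j) * rho ord0 0 j <= M + E.
    have -> : \sum_j (ceiling ord0 - Phi ord0 0 j) * rho ord0 0 j
        = ceiling ord0 - dot (Phi ord0) (rho ord0).
      rewrite -[X in _ = X - _]mulr1 -x2 mulr_sumr /dot -sumrB.
      by apply: eq_bigr => j _; rewrite mulrBl.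
    have := pairing_lower ord0; have := ceiling_le ord0.
    by rewrite /= subn0 tauN -/M -/E; lra.
  apply: le_trans h1; rewrite (bigD1 i) //=.
  apply: (@le_trans _ _ ((ceiling ord0 - Phi ord0 0 i) * rho ord0 0 i)).
    by rewrite ler_wpM2l.
  rewrite lerDl; apply: sumr_ge0 => j _; rewrite mulr_ge0 //.
  by case/andP: (x1 j).
have gk (k : 'I_N.+1) i : ceiling k - Phi k 0 i <= (1 + tau * W) ^+ k * ((M + E) / eps).
  move: k; apply: ord_fwd_ind => [|n IH]; first by rewrite expr0 mul1r.
  apply: le_trans (gap_step n i) _; rewrite /= /bump /= add1n exprS -mulrA.
  by rewrite ler_wpM2l // addr_ge0 ?mulr_ge0 ?(ltW tau0) ?total_weight_ge0.
move=> k i; rewrite -/M -/E.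
have D0 := divr_ge0 (addr_ge0 M0 E0) (ltW e0).
have := gk k i; have := Phi_le_ceiling k i; have := ceiling_le k; rewrite -/M.
have /andP[_ pe] := power_le_exp (total_weight_ge0 G) (ltn_ord k).
have h5 : (1 + tau * W) ^+ k * ((M + E) / eps) <= expR (W * T) * ((M + E) / eps).
  exact: ler_wpM2r.
have h6 : 0 <= expR (W * T) * ((M + E) / eps) by rewrite mulr_ge0 ?expR_ge0.
have h7 : 0 <= ceiling k.
  by rewrite /ceiling !addr_ge0 ?mulr_ge0 ?addr_ge0 ?(ltW tau0).
by rewrite ler_norml; move: h5 h6 h7; lra.
Qed.

(** One step divides the density at most by [1 + tau kappa], and the residual is so
   small that it consumes at most half of the initial density over the whole time. *)
Lemma rho_lower (C kappa eps : R) : 0 <= kappa -> 0 < eps -> 0 < T ->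
  (forall x p i, simplex_int x -> S p -> `|p| <= C ->
    - kappa * x 0 i <= (divG G (B x p) + lapG G x) 0 i) ->
  (forall n, `|gradG G (Phi (lo n))| <= C) ->
  (forall n i, - (eps / (2 * (T * expR (kappa * T)))) <= s n 0 i) ->
  (forall i, eps <= rho ord0 0 i) ->
  forall k i, eps / (2 * expR (kappa * T)) <= rho k 0 i.
Proof.
move=> k0 e0 T0 hk hC hs h0 k i.
set Q := expR (kappa * T); have Qp : 0 < Q by exact: expR_gt0.
pose sg := eps / (2 * (T * Q)).
have sg0 : 0 < sg by rewrite divr_gt0 ?mulr_gt0.
have step n : rho (lo n) 0 i - tau * sg <= (1 + tau * kappa) * rho (hi n) 0 i.
  have ix := ps_int ps (hi n).
  have := hk _ _ i ix (skewE_gradG G (Phi (lo n))) (hC n).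
  have := hs n i; rewrite -/Q -/sg.
  have /rowP/(_ i) := ps_rho ps n.
  move: (divG _ _ + lapG _ _) => l; rewrite !mxE => E h1 h2.
  have h3 : tau * (- kappa * rho (hi n) 0 i - sg) <= tau * (l 0 i + s n 0 i).
    by rewrite ler_pM2l //; lra.
  by move: h3; rewrite -E mulrDr mulrN; lra.
have claim (l : 'I_N.+1) : eps - sg * (tau * l%:R) * Q <=
    (1 + tau * kappa) ^+ l * rho l 0 i.
  move: l; apply: ord_fwd_ind => [|n IH].
    by rewrite expr0 mul1r !mulr0 mul0r subr0.
  rewrite /= /bump /= add1n exprSr -[leRHS]mulrA.
  have /andP[p1 pQ] := power_le_exp k0 (ltnW (ltn_ord n)).
  have p0 := le_trans ler01 p1.
  have h1 : (1 + tau * kappa) ^+ n * (rho (lo n) 0 i - tau * sg) <=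
      (1 + tau * kappa) ^+ n * ((1 + tau * kappa) * rho (hi n) 0 i).
    by rewrite ler_wpM2l // step.
  apply: le_trans h1; rewrite mulrBr.
  have h2 : (1 + tau * kappa) ^+ n * (tau * sg) <= Q * (tau * sg).
    by rewrite ler_wpM2r // mulr_ge0 ?ltW.
  move: IH; rewrite /= -[n.+1]addn1 natrD !mulrDr mulr1 mulrDl; lra.
have /andP[p1 pQ] := power_le_exp k0 (ltn_ord k).
have xk : 0 < rho k 0 i by case: (ps_int ps k).
have h1 : eps / 2 <= Q * rho k 0 i.
  apply: (@le_trans _ _ ((1 + tau * kappa) ^+ k * rho k 0 i)); last first.
    by rewrite ler_wpM2r // ltW.
  apply: le_trans (claim k).
  have h2 : sg * (tau * k%:R) * Q <= sg * T * Q.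
    rewrite ler_wpM2r ?(ltW Qp) // ler_wpM2l ?(ltW sg0) // -tauN.
    by rewrite ler_wpM2l ?(ltW tau0) // ler_nat -ltnS.
  have h3 : sg * T * Q = eps / 2.
    by rewrite /sg; field; rewrite !gt_eqF.
  by move: h2; rewrite h3; lra.
by rewrite ler_pdivrMr ?mulr_gt0 //; move: h1; lra.
Qed.

End Bounds.

Lemma apriori_bounds (T eps : R) : 0 < T -> 0 < eps ->
  exists delta C sg : R, [/\ 0 < delta, 0 < C & 0 < sg] /\
  forall N (tau : R) (Phi rho : 'I_N.+1 -> 'rV[R]_d) (r s : 'I_N -> 'rV[R]_d),
    0 < tau -> tau * N%:R = T -> perturbed_scheme tau Phi rho r s ->
    simplex_ge eps (rho ord0) ->
    (forall n i, `|r n 0 i| <= 1) ->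
    (forall n, dot (Phi (lo n)) (s n) <= 1) ->
    (forall n i, - sg <= s n 0 i) ->
    forall k, [/\ forall i, delta <= rho k 0 i, `|Phi k| <= C & `|gradG G (Phi k)| <= C].
Proof.
move=> T0 e0; have [C0 [CH [Cg [[C00 CH0 Cg0] hC0 hCH hCg]]]] := A_bounds hA.
pose C1 := Cg + (CH + 1) * T + expR (total_weight G * T) *
  ((Cg + (CH + 1) * T + (Cg + (C0 + 2) * T)) / eps).
have T0' := ltW T0; have e0' := ltW e0.
have C10 : 0 <= C1.
  by rewrite /C1 !addr_ge0 ?mulr_ge0 ?addr_ge0 ?expR_ge0 ?invr_ge0 ?mulr_ge0 ?addr_ge0.
have [Cd Cd0 hCd] := gradG_bounded G.
pose C := C1 + Cd * C1 + 1.
have CC : 0 <= Cd * C1 by rewrite mulr_ge0.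
have [a ha] := A_mobility hA.
have [kappa k0 hk] := inflow_bound ha C.
have Qp : 0 < expR (kappa * T) by exact: expR_gt0.
exists (eps / (2 * expR (kappa * T))), C, (eps / (2 * (T * expR (kappa * T)))).
split; first by rewrite !divr_gt0 ?mulr_gt0 //; split=> //; rewrite /C; lra.
move=> N tau Phi rho r s tau0 tauN ps ge0 r1 s1 s2.
have Pb k i := Phi_bound tau0 tauN ps r1 s1 C00 CH0 Cg0 hC0 hCH hCg e0 ge0 k i.
have Pn k : `|Phi k| <= C1.
  by apply: mx_norm_le => // i j; rewrite ord1; exact: Pb.
have Pg k : `|gradG G (Phi k)| <= Cd * C1.
  by apply: le_trans (hCd _) _; rewrite ler_wpM2l.
move=> k; split=> [i||].
- apply: (rho_lower tau0 tauN ps k0 e0 T0 hk) => // [n|]; last by case: ge0.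
  by apply: le_trans (Pg _) _; rewrite /C; lra.
- by apply: le_trans (Pn _) _; rewrite /C; lra.
- by apply: le_trans (Pg _) _; rewrite /C; lra.
Qed.

End Apriori.

(** * Consistency of the exact solution *)

Section VectorCurves.
Context {R : realType} {d : nat}.

Lemma is_derive_entry (f : R -> 'rV[R]_d) t i : differentiable f t ->
  is_derive t (1 : R) (fun t => f t 0 i) (f^`()%classic t 0 i).
Proof.
move=> df; have /derivableP := @diff_derivable _ _ _ f t (1 : R) df.
rewrite derive1E => D.
have dm := @ex_derive _ _ _ _ _ _ _ D.
rewrite derive_mx // mxE; apply: derivableP.
by have /derivable_mxP := dm; exact.
Qed.

Lemma entry_lipschitz (f : R -> 'rV[R]_d) (T K : R) :
  (forall t, 0 <= t <= T -> differentiable f t) ->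
  (forall t, 0 <= t <= T -> `|f^`()%classic t| <= K) -> 0 <= K ->
  forall s t, 0 <= s <= T -> 0 <= t <= T -> `|f t - f s| <= K * `|t - s|.
Proof.
move=> df bf K0.
have H s t : 0 <= s -> s < t -> t <= T -> `|f t - f s| <= K * (t - s).
  move=> s0 st tT; apply: mx_norm_le => [|k i].
    by rewrite mulr_ge0 // subr_ge0 ltW.
  have I u : s <= u <= t -> 0 <= u <= T.
    by move=> /andP[u1 u2]; rewrite (le_trans s0 u1) (le_trans u2 tT).
  have [u hu|u /andP[u1 u2] E] := @mvt_itv _ (fun t => f t 0 i)
    (fun t => f^`()%classic t 0 i) s t st.
    by apply: is_derive_entry; exact/df/I.
  rewrite ord1 !mxE E normrM (gtr0_norm (_ : 0 < t - s)) ?subr_gt0 //.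
  rewrite ler_wpM2r ?subr_ge0 ?(ltW st) //.
  by apply: le_trans (mx_entry_le _ _ _) (bf u (I u _)); rewrite !ltW.
move=> s t /andP[s0 sT] /andP[t0 tT]; have [st|ts|->] := ltgtP s t.
- by rewrite (gtr0_norm (_ : 0 < t - s)) ?subr_gt0 //; exact: H.
- by rewrite distrC (distrC t) (gtr0_norm (_ : 0 < s - t)) ?subr_gt0 //; exact: H.
- by rewrite !subrr !normr0 mulr0.
Qed.

End VectorCurves.

Section Exact.
Context {R : realType} {d : nat} (G : wgraph R d).
Variables (H : 'rV[R]_d -> 'M[R]_d -> R) (F UT : 'rV[R]_d -> R).
Hypothesis d0 : (0 < d)%N.
Hypothesis hP : assumption_P G H F UT.
Local Notation S := (skewE G).
Local Notation Hb := (coeff_H H F).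
Local Notation B := (coeff_B G H).
Local Notation g := (grad_rho UT).
Hypothesis hA : assumption_A G Hb B g.

Lemma skewE_coeff_B x p : simplex_int x -> S p -> S (B x p).
Proof.
by move=> ix Sp; apply: skewEN; apply: (skewE_gradH hP) => //; exact: skewEN.
Qed.

Lemma lipschitz_bounded eps C K (W : normedModType R)
    (f : 'rV[R]_d -> 'M[R]_d -> W) : 0 <= K -> 0 <= C ->
  (forall x p x' p', phase G eps C (x, p) -> phase G eps C (x', p') ->
     `|f x' p' - f x p| <= K * (`|x' - x| + `|p' - p|)) ->
  exists2 M, 0 <= M & forall x p, phase G eps C (x, p) -> `|f x p| <= M.
Proof.
move=> K0 C0 h.
have [[[x0 p0] h0]|no] := pselect (exists z, phase G eps C z); last first.
  by exists 0 => // x p hx; exfalso; apply: no; exists (x, p).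
exists (`|f x0 p0| + K * (2 + 2 * C)).
  by rewrite addr_ge0 // mulr_ge0 // addr_ge0 // mulr_ge0.
move=> x p hx; rewrite -[f x p](subrKC (f x0 p0)).
apply: le_trans (ler_normD _ _) _; rewrite lerD2l.
apply: le_trans (h _ _ _ _ h0 hx) _; rewrite ler_wpM2l //.
have n1 := simplex_norm_le (proj1 (proj1 h0)).
have n2 := simplex_norm_le (proj1 (proj1 hx)).
have [_ [_ n3]] := h0; have [_ [_ n4]] := hx; move: n3 n4 => /= n3 n4.
have n5 := ler_normB x x0; have n6 := ler_normB p p0.
move: n1 n2 n5 n6 => /= n1 n2 n5 n6; lra.
Qed.

(** One constant for all estimates on a compact set of states keeps the consistency
   and stability proofs readable. *)
Record phase_constants (eps C K : R) : Prop := {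
  pc_ge0 : 0 <= K;
  pc_H : forall x p x' p', phase G eps C (x, p) -> phase G eps C (x', p') ->
    `|Hb x' p' - Hb x p| <= K * (`|x' - x| + `|p' - p|);
  pc_B : forall x p x' p', phase G eps C (x, p) -> phase G eps C (x', p') ->
    `|B x' p' - B x p| <= K * (`|x' - x| + `|p' - p|);
  pc_Hb : forall x p, phase G eps C (x, p) -> `|Hb x p| <= K;
  pc_Bb : forall x p, phase G eps C (x, p) -> `|B x p| <= K;
  pc_grad : forall u, `|gradG G u| <= K * `|u|;
  pc_div : forall q, `|divG G q| <= K * `|q|;
  pc_lap : forall u, `|lapG G u| <= K * `|u| }.

Lemma phase_constants_exist eps C : 0 < eps -> 0 <= C -> exists K, phase_constants eps C K.
Proof.
move=> e0 C0.
have [K1 K10 h1] := coeff_H_lipschitz hP C e0.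
have [K2 K20 h2] := coeff_B_lipschitz hP C e0.
have [K3 K30 h3] := lipschitz_bounded K10 C0 h1.
have [K4 K40 h4] := lipschitz_bounded K20 C0 h2.
have [K5 K50 h5] := gradG_bounded G.
have [K6 K60 h6] := divG_bounded G.
have K7 : 0 <= K6 * K5 by rewrite mulr_ge0.
have mono (k k' x y : R) : 0 <= y -> x <= k * y -> k <= k' -> x <= k' * y.
  by move=> y0 h kk; apply: le_trans h _; rewrite ler_wpM2r.
exists (K1 + K2 + K3 + K4 + K5 + K6 + K6 * K5).
split.
- by rewrite !addr_ge0.
- by move=> x p x' p' hx hx'; apply: mono (h1 _ _ _ _ hx hx') _; [rewrite addr_ge0|lra].
- by move=> x p x' p' hx hx'; apply: mono (h2 _ _ _ _ hx hx') _; [rewrite addr_ge0|lra].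
- by move=> x p hx; apply: le_trans (h3 _ _ hx) _; lra.
- by move=> x p hx; apply: le_trans (h4 _ _ hx) _; lra.
- by move=> u; apply: mono (h5 u) _; [|lra].
- by move=> u; apply: mono (h6 u) _; [|lra].
- move=> u; apply: (mono (K6 * K5)) => //; last lra.
  apply: le_trans (h6 _) _; rewrite -mulrA ler_wpM2l //.
Qed.

Section Consistency.
Variables (T : R) (rho0 : 'rV[R]_d) (phi rho : R -> 'rV[R]_d).
Hypothesis T0 : 0 < T.
Hypothesis ex : exact_solution G Hb B g T rho0 phi rho.

Lemma ex_diff_phi t : 0 <= t <= T -> differentiable phi t.
Proof.
move=> ht; have [U [_ IU [C1 _]]] := ex_phi_C2 ex.
by have [|dt _] := C1 t; first by apply: IU; rewrite /= in_itv.
Qed.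

Lemma ex_diff_rho t : 0 <= t <= T -> differentiable rho t.
Proof.
move=> ht; have [U [_ IU [C1 _]]] := ex_rho_C2 ex.
by have [|dt _] := C1 t; first by apply: IU; rewrite /= in_itv.
Qed.

(** Compactness of the time interval; the constants depend on the solution, which
   [exact_bounds] repairs. *)
Lemma exact_in_some_phase : exists2 dl, 0 < dl & exists2 C, 0 <= C &
  forall t, 0 <= t <= T -> [/\ simplex_ge dl (rho t), `|phi t| <= C &
    phase G dl C (rho t, gradG G (phi t))].
Proof.
have cI : compact `[0, T] by exact: segment_compact.
have cphi : forall t, `[0, T]%classic t -> {for t, continuous (fun t => `|phi t|)}.
  move=> t; rewrite /= in_itv /= => ht.
  apply: (@continuous_comp _ _ _ phi (fun x => `|x|)); last exact: norm_continuous.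
  exact/differentiable_continuous/ex_diff_phi.
have [C1 C10 hC1] := compact_continuous_bounded cI cphi.
have [K K0 hK] := gradG_bounded G.
have /choice[dl hdl] i : exists dl, 0 < dl /\ forall t, 0 <= t <= T -> dl <= rho t 0 i.
  have [|t tI ht] := @EVT_min R (fun t => rho t 0 i) 0 T (ltW T0).
    apply: continuous_in_subspaceT => t; rewrite inE /= in_itv /= => ht.
    exact: is_derive_continuous (is_derive_entry i (ex_diff_rho ht)).
  move: tI; rewrite in_itv /= => tI.
  exists (rho t 0 i); split; first by case: (ex_int ex tI) => _; exact.
  by move=> s hs; apply: ht; rewrite in_itv.
have D : \forall x \near (0 : R)^'+, forall i, x <= dl i.
  apply: filter_forall => i; apply: nbhs_right_le; exact: (proj1 (hdl i)).
near ((0 : R)^'+) => x.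
have x0 : 0 < x by [].
have xd i : x <= dl i by move: i; near: x.
exists x => //; exists (C1 + K * C1); first by rewrite addr_ge0 ?mulr_ge0.
move=> t ht.
have p1 : `|phi t| <= C1.
  by have := hC1 t; rewrite /= in_itv /= normr_id; exact.
have KC : 0 <= K * C1 by rewrite mulr_ge0.
have g1 : `|gradG G (phi t)| <= K * C1.
  by apply: le_trans (hK _) _; rewrite ler_wpM2l.
have sg : simplex_ge x (rho t).
  split; first by case: (ex_int ex ht).
  by move=> i; apply: le_trans (xd i) (proj2 (hdl i) t ht).
split=> //; first by lra.
split=> //; split; first exact: skewE_gradG.
by rewrite /=; lra.
Unshelve. all: by end_near. Qed.

Section InPhase.
Variables (dl C K : R).
Hypothesis dl0 : 0 < dl.
Hypothesis C0 : 0 <= C.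
Hypothesis pc : phase_constants dl C K.
Hypothesis inphase : forall t, 0 <= t <= T ->
  [/\ simplex_ge dl (rho t), `|phi t| <= C & phase G dl C (rho t, gradG G (phi t))].

Let K0 := pc_ge0 pc.

Definition speed : R := K + K * C + K * K + K.

Lemma speed_ge0 : 0 <= speed.
Proof. by rewrite /speed !addr_ge0 ?mulr_ge0. Qed.

(** The equations bound the time derivatives by the coefficients. *)
Lemma exact_time_lipschitz s t : 0 <= s <= T -> 0 <= t <= T ->
  `|phi t - phi s| <= speed * `|t - s| /\ `|rho t - rho s| <= speed * `|t - s|.
Proof.
move=> hs ht; split; apply: entry_lipschitz hs ht => //; try exact: speed_ge0.
- exact: ex_diff_phi.
- move=> u hu; rewrite (ex_phi_eq ex hu); have [_ pu hp] := inphase hu.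
  apply: le_trans (ler_normB _ _) _.
  have h1 := pc_Hb pc hp; have h2 := pc_lap pc (phi u).
  have h3 : K * `|phi u| <= K * C by rewrite ler_wpM2l.
  have h4 : 0 <= K * K by rewrite mulr_ge0.
  by have := K0; rewrite /speed; lra.
- exact: ex_diff_rho.
- move=> u hu; rewrite (ex_rho_eq ex hu); have [su _ hp] := inphase hu.
  apply: le_trans (ler_normD _ _) _.
  have h1 := pc_Bb pc hp; have h2 := pc_lap pc (rho u).
  have h3 := pc_div pc (B (rho u) (gradG G (phi u))).
  have h4 : K * `|B (rho u) (gradG G (phi u))| <= K * K by rewrite ler_wpM2l.
  have h5 : K * `|rho u| <= K * 1.
    by rewrite ler_wpM2l //; apply: simplex_norm_le; case: su.
  have h6 : 0 <= K * C by rewrite mulr_ge0.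
  by have := K0; rewrite /speed; lra.
Qed.

Variables (N : nat).
Hypothesis N0 : (0 < N)%N.
Local Notation tau := (T / N%:R).

Definition sample (f : R -> 'rV[R]_d) (k : 'I_N.+1) := f (k%:R * tau).

Lemma tau_gt0 : 0 < tau.
Proof. by rewrite divr_gt0 // ltr0n. Qed.

Lemma tauN : tau * N%:R = T.
Proof. by rewrite divfK // pnatr_eq0 -lt0n. Qed.

Lemma grid_in (k : nat) : (k <= N)%N -> 0 <= k%:R * tau <= T.
Proof.
move=> kN; have t0 := tau_gt0; rewrite mulr_ge0 ?(ltW t0) //=.
by rewrite -[leRHS]tauN mulrC ler_wpM2l ?(ltW t0) // ler_nat.
Qed.

Definition res_phi (n : 'I_N) : 'rV[R]_d :=
  tau^-1 *: (sample phi (hi n) - sample phi (lo n))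
  - (Hb (sample rho (hi n)) (gradG G (sample phi (lo n))) - lapG G (sample phi (lo n))).

Definition res_rho (n : 'I_N) : 'rV[R]_d :=
  tau^-1 *: (sample rho (hi n) - sample rho (lo n))
  - (divG G (B (sample rho (hi n)) (gradG G (sample phi (lo n))))
     + lapG G (sample rho (hi n))).

Lemma sample_scheme : perturbed_scheme G Hb B g tau (sample phi) (sample rho) res_phi res_rho.
Proof.
have tn0 : tau != 0 by rewrite gt_eqF // tau_gt0.
have cancel (X Y : 'rV[R]_d) : X + (Y - X) = Y by rewrite addrC subrK.
split=> [k||n|n].
- by apply: (ex_int ex); apply: grid_in; rewrite -ltnS.
- by rewrite /sample /= mulrC tauN; exact: (ex_final ex).
- by rewrite /res_phi cancel scalerA divff // scale1r.
- by rewrite /res_rho cancel scalerA divff // scale1r.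
Qed.

Lemma hi_time (n : 'I_N) : (hi n)%:R * tau = (lo n)%:R * tau + tau :> R.
Proof. by rewrite /= /bump /= add1n -addn1 natrD mulrDl mul1r. Qed.

(** Componentwise, a difference quotient over one step is the derivative at a time
   that is within [tau] of both grid points. *)
Lemma mvt_grid (f f' : R -> R) (n : 'I_N) :
  (forall t : R, 0 <= t <= T -> is_derive t (1 : R) f (f' t)) ->
  exists t, [/\ 0 <= t <= T, `|t - (lo n)%:R * tau| <= tau, `|t - (hi n)%:R * tau| <= tau
   & tau^-1 * (f ((hi n)%:R * tau) - f ((lo n)%:R * tau)) = f' t].
Proof.
move=> hf; have t0 := tau_gt0.
have /andP[a0 _] := grid_in (ltnW (ltn_ord n)).
have /andP[_ bT] := grid_in (ltn_ord n).
have E := hi_time n.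
have lt : (lo n)%:R * tau < (hi n)%:R * tau by rewrite E ltrDl.
have bT' : (hi n)%:R * tau <= T by [].
have I u : (lo n)%:R * tau <= u <= (hi n)%:R * tau -> 0 <= u <= T.
  by move=> /andP[u1 u2]; rewrite (le_trans a0 u1) (le_trans u2 bT').
have [u hu|u /andP[u1 u2] D] := @mvt_itv _ f f' _ _ lt; first exact/hf/I.
exists u; split.
- by apply: I; rewrite !ltW.
- by rewrite ger0_norm; lra.
- by rewrite ler0_norm; lra.
- have E' : (hi n)%:R * tau - (lo n)%:R * tau = tau by rewrite E addrC addKr.
  by rewrite D E' mulrC mulfK // gt_eqF.
Qed.

Definition res_const : R := K * (speed + K * speed) + K * speed
   + K * (K * (speed + K * speed)) + K * speed.

Lemma res_const_ge0 : 0 <= res_const.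
Proof.
have s0 := speed_ge0.
by rewrite /res_const !addr_ge0 ?mulr_ge0 ?addr_ge0 ?mulr_ge0 ?mulr_ge0 ?addr_ge0 ?mulr_ge0.
Qed.

(** By the mean value theorem the difference quotient is the right-hand side of the
   equation at an intermediate time, and the right-hand side at the mixed grid values
   differs from it by Lipschitz constants times [tau]. *)
Lemma residual_bound n : `|res_phi n| <= res_const * tau /\ `|res_rho n| <= res_const * tau.
Proof.
have t0 := tau_gt0; have s0 := speed_ge0.
have Ilo := grid_in (ltnW (ltn_ord n)); have Ihi := grid_in (ltn_ord n).
have [slo plo hlo] := inphase Ilo; have [shi phi_hi hhi] := inphase Ihi.
have hmix : phase G dl C (sample rho (hi n), gradG G (sample phi (lo n))).
  by split; [case: hhi|case: hlo].
have near_t t : 0 <= t <= T -> `|t - (lo n)%:R * tau| <= tau -> `|t - (hi n)%:R * tau| <= tau ->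
    [/\ `|phi t - sample phi (lo n)| <= speed * tau,
        `|rho t - sample rho (hi n)| <= speed * tau &
        `|gradG G (phi t) - gradG G (sample phi (lo n))| <= K * (speed * tau)].
  move=> ht tl th.
  have h1 : `|phi t - sample phi (lo n)| <= speed * tau.
    apply: le_trans (proj1 (exact_time_lipschitz Ilo ht)) _.
    by rewrite ler_wpM2l.
  split=> //.
    apply: le_trans (proj2 (exact_time_lipschitz Ihi ht)) _.
    by rewrite ler_wpM2l.
  rewrite -linearB; apply: le_trans (pc_grad pc _) _.
  by rewrite ler_wpM2l.
have RT : 0 <= res_const * tau by rewrite mulr_ge0 ?res_const_ge0 ?(ltW t0).
have tk (c : R) : 0 <= c -> 0 <= c * tau by move=> c0; rewrite mulr_ge0 ?(ltW t0).
have q1 : 0 <= K * (speed + K * speed) by rewrite mulr_ge0 ?addr_ge0 ?mulr_ge0.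
have q2 : 0 <= K * speed by rewrite mulr_ge0.
have q3 : 0 <= K * (K * (speed + K * speed)) by rewrite mulr_ge0.
split; apply: mx_norm_le => // k i; rewrite ord1.
- have [t ht|t [ht tl th E]] := @mvt_grid (fun t => phi t 0 i)
    (fun t => phi^`()%classic t 0 i) n.
    by apply: is_derive_entry; exact: ex_diff_phi.
  have [a1 a2 a3] := near_t t ht tl th; have [_ _ ht'] := inphase ht.
  have -> : res_phi n 0 i = ((Hb (rho t) (gradG G (phi t))
      - Hb (sample rho (hi n)) (gradG G (sample phi (lo n))))
      - lapG G (phi t - sample phi (lo n))) 0 i.
    have {}E : tau^-1 * (sample phi (hi n) 0 i - sample phi (lo n) 0 i)
      = phi^`()%classic t 0 i := E.
    move: E; rewrite (ex_phi_eq ex ht) /res_phi.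
    have -> : lapG G (phi t - sample phi (lo n)) = lapG G (phi t) - lapG G (sample phi (lo n)).
      exact: linearB.
    move: (lapG _ _) (lapG _ _) => l1 l2; rewrite !mxE => ->; ring.
  apply: le_trans (mx_entry_le _ _ _) (le_trans (ler_normB _ _) _).
  have b1 := pc_H pc hmix ht'; have b2 := pc_lap pc (phi t - sample phi (lo n)).
  have b3 : K * (`|rho t - sample rho (hi n)| + `|gradG G (phi t) - gradG G (sample phi (lo n))|)
     <= K * (speed * tau + K * (speed * tau)) by rewrite ler_wpM2l // lerD.
  have b4 : K * `|phi t - sample phi (lo n)| <= K * (speed * tau) by rewrite ler_wpM2l.
  have := tk _ q3; have := tk _ q2; rewrite /res_const; lra.
- have [t ht|t [ht tl th E]] := @mvt_grid (fun t => rho t 0 i)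
    (fun t => rho^`()%classic t 0 i) n.
    by apply: is_derive_entry; exact: ex_diff_rho.
  have [a1 a2 a3] := near_t t ht tl th; have [_ _ ht'] := inphase ht.
  have -> : res_rho n 0 i = (divG G (B (rho t) (gradG G (phi t))
      - B (sample rho (hi n)) (gradG G (sample phi (lo n))))
      + lapG G (rho t - sample rho (hi n))) 0 i.
    have {}E : tau^-1 * (sample rho (hi n) 0 i - sample rho (lo n) 0 i)
      = rho^`()%classic t 0 i := E.
    move: E; rewrite (ex_rho_eq ex ht) /res_rho.
    have -> : lapG G (rho t - sample rho (hi n)) = lapG G (rho t) - lapG G (sample rho (hi n)).
      exact: linearB.
    have -> : divG G (B (rho t) (gradG G (phi t))
      - B (sample rho (hi n)) (gradG G (sample phi (lo n)))) =
      divG G (B (rho t) (gradG G (phi t)))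
      - divG G (B (sample rho (hi n)) (gradG G (sample phi (lo n)))).
      exact: linearB.
    move: (lapG _ _) (lapG _ _) (divG _ _) (divG _ _) => l1 l2 l3 l4.
    rewrite !mxE => ->; ring.
  apply: le_trans (mx_entry_le _ _ _) (le_trans (ler_normD _ _) _).
  have b1 := pc_B pc hmix ht'; have b2 := pc_lap pc (rho t - sample rho (hi n)).
  have b5 := pc_div pc (B (rho t) (gradG G (phi t))
      - B (sample rho (hi n)) (gradG G (sample phi (lo n)))).
  have b3 : K * (`|rho t - sample rho (hi n)| + `|gradG G (phi t) - gradG G (sample phi (lo n))|)
     <= K * (speed * tau + K * (speed * tau)) by rewrite ler_wpM2l // lerD.
  have b6 := ler_wpM2l K0 (le_trans b1 b3).
  have b4 : K * `|rho t - sample rho (hi n)| <= K * (speed * tau) by rewrite ler_wpM2l.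
  have := tk _ q1; have := tk _ q2; rewrite /res_const; lra.
Qed.

End InPhase.
End Consistency.
End Exact.

(** * Stability *)

Section Paths.
Context {R : realType} {V : normedZmodType R} {N : nat}.
Variables (f : 'I_N.+1 -> V) (b : 'I_N -> R).
Hypothesis hb : forall n, `|f (hi n) - f (lo n)| <= b n.

Let b0 n : 0 <= b n. Proof. exact: le_trans (hb n). Qed.

Lemma path_from_start k : `|f k - f ord0| <= \sum_n b n.
Proof.
suff h : `|f k - f ord0| <= \sum_(n < N | (n < k)%N) b n.
  apply: le_trans h _; rewrite big_mkcond /=.
  by apply: ler_sum => n _; case: ifP.
move: k; apply: ord_fwd_ind => [|n IH].
  by rewrite subrr normr0; apply: sumr_ge0.
rewrite (bigD1 n) /=; last by rewrite /bump /= add1n ltnS.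
rewrite -(subrKA (f (lo n))); apply: le_trans (ler_normD _ _) _.
apply: lerD (hb n) (le_trans IH _); rewrite le_eqVlt; apply/orP; left; apply/eqP.
by apply: eq_bigl => i; rewrite /= /bump /= add1n ltnS ltn_neqAle andbC.
Qed.

Lemma path_to_end k : `|f ord_max - f k| <= \sum_n b n.
Proof.
suff h : `|f ord_max - f k| <= \sum_(n < N | (k <= n)%N) b n.
  apply: le_trans h _; rewrite big_mkcond /=.
  by apply: ler_sum => n _; case: ifP.
move: k; apply: ord_back_ind => [|n IH].
  by rewrite subrr normr0; apply: sumr_ge0.
rewrite (bigD1 n) //= -(subrKA (f (hi n))); apply: le_trans (ler_normD _ _) _.
rewrite [leRHS]addrC; apply: lerD (le_trans IH _) (hb n).
rewrite le_eqVlt; apply/orP; left; apply/eqP.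
by apply: eq_bigl => i; rewrite /= /bump /= add1n ltn_neqAle eq_sym andbC.
Qed.

End Paths.

Section Stability.
Context {R : realType} {d : nat} (G : wgraph R d).
Variables (H : 'rV[R]_d -> 'M[R]_d -> R) (F UT : 'rV[R]_d -> R).
Hypothesis d0 : (0 < d)%N.
Hypothesis hP : assumption_P G H F UT.
Local Notation S := (skewE G).
Local Notation Hb := (coeff_H H F).
Local Notation B := (coeff_B G H).
Local Notation g := (grad_rho UT).

Lemma sum_with_smaller_rate (A1 A2 X s1 s2 m1 m2 mm : R) : A1 - - X <= - m1 * s2 ->
  A2 <= - m2 * s1 -> mm * s1 <= m2 * s1 -> mm * s2 <= m1 * s2 ->
  A1 + A2 - - X <= - mm * (s1 + s2).
Proof. lra. Qed.

(** The two diffusion terms cancel, the Laplacian being symmetric. *)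
Lemma pairing_identity (h e z r s : 'rV[R]_d) (b : 'M[R]_d) : S b ->
  dot (h - lapG G e + r) z + dot e (divG G b + lapG G z + s) =
  dot h z - dotE G b (gradG G e) + dot r z + dot e s.
Proof.
move=> Sb; rewrite !dotDl !dotDr dotNl (dotC (lapG _ _)) !dot_lapG dot_divG //.
rewrite (dotEC _ b) (dotEC _ (gradG G z)); ring.
Qed.

(** The Hamiltonian is coercive in the flow only; the strictly concave [F] supplies
   coercivity in the density. *)
Lemma coeff_monotone eps C : 0 < eps -> exists2 m, 0 < m & forall x p x' p',
  phase G eps C (x, p) -> phase G eps C (x', p') ->
  dot (Hb x' p' - Hb x p) (x' - x) - dotE G (B x' p' - B x p) (p' - p)
  <= - m * (`|x' - x| ^+ 2 + `|p' - p| ^+ 2).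
Proof.
move=> e0; have [m1 m10 h1] := H_monotone hP C e0.
have [m2 m20 h2] := F_monotone hP e0.
exists (Num.min m1 m2); first by rewrite lt_min m10.
move=> x p x' p' hx hx'.
have := h1 _ _ _ _ (phaseN hx) (phaseN hx').
have := h2 _ _ (proj1 hx) (proj1 hx').
have -> : - p' - - p = - (p' - p) by rewrite opprB opprK addrC.
rewrite normrN dotENr.
have -> : dotE G (B x' p' - B x p) (p' - p) =
   - dotE G (grad_skew G (H x') (- p') - grad_skew G (H x) (- p)) (p' - p).
  by rewrite /coeff_B -dotENl opprB opprK addrC.
have -> : dot (Hb x' p' - Hb x p) (x' - x) =
   dot (grad_rho (fun r => H r (- p')) x' - grad_rho (fun r => H r (- p)) x) (x' - x)
   + dot (grad_rho F x' - grad_rho F x) (x' - x).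
  by rewrite /coeff_H -dotDl; congr dot; rewrite opprD addrACA.
move=> b2 b1.
have c1 : Num.min m1 m2 * `|x' - x| ^+ 2 <= m2 * `|x' - x| ^+ 2.
  by rewrite ler_wpM2r ?sqr_ge0 // ge_min lexx orbT.
have c2 : Num.min m1 m2 * `|p' - p| ^+ 2 <= m1 * `|p' - p| ^+ 2.
  by rewrite ler_wpM2r ?sqr_ge0 // ge_min lexx.
exact: (sum_with_smaller_rate b1 b2 c1 c2).
Qed.

Lemma young_ineq (m x y : R) : 0 < m -> x * y <= m / 2 * x ^+ 2 + y ^+ 2 / (2 * m).
Proof.
move=> m0; have : 0 <= (m * x - y) ^+ 2 / (2 * m).
  by rewrite divr_ge0 ?sqr_ge0 // mulr_ge0 // ltW.
have -> : (m * x - y) ^+ 2 / (2 * m) = m / 2 * x ^+ 2 + y ^+ 2 / (2 * m) - x * y.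
  by field; rewrite gt_eqF.
lra.
Qed.

Section TwoSolutions.
Variables (N : nat) (tau T : R) (Phi rho Psi sig : 'I_N.+1 -> 'rV[R]_d)
  (r s : 'I_N -> 'rV[R]_d).
Variables (dl C K m Cp KU Rc : R).
Hypothesis tau0 : 0 < tau.
Hypothesis tauN : tau * N%:R = T.
Hypothesis ps1 : perturbed_scheme G Hb B g tau Phi rho r s.
Hypothesis ps2 : perturbed_scheme G Hb B g tau Psi sig (fun=> 0) (fun=> 0).
Hypothesis start : rho ord0 = sig ord0.
Hypothesis dl0 : 0 < dl.
Hypothesis in1 : forall n : 'I_N, phase G dl C (rho (hi n), gradG G (Phi (lo n))).
Hypothesis in2 : forall n : 'I_N, phase G dl C (sig (hi n), gradG G (Psi (lo n))).
Hypothesis pc : phase_constants G H F dl C K.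
Hypothesis m0 : 0 < m.
Hypothesis mono : forall x p x' p',
  phase G dl C (x, p) -> phase G dl C (x', p') ->
  dot (Hb x' p' - Hb x p) (x' - x) - dotE G (B x' p' - B x p) (p' - p)
  <= - m * (`|x' - x| ^+ 2 + `|p' - p| ^+ 2).
Hypothesis Cp0 : 0 <= Cp.
Hypothesis poin : forall e z, zero_sum z -> `|dot e z| <= Cp * (`|gradG G e| * `|z|).
Hypothesis KU0 : 0 <= KU.
Hypothesis lipU : forall x x', simplex x -> simplex x' -> `|g x' - g x| <= KU * `|x' - x|.
Hypothesis Rc0 : 0 <= Rc.
Hypothesis rb : forall n, `|r n| <= Rc * tau.
Hypothesis sb : forall n, `|s n| <= Rc * tau.

Let K0 := pc_ge0 pc.
Let e k := Phi k - Psi k.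
Let z k := rho k - sig k.
Let a n := `|z (hi n)|.
Let p n := `|gradG G (e (lo n))|.

Let T0 : 0 <= T. Proof. by rewrite -tauN mulr_ge0 // ltW. Qed.

Let sumc (c : R) : tau * \sum_(n < N) c = c * T.
Proof. by rewrite sumr_const card_ord -mulr_natr -tauN; ring. Qed.

Let dHn n := Hb (rho (hi n)) (gradG G (Phi (lo n))) - Hb (sig (hi n)) (gradG G (Psi (lo n))).
Let dBn n := B (rho (hi n)) (gradG G (Phi (lo n))) - B (sig (hi n)) (gradG G (Psi (lo n))).

Lemma diff_phi n : e (hi n) - e (lo n) = tau *: (dHn n - lapG G (e (lo n)) + r n).
Proof.
have -> : e (hi n) - e (lo n) = (Phi (hi n) - Phi (lo n)) - (Psi (hi n) - Psi (lo n)).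
  by rewrite /e; apply/rowP => i; rewrite !mxE; ring.
rewrite (ps_phi ps1) (ps_phi ps2) -scalerBr; congr (_ *: _).
have -> : lapG G (e (lo n)) = lapG G (Phi (lo n)) - lapG G (Psi (lo n)) by exact: linearB.
move: (lapG _ _) (lapG _ _) => l1 l2; rewrite /dHn.
move: (Hb _ _) (Hb _ _) => h1 h2; by apply/rowP => i; rewrite !mxE; ring.
Qed.

Lemma diff_rho n : z (hi n) - z (lo n) = tau *: (divG G (dBn n) + lapG G (z (hi n)) + s n).
Proof.
have -> : z (hi n) - z (lo n) = (rho (hi n) - rho (lo n)) - (sig (hi n) - sig (lo n)).
  by rewrite /z; apply/rowP => i; rewrite !mxE; ring.
rewrite (ps_rho ps1) (ps_rho ps2) -scalerBr; congr (_ *: _).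
have -> : lapG G (z (hi n)) = lapG G (rho (hi n)) - lapG G (sig (hi n)) by exact: linearB.
have -> : divG G (dBn n) = divG G (B (rho (hi n)) (gradG G (Phi (lo n))))
   - divG G (B (sig (hi n)) (gradG G (Psi (lo n)))) by exact: linearB.
move: (lapG _ _) (lapG _ _) (divG _ _) (divG _ _) => l1 l2 l3 l4.
by apply/rowP => i; rewrite !mxE; ring.
Qed.

(** Both densities have total mass one and divergences sum to zero, so the residual of
   the continuity equation carries no mass; this is what allows it to be paired with
   the value error through the gradient of the latter. *)
Lemma zero_sum_s n : zero_sum (s n).
Proof.
have ix := ps_int ps1 (hi n); have iy := ps_int ps1 (lo n).
have Sp := skewE_gradG G (Phi (lo n)).
have /zero_sumP := zero_sumB (proj1 ix) (proj1 iy).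
rewrite (ps_rho ps1) dotZr !dotDr => /eqP.
have /zero_sumP -> := zero_sum_divG (skewE_coeff_B hP ix Sp).
have /zero_sumP -> : zero_sum (lapG G (rho (hi n))).
  by apply: zero_sum_divG; exact: skewE_gradG.
by rewrite !add0r mulf_eq0 gt_eqF //= => /eqP h; apply/zero_sumP.
Qed.

Lemma SdB n : S (dBn n).
Proof.
apply: skewEB; apply: (skewE_coeff_B hP); try exact: skewE_gradG.
  exact: (ps_int ps1).
exact: (ps_int ps2).
Qed.

Lemma pE n : p n = `|gradG G (Phi (lo n)) - gradG G (Psi (lo n))|.
Proof. by rewrite /p /e linearB. Qed.

(** The pairing of the two errors decreases by [m] times the squared errors; half of
   this is spent on absorbing the residuals by the inequality of Young. *)
Lemma energy_step n :
  dot (e (hi n)) (z (hi n)) - dot (e (lo n)) (z (lo n)) <=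
  tau * (- (m / 2) * (a n ^+ 2 + p n ^+ 2)
         + (d%:R ^+ 2 + Cp ^+ 2) * (Rc * tau) ^+ 2 / (2 * m)).
Proof.
have -> : dot (e (hi n)) (z (hi n)) - dot (e (lo n)) (z (lo n)) =
    dot (e (hi n) - e (lo n)) (z (hi n)) + dot (e (lo n)) (z (hi n) - z (lo n)).
  by rewrite dotBl dotBr; ring.
rewrite diff_phi diff_rho dotZl dotZr -mulrDr ler_pM2l //.
have -> : dot (dHn n - lapG G (e (lo n)) + r n) (z (hi n)) +
   dot (e (lo n)) (divG G (dBn n) + lapG G (z (hi n)) + s n) =
   dot (dHn n) (z (hi n)) - dotE G (dBn n) (gradG G (e (lo n)))
   + dot (r n) (z (hi n)) + dot (e (lo n)) (s n).
  exact: pairing_identity (SdB n).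
have h1 : dot (dHn n) (z (hi n)) - dotE G (dBn n) (gradG G (e (lo n))) <=
    - m * (a n ^+ 2 + p n ^+ 2).
  have := mono (in2 n) (in1 n).
  rewrite -/(dHn n) -/(dBn n) -/(z (hi n)) -/(a n) -pE.
  by have -> : gradG G (Phi (lo n)) - gradG G (Psi (lo n)) = gradG G (e (lo n))
    by rewrite /e linearB.
have Rt : 0 <= Rc * tau by rewrite mulr_ge0 // ltW.
have i2m : 0 <= (2 * m)^-1 by rewrite invr_ge0 mulr_ge0 // ltW.
have h2 : dot (r n) (z (hi n)) <= m / 2 * a n ^+ 2 + (d%:R * (Rc * tau)) ^+ 2 / (2 * m).
  apply: le_trans (ler_norm _) (le_trans (norm_dot_le _ _) _).
  apply: le_trans (young_ineq (a n) _ m0).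
  rewrite -/(a n) mulrA mulrC ler_wpM2l ?normr_ge0 // ler_wpM2l //.
have h3 : dot (e (lo n)) (s n) <= m / 2 * p n ^+ 2 + (Cp * (Rc * tau)) ^+ 2 / (2 * m).
  apply: le_trans (ler_norm _) (le_trans (poin _ (zero_sum_s n)) _).
  apply: le_trans (young_ineq (p n) _ m0).
  rewrite -/(p n) mulrCA ler_wpM2l ?normr_ge0 // ler_wpM2l //.
have -> : (d%:R ^+ 2 + Cp ^+ 2) * (Rc * tau) ^+ 2 / (2 * m) =
  (d%:R * (Rc * tau)) ^+ 2 / (2 * m) + (Cp * (Rc * tau)) ^+ 2 / (2 * m).
  by rewrite !exprMn mulrDl mulrDl.
move: h1 h2 h3; lra.
Qed.

Definition energy_const : R := (d%:R ^+ 2 + Cp ^+ 2) * Rc ^+ 2 * T / m ^+ 2.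

(** Telescoping: the density error vanishes initially, and the pairing is nonnegative
   at the final time by monotonicity of the terminal gradient. *)
Lemma energy_bound : tau * \sum_n (a n ^+ 2 + p n ^+ 2) <= energy_const * tau ^+ 2.
Proof.
have eN : 0 <= dot (e ord_max) (z ord_max).
  rewrite /e (ps_final ps1) (ps_final ps2); apply: (UT_monotone hP).
    by case: (ps_int ps2 ord_max).
  by case: (ps_int ps1 ord_max).
have z0 : dot (e ord0) (z ord0) = 0 by rewrite /z start subrr dot0r.
have := ler_sum (index_enum _) (fun n (_ : true) => energy_step n).
rewrite (sum_telescope (fun k => dot (e k) (z k))) z0 subr0 -mulr_sumr big_split /=.
rewrite -mulr_sumr => /(le_trans eN).
rewrite mulrDr sumc mulrCA => h.
have m2 : 0 < m / 2 by rewrite divr_gt0.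
have : m / 2 * (tau * \sum_n (a n ^+ 2 + p n ^+ 2)) <= m / 2 * (energy_const * tau ^+ 2).
  have -> : m / 2 * (energy_const * tau ^+ 2) =
      (d%:R ^+ 2 + Cp ^+ 2) * (Rc * tau) ^+ 2 / (2 * m) * T.
    by rewrite /energy_const; field; rewrite gt_eqF.
  by move: h; rewrite mulNr; lra.
by rewrite ler_pM2l.
Qed.

(** From square sums to sums: [x <= tau / 2 + x^2 / tau], and the square sum is of
   order [tau^2]. *)
Lemma sum_errors : tau * \sum_n (a n + p n) <= (T + energy_const) * tau.
Proof.
have step n : a n + p n <= tau + tau^-1 * (a n ^+ 2 + p n ^+ 2).
  have sq (x : R) : x <= tau / 2 + tau^-1 * x ^+ 2.
    have : 0 <= tau^-1 * (x - tau / 2) ^+ 2.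
      by rewrite mulr_ge0 ?sqr_ge0 // invr_ge0 ltW.
    have -> : tau^-1 * (x - tau / 2) ^+ 2 = tau^-1 * x ^+ 2 - x + tau / 4.
      by field; rewrite gt_eqF.
    by have t0 := ltW tau0; lra.
  have := sq (a n); have := sq (p n); rewrite mulrDr; lra.
have := ler_wpM2l (ltW tau0) (ler_sum (index_enum _) (fun n (_ : true) => step n)).
rewrite [X in _ <= _ * X -> _]big_split /= [X in _ <= X -> _]mulrDr sumc -mulr_sumr => /le_trans; apply.
have -> : (T + energy_const) * tau = tau * T + tau^-1 * (energy_const * tau ^+ 2).
  by field; rewrite gt_eqF.
rewrite lerD2l [leLHS]mulrCA ler_wpM2l ?energy_bound // invr_ge0 ltW //.
Qed.

Definition density_const : R := (K * K + K) * (T + energy_const) + Rc * T.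
Definition value_const : R := KU * density_const + ((K + K) * (T + energy_const) + Rc * T).

(** The continuity equation bounds each increment of the density error by the errors
   of the step, which are summable. *)
Lemma rho_error k : `|rho k - sig k| <= density_const * tau.
Proof.
rewrite -/(z k).
have step n : `|z (hi n) - z (lo n)| <= tau * ((K * K + K) * (a n + p n) + Rc * tau).
  rewrite diff_rho normrZ gtr0_norm // ler_pM2l //.
  apply: le_trans (ler_normD _ _) _; apply: lerD => //.
  apply: le_trans (ler_normD _ _) _.
  have h1 := pc_div pc (dBn n); have h2 := pc_lap pc (z (hi n)).
  have h3 : `|dBn n| <= K * (a n + p n) by rewrite pE; exact: (pc_B pc (in2 n) (in1 n)).
  have h4 : K * `|dBn n| <= K * (K * (a n + p n)) by rewrite ler_wpM2l.
  have h5 : K * `|z (hi n)| <= K * (a n + p n) by rewrite ler_wpM2l // lerDl /p.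
  by move: h1 h2 h4 h5; lra.
have := path_from_start step k; rewrite /z start subrr subr0 -/(z k) => /le_trans; apply.
rewrite -mulr_sumr big_split /= mulrDr sumc -mulr_sumr mulrCA.
have c0 : 0 <= K * K + K by rewrite addr_ge0 ?mulr_ge0.
have := ler_wpM2l c0 sum_errors; rewrite /density_const; lra.
Qed.

(** As for the density, but from the final time backward, where the error of the
   terminal gradient is controlled by that of the density. *)
Lemma phi_error k : `|Phi k - Psi k| <= value_const * tau.
Proof.
rewrite -/(e k).
have step n : `|e (hi n) - e (lo n)| <= tau * ((K + K) * (a n + p n) + Rc * tau).
  rewrite diff_phi normrZ gtr0_norm // ler_pM2l //.
  apply: le_trans (ler_normD _ _) _; apply: lerD => //.
  apply: le_trans (ler_normB _ _) _.
  have h1 := pc_div pc (gradG G (e (lo n))).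
  have h3 : `|dHn n| <= K * (a n + p n) by rewrite pE; exact: (pc_H pc (in2 n) (in1 n)).
  have h5 : K * p n <= K * (a n + p n) by rewrite ler_wpM2l // lerDr /a.
  by move: h1 h3 h5; rewrite -/(lapG G _) -/(p n); lra.
have h := path_to_end step k.
have hN : `|e ord_max| <= KU * (density_const * tau).
  rewrite /e (ps_final ps1) (ps_final ps2); apply: le_trans (lipU _ _) _.
  - by case: (ps_int ps2 ord_max).
  - by case: (ps_int ps1 ord_max).
  by rewrite ler_wpM2l //; exact: rho_error.
have E : e k = e ord_max - (e ord_max - e k) by rewrite opprB addrC subrK.
rewrite E; apply: le_trans (ler_normB _ _) _.
apply: (@le_trans _ _ (KU * (density_const * tau) + ((K + K) * (T + energy_const) + Rc * T) * tau)); last first.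
  by rewrite /value_const; lra.
apply: lerD hN (le_trans h _).
rewrite -mulr_sumr big_split /= mulrDr sumc -mulr_sumr mulrCA.
have c0 : 0 <= K + K by rewrite addr_ge0.
have := ler_wpM2l c0 sum_errors; lra.
Qed.

Lemma gradient_error :
  tau * \sum_n `|gradG G (Phi (lo n) - Psi (lo n))| ^+ 2 <= energy_const * tau ^+ 2.
Proof.
apply: le_trans energy_bound; rewrite ler_pM2l //.
by apply: ler_sum => n _; rewrite lerDr sqr_ge0.
Qed.

End TwoSolutions.
End Stability.

(** * Convergence *)

Section Convergence.
Context {R : realType} {d : nat} (G : wgraph R d).
Variables (H : 'rV[R]_d -> 'M[R]_d -> R) (F UT : 'rV[R]_d -> R).
Hypothesis d0 : (0 < d)%N.
Hypothesis hP : assumption_P G H F UT.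
Local Notation S := (skewE G).
Local Notation Hb := (coeff_H H F).
Local Notation B := (coeff_B G H).
Local Notation g := (grad_rho UT).
Hypothesis hA : assumption_A G Hb B g.
Variable T : R.
Hypothesis T0 : 0 < T.

Lemma phase_weaken e e' C C' x p : e' <= e -> C <= C' ->
  phase G e C (x, p) -> phase G e' C' (x, p).
Proof.
move=> ee CC [[sx h] [Sp n]]; split; last by split=> //; exact: le_trans CC.
by split=> // i; exact: le_trans (h i).
Qed.

Lemma fine_grid (Q : R) : exists2 N, (0 < N)%N & Q * (T / N%:R) <= 1.
Proof.
exists (Num.truncn (Q * T)).+1 => //.
by rewrite mulrA ler_pdivrMr ?ltr0n // mul1r ltW // truncnS_gt.
Qed.

Lemma nearest_grid_point N t : (0 < N)%N -> 0 <= t <= T ->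
  exists k : 'I_N.+1, `|t - k%:R * (T / N%:R)| <= T / N%:R.
Proof.
move=> N0 /andP[t0 tT].
have h0 : 0 < T / N%:R by rewrite divr_gt0 ?ltr0n.
have kt : 0 <= t / (T / N%:R) by rewrite divr_ge0 // ltW.
have /andP[k1 k2] := truncn_itv kt.
move: k1; rewrite ler_pdivlMr // => k1.
move: k2; rewrite ltr_pdivrMr // => k2.
have kN : (Num.truncn (t / (T / N%:R)) < N.+1)%N.
  rewrite ltnS -(ler_nat R); apply: (@le_trans _ _ (t / (T / N%:R))).
    by rewrite ler_pdivlMr.
  by rewrite ler_pdivrMr // mulrC divfK // gt_eqF ?ltr0n.
exists (Ordinal kN) => /=; rewrite ger0_norm ?subr_ge0 //.
by move: k2; rewrite -addn1 natrD mulrDl mul1r; lra.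
Qed.

(** The exact solution, sampled on a fine enough grid, solves the scheme up to
   residuals that the discrete a priori estimate tolerates; between grid points
   it moves little.  How fine the grid must be depends on the solution through
   [exact_in_some_phase], but the resulting bounds do not. *)
Lemma exact_bounds eps : 0 < eps -> exists dl C, [/\ 0 < dl, 0 <= C &
  forall rho0 phi rho, simplex_ge eps rho0 ->
    exact_solution G Hb B g T rho0 phi rho ->
    forall t, 0 <= t <= T -> phase G dl C (rho t, gradG G (phi t)) /\
      (simplex_ge dl (rho t) /\ `|phi t| <= C)].
Proof.
move=> e0.
have SB x p : simplex_int x -> S p -> S (B x p) by exact: (skewE_coeff_B hP).
have [dA [CA [sg [[dA0 CA0 sg0] hap]]]] := apriori_bounds d0 hA SB T0 e0.
have [Kg Kg0 hKg] := gradG_bounded G.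
have gC : 0 <= Kg * (CA + 1) by rewrite mulr_ge0 // addr_ge0 // ltW.
exists (dA / 2), ((CA + 1) + Kg * (CA + 1)); split.
- by rewrite divr_gt0.
- by have := ltW CA0; lra.
move=> rho0 phi rho ge0 ex t ht.
have [d1 d10 [C1 C10 h1]] := exact_in_some_phase T0 ex.
have [K pc] := phase_constants_exist hP d10 C10.
pose v := speed C1 K; pose Rc := res_const C1 K.
have v0 : 0 <= v by exact: speed_ge0 C10 pc.
have Rc0 : 0 <= Rc by exact: res_const_ge0 C10 pc.
(* Each summand is one requirement on the step: three on the residuals and two on
   the motion of the solution within one step. *)
pose Q := Rc + Rc / sg + d%:R * C1 * Rc + v + v / (dA / 2).
have [N N0 hQ] := fine_grid Q.
set tau := T / N%:R in hQ.
have tau0 : 0 < tau by rewrite divr_gt0 ?ltr0n.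
have q1 : 0 <= Rc * tau by rewrite mulr_ge0 // ltW.
have q2 : 0 <= Rc / sg * tau by rewrite mulr_ge0 ?(ltW tau0) // divr_ge0 // ltW.
have q3 : 0 <= d%:R * C1 * Rc * tau by rewrite mulr_ge0 ?(ltW tau0) // !mulr_ge0.
have q4 : 0 <= v * tau by rewrite mulr_ge0 // ltW.
have q5 : 0 <= v / (dA / 2) * tau.
  by rewrite mulr_ge0 ?(ltW tau0) // divr_ge0 // ltW // divr_gt0.
have {}hQ : Rc * tau + Rc / sg * tau + d%:R * C1 * Rc * tau + v * tau
    + v / (dA / 2) * tau <= 1 by move: hQ; rewrite /Q !mulrDl.
have b1 : Rc * tau <= 1 by lra.
have b2 : Rc * tau <= sg.
  have : Rc / sg * tau <= 1 by lra.
  by rewrite mulrAC ler_pdivrMr // mul1r.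
have b3 : d%:R * C1 * Rc * tau <= 1 by lra.
have b4 : v * tau <= 1 by lra.
have b5 : v * tau <= dA / 2.
  have : v / (dA / 2) * tau <= 1 by lra.
  by rewrite mulrAC ler_pdivrMr ?divr_gt0 // mul1r.
have rb n := residual_bound T0 ex C10 pc h1 N0 n.
have ps := sample_scheme T0 ex N0.
have grid (k : 'I_N.+1) : [/\ forall i, dA <= sample T rho k 0 i, `|sample T phi k| <= CA
    & `|gradG G (sample T phi k)| <= CA].
  move: k; apply: (hap N tau _ _ _ _ tau0 (tauN T N0) ps).
  - by rewrite /sample /= mul0r (ex_init ex).
  - by move=> n i; apply: le_trans (mx_entry_le _ _ _) (le_trans (proj1 (rb n)) _).
  - move=> n; apply: le_trans (ler_norm _) (le_trans (norm_dot_le _ _) _).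
    apply: le_trans b3; rewrite -!mulrA ler_wpM2l // ler_pM //.
      have [|_ h _] := h1 ((lo n)%:R * tau); last by exact: h.
      by apply: (grid_in T0 N0); exact: ltnW (ltn_ord n).
    exact: (proj2 (rb n)).
  - move=> n i; have := mx_entry_le (res_rho G H T phi rho n) 0 i.
    have := proj2 (rb n); rewrite -/tau => r1 r2.
    have : `|res_rho G H T phi rho n 0 i| <= sg.
      by apply: le_trans r2 (le_trans r1 _).
    by rewrite ler_norml => /andP[].
have [k hk] := nearest_grid_point N0 ht.
have [g1 g2 _] := grid k.
have Ik : 0 <= k%:R * tau <= T by apply: (grid_in T0 N0); rewrite -ltnS.
have [l1 l2] := exact_time_lipschitz ex C10 pc h1 Ik ht.
have vk : v * `|t - k%:R * tau| <= v * tau by rewrite ler_wpM2l.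
have p1 : `|phi t| <= CA + 1.
  rewrite -[phi t](subrK (phi (k%:R * tau))); apply: le_trans (ler_normD _ _) _.
  rewrite addrC; apply: lerD; first exact: g2.
  by apply: le_trans l1 (le_trans vk _).
have r1 i : dA / 2 <= rho t 0 i.
  have := mx_entry_le (rho t - rho (k%:R * tau)) 0 i; rewrite !mxE.
  have := g1 i; rewrite /sample -/tau => h2 h3.
  have : `|rho t 0 i - rho (k%:R * tau) 0 i| <= dA / 2.
    by apply: le_trans h3 (le_trans l2 (le_trans vk _)).
  by rewrite ler_norml => /andP[]; lra.
have sr : simplex_ge (dA / 2) (rho t) by split=> //; case: (ex_int ex ht).
split; last by split=> //; lra.
split=> //; split; first exact: skewE_gradG.
rewrite /=; apply: le_trans (hKg _) _.
have : Kg * `|phi t| <= Kg * (CA + 1) by rewrite ler_wpM2l.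
by have := ltW CA0; lra.
Qed.

Lemma interior_is_perturbed N tau rho0 (phi rho : 'I_N.+1 -> 'rV[R]_d) : 0 < tau ->
  interior_solution G H F UT tau rho0 phi rho ->
  perturbed_scheme G Hb B g tau phi rho (fun=> 0) (fun=> 0).
Proof.
move=> tau0 [[_ fin hphi hrho] ir].
have E (x y : 'rV[R]_d) : tau^-1 *: x = y -> x = tau *: (y + 0).
  by move=> <-; rewrite addr0 scalerA divff ?scale1r // gt_eqF.
split=> // n; apply: E.
  by rewrite hphi.
by rewrite hrho /coeff_B; congr (_ + _); rewrite linearN.
Qed.

Lemma discrete_bounds eps : 0 < eps -> exists dl C, [/\ 0 < dl, 0 < C &
  forall rho0 N (phi rho : 'I_N.+1 -> 'rV[R]_d), simplex_ge eps rho0 -> (0 < N)%N ->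
    interior_solution G H F UT (T / N%:R) rho0 phi rho -> forall k,
    [/\ simplex_ge dl (rho k), `|phi k| <= C & `|gradG G (phi k)| <= C]].
Proof.
move=> e0.
have SB x p : simplex_int x -> S p -> S (B x p) by exact: (skewE_coeff_B hP).
have [dA [CA [sg [[dA0 CA0 sg0] hap]]]] := apriori_bounds d0 hA SB T0 e0.
exists dA, CA; split=> // rho0 N phi rho ge0 N0 sol k.
have tau0 : 0 < T / N%:R by rewrite divr_gt0 ?ltr0n.
have [[i0 _ _ _] ir] := sol.
have [|||||a b c] := hap N _ phi rho (fun=> 0) (fun=> 0) tau0 _
  (interior_is_perturbed tau0 sol) _ _ _ _ k.
- by rewrite divfK // pnatr_eq0 -lt0n.
- by rewrite i0.
- by move=> n i; rewrite mxE normr0.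
- by move=> n; rewrite dot0r.
- by move=> n i; rewrite mxE oppr_le0 ltW.
by split=> //; split=> //; case: (ir k).
Qed.

(** The exact and the discrete solution stay in a common compact set of states that
   does not depend on the step, where the stability estimate applies. *)
Lemma convergence eps : 0 < eps -> exists2 Ct, 0 < Ct &
  forall rho0 N (phi rho : 'I_N.+1 -> 'rV[R]_d), simplex_ge eps rho0 -> (0 < N)%N ->
    interior_solution G H F UT (T / N%:R) rho0 phi rho ->
    forall phit rhot, exact_solution G Hb B g T rho0 phit rhot ->
    scheme_error G (T / N%:R) phit rhot phi rho <= Ct * (T / N%:R).
Proof.
move=> e0.
have [d1 [C1 [d10 C10 hex]]] := exact_bounds e0.
have [d2 [C2 [d20 C20 hdi]]] := discrete_bounds e0.
pose dl := Num.min d1 d2; pose C := Num.max C1 C2.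
have dl0 : 0 < dl by rewrite lt_min d10.
have C0 : 0 <= C by rewrite le_max C10.
have [K pc] := phase_constants_exist hP dl0 C0.
have K0 := pc_ge0 pc.
have [m m0 mono] := coeff_monotone hP C dl0.
have [Cp Cp0 poin] := poincare G.
have [KU KU0 lipU] := UT_lipschitz hP.
pose Rc := res_const C K.
have Rc0 : 0 <= Rc by exact: res_const_ge0 C0 pc.
pose k3 := @energy_const R d T m Cp Rc.
pose k4 := @density_const R d T K m Cp Rc.
pose k5 := @value_const R d T K m Cp KU Rc.
have k30 : 0 <= k3.
  rewrite /k3 /energy_const divr_ge0 ?sqr_ge0 // mulr_ge0 ?(ltW T0) // mulr_ge0 ?sqr_ge0 //.
  by rewrite addr_ge0 ?sqr_ge0.
have T0' := ltW T0.
have k40 : 0 <= k4.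
  have RT : 0 <= Rc * T by rewrite mulr_ge0.
  by rewrite /k4 /density_const addr_ge0 // mulr_ge0 // addr_ge0 // mulr_ge0.
have k50 : 0 <= k5.
  have RT : 0 <= Rc * T by rewrite mulr_ge0.
  by rewrite /k5 /value_const addr_ge0 ?mulr_ge0 // addr_ge0 // mulr_ge0 // addr_ge0.
exists (d%:R * (k4 + k5) + d%:R * (k3 + 1)).
  have A : 0 <= d%:R * (k4 + k5) by rewrite mulr_ge0 // addr_ge0.
  by rewrite ltr_wpDl // pmulr_rgt0 ?ltr0n //; lra.
move=> rho0 N phi rho ge0 N0 sol phit rhot ex.
set tau := T / N%:R.
have t0 : 0 < tau by rewrite divr_gt0 ?ltr0n.
have tN : tau * N%:R = T by exact: tauN.
have le1 : dl <= d1 by rewrite ge_min lexx.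
have le2 : dl <= d2 by rewrite ge_min lexx orbT.
have Cl1 : C1 <= C by rewrite le_max lexx.
have Cl2 : C2 <= C by rewrite le_max lexx orbT.
have inphase t : 0 <= t <= T -> [/\ simplex_ge dl (rhot t), `|phit t| <= C &
    phase G dl C (rhot t, gradG G (phit t))].
  move=> ht; have [p1 [s1 n1]] := hex _ _ _ ge0 ex _ ht.
  split; [|exact: le_trans Cl1|exact: phase_weaken p1].
  by split; [case: s1|move=> i; apply: le_trans le1 _; case: s1].
have rb n := residual_bound T0 ex C0 pc inphase N0 n.
have in1 (n : 'I_N) : phase G dl C (sample T rhot (hi n), gradG G (sample T phit (lo n))).
  have [|_ _ [h _]] := inphase ((hi n)%:R * tau); first exact: (grid_in T0 N0 (ltn_ord n)).
  have [|_ _ [_ h']] := inphase ((lo n)%:R * tau).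
    exact: (grid_in T0 N0 (ltnW (ltn_ord n))).
  by split.
have in2 (n : 'I_N) : phase G dl C (rho (hi n), gradG G (phi (lo n))).
  have [h _ _] := hdi _ _ _ _ ge0 N0 sol (hi n).
  have [_ _ h'] := hdi _ _ _ _ ge0 N0 sol (lo n).
  by apply: (phase_weaken le2 Cl2); split=> //; split=> //; exact: skewE_gradG.
have ps1 := sample_scheme T0 ex N0.
have ps2 := interior_is_perturbed t0 sol.
have start : sample T rhot (ord0 : 'I_N.+1) = rho ord0.
  by have [[-> _ _ _] _] := sol; rewrite -(ex_init ex) /sample mul0r.
have E1 := rho_error hP t0 tN ps1 ps2 start in1 in2 pc m0 mono Cp0 poin Rc0
  (fun n => proj1 (rb n)) (fun n => proj2 (rb n)).
have E2 := phi_error hP t0 tN ps1 ps2 start in1 in2 pc m0 mono Cp0 poin KU0 lipU Rc0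
  (fun n => proj1 (rb n)) (fun n => proj2 (rb n)).
have E3 := gradient_error hP t0 tN ps1 ps2 start in1 in2 m0 mono Cp0 poin Rc0
  (fun n => proj1 (rb n)) (fun n => proj2 (rb n)).
have D0 : 0 <= d%:R :> R by [].
rewrite mulrDl; apply: lerD.
  apply/bigmax_leP; split=> [|k _].
    by rewrite mulr_ge0 ?(ltW t0) // mulr_ge0 // addr_ge0.
  apply: le_trans (lerD (norm2_le _) (norm2_le _)) _.
  rewrite -mulrDr -mulrA mulrDl ler_wpM2l //; apply: lerD; first exact: E1.
  exact: E2.
have q0 : 0 <= d%:R * (k3 + 1) * tau.
  by rewrite mulr_ge0 ?(ltW t0) // mulr_ge0 // addr_ge0.
rewrite -[leRHS]ger0_norm // -sqrtr_sqr ler_wsqrtr //.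
apply: (@le_trans _ _ (d%:R ^+ 2 * (k3 * tau ^+ 2))); last first.
  have -> : (d%:R * (k3 + 1) * tau) ^+ 2 = d%:R ^+ 2 * ((k3 + 1) ^+ 2 * tau ^+ 2) by ring.
  rewrite ler_wpM2l ?sqr_ge0 // ler_wpM2r ?sqr_ge0 //.
  by have := sqr_ge0 k3; rewrite sqrrD expr1n mulr1; lra.
apply: le_trans (ler_wpM2l (sqr_ge0 _) E3).
rewrite mulrCA ler_pM2l // mulr_sumr; apply: ler_sum => n _.
rewrite -exprMn ler_sqr ?nnegrE ?sqrtr_ge0 ?mulr_ge0 //.
by apply: le_trans (normE_le _ _) _; rewrite -linearB.
Qed.

End Convergence.

Unset Implicit Arguments.
Set Strict Implicit.

Theorem theorem3p2 (R : realType) (d : nat) (G : wgraph R d) (T : R)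
    (H : 'rV[R]_d -> 'M[R]_d -> R) (F UT : 'rV[R]_d -> R)
    (L : 'rV[R]_d -> 'M[R]_d -> \bar R)
    (d_ge2 : (2 <= d)%N) (T_gt0 : 0 < T)
    (HL : legendre_dual G H L)
    (hP : assumption_P G H F UT) (hL : assumption_L G L) :
  (forall (rho0 : 'rV[R]_d) (N : nat), simplex_int rho0 -> (0 < N)%N ->
     let tau := T / N%:R in
     [/\ exists (rhos : 'I_N.+1 -> 'rV[R]_d) (ms : 'I_N -> 'M[R]_d),
           [/\ minimizer G F UT L tau rho0 rhos ms,
               forall rho m, minimizer G F UT L tau rho0 rho m ->
                 rho = rhos /\ m = ms,
               forall n, simplex_int (rhos n) &
               exists2 phi : 'I_N -> 'rV[R]_d,
                 unique (fun psi : 'I_N -> 'rV[R]_d =>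
                           (forall n, zero_sum (psi n)) /\
                           KKT G F UT L tau rhos ms psi) phi &
                 exists! a : 'I_N -> R,
                   scheme G H F UT tau rho0 (lifted UT rhos phi a) rhos],
         forall phi rho : 'I_N.+1 -> 'rV[R]_d,
           interior_solution G H F UT tau rho0 phi rho ->
           minimizer G F UT L tau rho0 rho (flux G H phi rho) &
         exists phi rho : 'I_N.+1 -> 'rV[R]_d,
           interior_solution G H F UT tau rho0 phi rho]) /\
  (assumption_A G (coeff_H H F) (coeff_B G H) (grad_rho UT) ->
   forall eps : R, 0 < eps < d%:R^-1 ->
   exists deltaT CT tau0 CtT : R,
     [/\ 0 < deltaT, 0 < CT, 0 < tau0 & 0 < CtT] /\
     forall (rho0 : 'rV[R]_d) (N : nat), simplex_ge eps rho0 -> (0 < N)%N ->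
     let tau := T / N%:R in
     forall phi rho : 'I_N.+1 -> 'rV[R]_d,
       interior_solution G H F UT tau rho0 phi rho ->
       [/\ forall n i, deltaT <= rho n 0 i,
           forall n, norm_inf (phi n) + normE_inf G (gradG G (phi n)) <= CT &
           tau <= tau0 ->
           forall phit rhot : R -> 'rV[R]_d,
             exact_solution G (coeff_H H F) (coeff_B G H) (grad_rho UT) T rho0
               phit rhot ->
             scheme_error G tau phit rhot phi rho <= CtT * tau]).
Proof.
have d_gt0 : (0 < d)%N by exact: ltnW.
split=> [rho0 N ir0 N0 tau|hA eps /andP[eps_gt0 _]].
  have tau0 : 0 < tau by rewrite divr_gt0 ?ltr0n.
  have [g [U [oU KU C1]] Lg0] := L_C1 hL.
  have dg x w : simplex_int x -> skewE G w -> differentiable g (x, w).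
    by move=> ix Sw; case: (C1 (x, w) (KU (x, w) (conj ix Sw))).
  have Lg x w : simplex_int x -> skewE G w -> fine (L x w) = g (x, w).
    by move=> ix Sw; exact: (Lg0 (x, w)).
  have [rho [m mi]] := minimizer_exists hP hL tau0 N0 ir0.
  have ir := minimizer_interior hL tau0 ir0 mi.
  have [[sr Sm r0 G0] _] := mi.
  have [phi [zphi st]] := multipliers_exist d_gt0 dg tau0 ir Sm
    (fun eta zeta => minimizer_stationary hP hL dg Lg tau0 ir0 mi).
  have ex_a := scheme_of_multipliers d_gt0 HL hP hL dg Lg tau0 ir Sm r0 G0 st.
  split.
  - exists rho, m; split=> //.
      move=> rho' m' mi'; exact: (minimizer_unique hP hL tau0 ir0 mi' mi).
    exists phi => //; split.
      by split=> //; apply/(KKT_d_lagrangian hP hL dg Lg).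
    move=> psi [zpsi /(KKT_d_lagrangian hP hL dg Lg) h].
    have [_ st'] := h ir Sm.
    exact: (multipliers_unique tau0 ir Sm zphi zpsi st st').
  - by move=> Phi r; exact: (scheme_minimizer HL hP hL dg Lg tau0).
  - by have [a [sa _]] := ex_a; exists (lifted UT rho phi a), rho.
have [dl [C [dl_gt0 C_gt0 bounds]]] := discrete_bounds d_gt0 hP hA T_gt0 eps_gt0.
have [Ct Ct_gt0 error] := convergence d_gt0 hP hA T_gt0 eps_gt0.
exists dl, (C + C), 1, Ct; split; first by rewrite addr_gt0.
move=> rho0 N rho0_ge N_gt0 tau phi rho sol; split=> [n i|n|_ phit rhot ex].
- by have [[_]] := bounds _ _ _ _ rho0_ge N_gt0 sol n.
- have [_ phi_le grad_le] := bounds _ _ _ _ rho0_ge N_gt0 sol n.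
  apply: lerD; first exact: le_trans (norm_inf_le _) phi_le.
  exact: le_trans (normE_inf_le _ _) grad_le.
- exact: (error _ _ _ _ rho0_ge N_gt0 sol _ _ ex).
Qed.
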